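(* Let $\mathfrak g\subseteq\mathrm{Der}(A_1)$ be a finite-dimensional non-abelian Lie subalgebra. Then $\mathfrak g$ is isomorphic to one of the following: 1) $\mathfrak{sl}(2)$; 2) $\mathfrak{sl}(2)\ltimes\mathbb C^2$; 3) $\mathcal L_n$ for some $n\ge2$; 4) $\tilde{\mathcal L}_n/\mathbb C$ for some $n\geq 2$; 5) $\mathfrak r(i_1,\dots,i_n)$ for some $n\ge 1$ and integers $0<i_1<\dots<i_n$.
   Context: The Weyl algebra $A_1$ is the complex associative unital algebra generated by $p,q$ with $pq-qp=1$. $\mathrm{Der}(A_1)$ is the complex Lie algebra of derivations of $A_1$, with commutator bracket. $\mathfrak{sl}(2)=\mathfrak{sl}(2,\mathbb C)$ and $\mathfrak{sl}(2)\ltimes\mathbb C^2$ is the semi-direct product for the standard representation, with $\mathbb C^2$ an abelian ideal. $\mathcal L_n$ has basis $X_0,\dots,X_n$ with only non-zero brackets (up to antisymmetry) $[X_0,X_k]=X_{k+1}$, $k=1,\dots,n-1$. $\tilde{\mathcal L}_n$ has basis $h,X_0,\dots,X_n$ with only non-zero brackets $[h,X_0]=X_0$, $[h,X_k]=-(n-k)X_k$ for $k=1,\dots,n$, $[X_0,X_k]=X_{k+1}$ for $k=1,\dots,n-1$; $\tilde{\mathcal L}_n/\mathbb C$ is its quotient by the central ideal $\mathbb CX_n$. $\mathfrak r(i_1,\dots,i_n)$ has basis $h,X_1,\dots,X_n$ with only non-zero brackets $[h,X_k]=-i_kX_k$, $k=1,\dots,n$. *)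

(* Defs.v *)
From HB Require Import structures.
From mathcomp Require Import all_boot all_order all_algebra.
From mathcomp Require Import generic_quotient ring_quotient.
From mathcomp Require Import ring.
From mathcomp Require Import boolp functions reals.
From mathcomp Require Import complex.

Set Implicit Arguments.
Unset Strict Implicit.
Unset Printing Implicit Defensive.

Import GRing.Theory.

Local Open Scope ring_scope.
Local Open Scope quotient_scope.

Fact addr_leibniz (V : zmodType) (x y z t u w : V) :
  (x + y) + (z + t) - ((u + z) + (y + w)) = (x - u) + (t - w).
Proof.
rewrite [u + z + _]addrC [z + t]addrC [u + z]addrC opprD addrACA !addrKA.
by rewrite addrACA [RHS]addrACA [- w - u]addrC.
Qed.

Fact addr_jacobi (V : zmodType) (p1 p2 p3 p4 p5 p6 : V) :
  (p1 - p2 - (p3 - p6)) + (p3 - p4 - (p5 - p2)) + (p5 - p6 - (p1 - p4)) = 0.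
Proof.
have E (a b c d : V) : a - b - (c - d) = (a - c) + (d - b).
  by rewrite opprB [d - c]addrC addrACA [d - b]addrC.
rewrite !E [X in X + _ = _]addrACA !subrKA addrACA !subrKA.
by rewrite !subrr addr0.
Qed.

HB.mixin Record isLieAlgebra (K : fieldType) L of GRing.Lmodule K L := {
  lie : L -> L -> L;
  lie_linearl : forall (a : K) x y z, lie (a *: x + y) z = a *: lie x z + lie y z;
  lie_linearr : forall (a : K) x y z, lie z (a *: x + y) = a *: lie z x + lie z y;
  liexx : forall x, lie x x = 0;
  lie_jacobi : forall x y z,
    lie x (lie y z) + lie y (lie z x) + lie z (lie x y) = 0
}.

#[short(type="lieAlgType")]
HB.structure Definition LieAlgebra (K : fieldType) :=
  {L of GRing.Lmodule K L & isLieAlgebra K L}.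

Notation "[ 'Lie' x , y ]" := (lie x y)
  (at level 0, format "[ 'Lie'  x ,  y ]") : ring_scope.

Definition lie_isomorphic (K : fieldType) (L M : lieAlgType K) : Prop :=
  exists f : {linear L -> M},
    bijective f /\ forall x y, f [Lie x, y] = [Lie f x, f y].

Definition lie_abelian (K : fieldType) (L : lieAlgType K) : Prop :=
  forall x y : L, [Lie x, y] = 0.

Definition finite_dimensional (K : fieldType) (V : lmodType K) : Prop :=
  exists (n : nat) (v : 'I_n -> V),
    forall x, exists a : 'I_n -> K, x = \sum_(i < n) a i *: v i.

Section LieSubalgebra.
Variables (K : fieldType) (L : lieAlgType K).

Record lieSubalg := LieSubalg {
  lsub_pred :> {pred L};
  lsub_submod : submod_closed lsub_pred;
  lsub_lie : {in lsub_pred &, forall x y, [Lie x, y] \in lsub_pred}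
}.

Record lsub_type (g : lieSubalg) := LSub {
  lsub_val : L;
  lsub_valP : lsub_val \in lsub_pred g
}.

Variable g : lieSubalg.

HB.instance Definition _ := [isSub for @lsub_val g].
HB.instance Definition _ := [Choice of lsub_type g by <:].

Fact lsub_subsemimod : subsemimod_closed (lsub_pred g).
Proof.
case: (lsub_submod g) => g0 gl; split; last first.
  by move=> a x gx; rewrite -[_ *: _]addr0 gl.
by split=> // x y gx gy; rewrite -[x]scale1r gl.
Qed.

HB.instance Definition _ :=
  GRing.SubChoice_isSubLmodule.Build K L (lsub_pred g) (lsub_type g) lsub_subsemimod.

Definition lsub_bracket (x y : lsub_type g) : lsub_type g :=
  LSub (lsub_lie (lsub_valP x) (lsub_valP y)).

Fact lsub_bracketl (a : K) (x y z : lsub_type g) :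
  lsub_bracket (a *: x + y) z = a *: lsub_bracket x z + lsub_bracket y z.
Proof.
by apply: val_inj; exact: lie_linearl.
Qed.

Fact lsub_bracketr (a : K) (x y z : lsub_type g) :
  lsub_bracket z (a *: x + y) = a *: lsub_bracket z x + lsub_bracket z y.
Proof.
by apply: val_inj; exact: lie_linearr.
Qed.

Fact lsub_bracketxx (x : lsub_type g) : lsub_bracket x x = 0.
Proof. by apply: val_inj; exact: liexx. Qed.

Fact lsub_jacobi (x y z : lsub_type g) :
  lsub_bracket x (lsub_bracket y z) + lsub_bracket y (lsub_bracket z x)
  + lsub_bracket z (lsub_bracket x y) = 0.
Proof. by apply: val_inj; exact: lie_jacobi. Qed.

HB.instance Definition _ := isLieAlgebra.Build K (lsub_type g)
  lsub_bracketl lsub_bracketr lsub_bracketxx lsub_jacobi.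

End LieSubalgebra.

Coercion lsub_type : lieSubalg >-> Sortclass.

Section LieQuotient.
Variables (K : fieldType) (L : lieAlgType K).

Record lieIdeal := LieIdeal {
  lideal_pred :> {pred L};
  lideal_submod : submod_closed lideal_pred;
  lideal_lie : forall x y, y \in lideal_pred -> [Lie x, y] \in lideal_pred
}.

Variable I : lieIdeal.

Fact lideal_subsemimod : subsemimod_closed (lideal_pred I).
Proof.
case: (lideal_submod I) => I0 Il; split; last first.
  by move=> a x Ix; rewrite -[_ *: _]addr0 Il.
by split=> // x y Ix Iy; rewrite -[x]scale1r Il.
Qed.

HB.instance Definition _ :=
  GRing.isSubmodClosed.Build K L (lideal_pred I) lideal_subsemimod.

Definition lie_quot : Type := Quotient.quot (lideal_pred I).

HB.instance Definition _ := GRing.Zmodule.on lie_quot.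

Definition lquot_pi (x : L) : lie_quot := \pi_(Quotient.quot (lideal_pred I)) x.
Definition lquot_repr (x : lie_quot) : L :=
  @repr _ (Quotient.quot (lideal_pred I) : quotType L) x.

Fact lquot_reprK : cancel lquot_repr lquot_pi.
Proof. exact: reprK. Qed.

Fact lquot_eq x y : reflect (lquot_pi x = lquot_pi y) (x - y \in lideal_pred I).
Proof.
apply: (iffP idP).
  by rewrite (Quotient.idealrBE (lideal_pred I)) => /eqP.
by move=> exy; rewrite (Quotient.idealrBE (lideal_pred I)); apply/eqP.
Qed.

Fact lquot_piD x y : lquot_pi (x + y) = lquot_pi x + lquot_pi y.
Proof. exact: (raddfD (\pi_(Quotient.quot (lideal_pred I)))). Qed.

Fact lquot_pi0 : lquot_pi 0 = 0.
Proof. exact: (raddf0 (\pi_(Quotient.quot (lideal_pred I)))). Qed.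

Definition lquot_scale (a : K) (x : lie_quot) : lie_quot :=
  lquot_pi (a *: lquot_repr x).
Definition lquot_bracket (x y : lie_quot) : lie_quot :=
  lquot_pi [Lie lquot_repr x, lquot_repr y].

Fact lquot_piZ a x : lquot_pi (a *: x) = lquot_scale a (lquot_pi x).
Proof.
by apply/lquot_eq; rewrite -scalerBr rpredZ //; apply/lquot_eq; rewrite lquot_reprK.
Qed.

Fact lieBl (x y z : L) : [Lie x - y, z] = [Lie x, z] - [Lie y, z].
Proof. by rewrite addrC -scaleN1r lie_linearl scaleN1r addrC. Qed.

Fact lieBr (x y z : L) : [Lie z, x - y] = [Lie z, x] - [Lie z, y].
Proof. by rewrite addrC -scaleN1r lie_linearr scaleN1r addrC. Qed.

Fact lie_anti (x y : L) : [Lie x, y] = - [Lie y, x].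
Proof.
have := liexx (x - y).
rewrite lieBl !lieBr !liexx subr0 sub0r -opprD => /eqP.
by rewrite oppr_eq0 addr_eq0 => /eqP.
Qed.

Fact lquot_pi_bracket x y :
  lquot_pi [Lie x, y] = lquot_bracket (lquot_pi x) (lquot_pi y).
Proof.
apply/lquot_eq; set x' := lquot_repr _; set y' := lquot_repr _.
have Ix : x - x' \in lideal_pred I by apply/lquot_eq; rewrite lquot_reprK.
have Iy : y - y' \in lideal_pred I by apply/lquot_eq; rewrite lquot_reprK.
have -> : [Lie x, y] - [Lie x', y'] = [Lie x - x', y] + [Lie x', y - y'].
  by rewrite lieBl lieBr addrA subrK.
rewrite rpredD //; last exact: lideal_lie.
by rewrite lie_anti rpredN; exact: lideal_lie.
Qed.

Fact lquot_scalerA a b v :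
  lquot_scale a (lquot_scale b v) = lquot_scale (a * b) v.
Proof. by rewrite -[v]lquot_reprK -!lquot_piZ scalerA. Qed.

Fact lquot_scale1r : left_id 1 lquot_scale.
Proof. by move=> v; rewrite -[v]lquot_reprK -!lquot_piZ scale1r. Qed.

Fact lquot_scalerDr : right_distributive lquot_scale +%R.
Proof.
move=> a u v; rewrite -[u]lquot_reprK -[v]lquot_reprK.
by rewrite -lquot_piD -!lquot_piZ -lquot_piD scalerDr.
Qed.

Fact lquot_scalerDl v : {morph lquot_scale^~ v : a b / a + b}.
Proof.
by move=> a b; rewrite -[v]lquot_reprK -!lquot_piZ -lquot_piD scalerDl.
Qed.

HB.instance Definition _ := GRing.Zmodule_isLmodule.Build K lie_quot
  lquot_scalerA lquot_scale1r lquot_scalerDr lquot_scalerDl.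

Fact lquot_pi_linear a x y : lquot_pi (a *: x + y) = a *: lquot_pi x + lquot_pi y.
Proof. by rewrite lquot_piD lquot_piZ. Qed.

Fact lquot_bracketl (a : K) (x y z : lie_quot) :
  lquot_bracket (a *: x + y) z = a *: lquot_bracket x z + lquot_bracket y z.
Proof.
rewrite -[x]lquot_reprK -[y]lquot_reprK -[z]lquot_reprK.
by rewrite -lquot_pi_linear -!lquot_pi_bracket lie_linearl lquot_pi_linear.
Qed.

Fact lquot_bracketr (a : K) (x y z : lie_quot) :
  lquot_bracket z (a *: x + y) = a *: lquot_bracket z x + lquot_bracket z y.
Proof.
rewrite -[x]lquot_reprK -[y]lquot_reprK -[z]lquot_reprK.
by rewrite -lquot_pi_linear -!lquot_pi_bracket lie_linearr lquot_pi_linear.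
Qed.

Fact lquot_bracketxx (x : lie_quot) : lquot_bracket x x = 0.
Proof. by rewrite -[x]lquot_reprK -lquot_pi_bracket liexx lquot_pi0. Qed.

Fact lquot_jacobi (x y z : lie_quot) :
  lquot_bracket x (lquot_bracket y z) + lquot_bracket y (lquot_bracket z x)
  + lquot_bracket z (lquot_bracket x y) = 0.
Proof.
rewrite -[x]lquot_reprK -[y]lquot_reprK -[z]lquot_reprK.
by rewrite -!lquot_pi_bracket -!lquot_piD lie_jacobi lquot_pi0.
Qed.

HB.instance Definition _ := isLieAlgebra.Build K lie_quot
  lquot_bracketl lquot_bracketr lquot_bracketxx lquot_jacobi.

End LieQuotient.

Section Derivations.
Variables (K : fieldType) (A : algType K).

Definition is_derivation : {pred A -> A} := fun D =>
  `[< linear D /\ forall a b, D (a * b) = D a * b + a * D b >].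

Record derivation := Derivation {
  der_fun :> A -> A;
  der_funP : der_fun \in is_derivation
}.

HB.instance Definition _ := [isSub for der_fun].
HB.instance Definition _ := [Choice of derivation by <:].

Fact fctZE (a : K) (D : A -> A) x : (a *: D) x = a *: D x.
Proof. by []. Qed.

Fact is_derivation_subsemimod : subsemimod_closed is_derivation.
Proof.
split=> [|a D /asboolP [Dl DM]].
  split=> [|D E /asboolP [Dl DM] /asboolP [El EM]].
    apply/asboolP; split=> [a u v|a b].
      by rewrite [LHS]/(0 : A) scaler0 addr0.
    by rewrite [LHS]/(0 : A) mul0r mulr0 addr0.
  apply/asboolP; split=> [a u v|a b] /=; rewrite /GRing.add /=.
    by rewrite Dl El scalerDr addrACA.
  by rewrite DM EM mulrDl mulrDr addrACA.
apply/asboolP; split=> [b u v|b c].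
  by rewrite !fctZE Dl scalerDr !scalerA mulrC.
by rewrite !fctZE DM scalerDr scalerAl scalerAr.
Qed.

HB.instance Definition _ := GRing.SubChoice_isSubLmodule.Build K (A -> A)
  is_derivation derivation is_derivation_subsemimod.

Fact derP (D : derivation) :
  linear D /\ forall a b, D (a * b) = D a * b + a * D b.
Proof. by have /asboolP := der_funP D. Qed.

Fact der_linear (D : derivation) : linear D.
Proof. by case: (derP D). Qed.

Fact derD (D : derivation) a b : D (a + b) = D a + D b.
Proof. by rewrite -[a]scale1r der_linear !scale1r. Qed.

Fact derB (D : derivation) a b : D (a - b) = D a - D b.
Proof. by rewrite addrC -scaleN1r der_linear scaleN1r addrC. Qed.

Fact derM (D : derivation) a b : D (a * b) = D a * b + a * D b.
Proof. by case: (derP D). Qed.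

Fact der_commP (D E : derivation) : (fun a => D (E a) - E (D a)) \in is_derivation.
Proof.
apply/asboolP; split=> [a u v|a b].
  by rewrite !der_linear opprD addrACA -scalerBr.
by rewrite !derM !derD !derM mulrBl mulrBr addr_leibniz.
Qed.

Definition der_bracket (D E : derivation) : derivation :=
  Derivation (der_commP D E).

Fact der_bracketE (D E : derivation) x :
  der_bracket D E x = D (E x) - E (D x).
Proof. by []. Qed.

Fact der_ext (D E : derivation) : D =1 E -> D = E.
Proof. by move=> eDE; apply: val_inj; apply/funext. Qed.

Fact derDE (D E : derivation) x : (D + E) x = D x + E x.
Proof. by []. Qed.

Fact derZE (a : K) (D : derivation) x : (a *: D) x = a *: D x.
Proof. by []. Qed.

Fact der_bracketl (a : K) (x y z : derivation) :
  der_bracket (a *: x + y) z = a *: der_bracket x z + der_bracket y z.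
Proof.
apply: der_ext => u; rewrite derDE derZE !der_bracketE !derDE !derZE.
by rewrite der_linear opprD addrACA -scalerBr.
Qed.

Fact der_bracketxx (x : derivation) : der_bracket x x = 0.
Proof. by apply: der_ext => u; rewrite der_bracketE subrr. Qed.

Fact der_bracketr (a : K) (x y z : derivation) :
  der_bracket z (a *: x + y) = a *: der_bracket z x + der_bracket z y.
Proof.
apply: der_ext => u; rewrite derDE derZE !der_bracketE !derDE !derZE.
by rewrite der_linear opprD addrACA -scalerBr.
Qed.

Fact der_jacobi (x y z : derivation) :
  der_bracket x (der_bracket y z) + der_bracket y (der_bracket z x)
  + der_bracket z (der_bracket x y) = 0.
Proof.
apply: der_ext => u; rewrite !derDE !der_bracketE !derB [RHS]/(0 : A).
exact: addr_jacobi.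
Qed.

HB.instance Definition _ := isLieAlgebra.Build K derivation
  der_bracketl der_bracketr der_bracketxx der_jacobi.

End Derivations.

Section MatrixLie.
Variables (K : fieldType) (n : nat).

Definition mx_bracket (M N : 'M[K]_n) : 'M[K]_n := M *m N - N *m M.

Fact mx_bracketl (a : K) (x y z : 'M[K]_n) :
  mx_bracket (a *: x + y) z = a *: mx_bracket x z + mx_bracket y z.
Proof.
by rewrite /mx_bracket mulmxDl mulmxDr -scalemxAl -scalemxAr opprD addrACA -scalerBr.
Qed.

Fact mx_bracketr (a : K) (x y z : 'M[K]_n) :
  mx_bracket z (a *: x + y) = a *: mx_bracket z x + mx_bracket z y.
Proof.
by rewrite /mx_bracket mulmxDl mulmxDr -scalemxAl -scalemxAr opprD addrACA -scalerBr.
Qed.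

Fact mx_bracketxx (x : 'M[K]_n) : mx_bracket x x = 0.
Proof. exact: subrr. Qed.

Fact mx_jacobi (x y z : 'M[K]_n) :
  mx_bracket x (mx_bracket y z) + mx_bracket y (mx_bracket z x)
  + mx_bracket z (mx_bracket x y) = 0.
Proof.
rewrite /mx_bracket !mulmxBl !mulmxBr !mulmxA; exact: addr_jacobi.
Qed.

HB.instance Definition _ := isLieAlgebra.Build K 'M[K]_n
  mx_bracketl mx_bracketr mx_bracketxx mx_jacobi.

Definition traceless : {pred 'M[K]_n} := fun M => \tr M == 0.

Fact traceless_submod : submod_closed traceless.
Proof.
split=> [|a M N /eqP trM /eqP trN]; first by apply/eqP; rewrite mxtrace0.
by apply/eqP; rewrite mxtraceD mxtraceZ trM trN mulr0 addr0.
Qed.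

Fact traceless_lie : {in traceless &, forall M N, [Lie M, N] \in traceless}.
Proof.
move=> M N _ _; apply/eqP.
by rewrite [[Lie M, N]]/(M *m N - N *m M) linearB /= mxtrace_mulC subrr.
Qed.

Definition sl : lieSubalg 'M[K]_n := LieSubalg traceless_submod traceless_lie.

End MatrixLie.

Section AffineSl.
Variables (K : fieldType) (n : nat).

Definition sl_std : Type := (sl K n * 'cV[K]_n)%type.

HB.instance Definition _ := GRing.Lmodule.on sl_std.

Definition sl_std_bracket (s t : sl_std) : sl_std :=
  ([Lie s.1, t.1], lsub_val s.1 *m t.2 - lsub_val t.1 *m s.2).

Fact sl_std_bracketl (a : K) (x y z : sl_std) :
  sl_std_bracket (a *: x + y) z = a *: sl_std_bracket x z + sl_std_bracket y z.
Proof.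
rewrite /sl_std_bracket; congr (_, _); first exact: lie_linearl.
rewrite [lsub_val _]/(a *: lsub_val x.1 + lsub_val y.1).
rewrite [(a *: x + y).2]/(a *: x.2 + y.2) mulmxDl mulmxDr -scalemxAl -scalemxAr.
by rewrite opprD addrACA -scalerBr.
Qed.

Fact sl_std_bracketr (a : K) (x y z : sl_std) :
  sl_std_bracket z (a *: x + y) = a *: sl_std_bracket z x + sl_std_bracket z y.
Proof.
rewrite /sl_std_bracket; congr (_, _); first exact: lie_linearr.
rewrite [lsub_val (a *: x + y).1]/(a *: lsub_val x.1 + lsub_val y.1).
rewrite [(a *: x + y).2]/(a *: x.2 + y.2) mulmxDl mulmxDr -scalemxAl -scalemxAr.
by rewrite opprD addrACA -scalerBr.
Qed.

Fact sl_std_bracketxx (x : sl_std) : sl_std_bracket x x = 0.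
Proof. by rewrite /sl_std_bracket liexx subrr. Qed.

Fact sl_std_jacobi (x y z : sl_std) :
  sl_std_bracket x (sl_std_bracket y z) + sl_std_bracket y (sl_std_bracket z x)
  + sl_std_bracket z (sl_std_bracket x y) = 0.
Proof.
apply/pair_equal_spec; split; first exact: lie_jacobi.
case: x y z => [[x ?] u] [[y ?] v] [[z ?] w] /=.
rewrite [[Lie y, z]]/(y *m z - z *m y) [[Lie z, x]]/(z *m x - x *m z).
rewrite [[Lie x, y]]/(x *m y - y *m x) !(mulmxBr, mulmxBl) !mulmxA.
exact: addr_jacobi.
Qed.

HB.instance Definition _ := isLieAlgebra.Build K sl_std
  sl_std_bracketl sl_std_bracketr sl_std_bracketxx sl_std_jacobi.

End AffineSl.

Section BracketTables.
Variables (K : fieldType) (I : finType).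

Definition basis_vec (i : I) : {ffun I -> K^o} := [ffun j => (j == i)%:R].

(* [c i j] is the contribution to [e_i, e_j], each nonzero bracket being listed *)
(* in one order only: the resulting bracket is the bilinear map with            *)
(* [e_i, e_j] = c i j - c j i.                                                  *)
Definition table_bracket (c : I -> I -> {ffun I -> K^o}) (x y : {ffun I -> K^o}) :
    {ffun I -> K^o} :=
  \sum_i \sum_j (x i * y j - x j * y i) *: c i j.

Fact table_bracket_basis (c : I -> I -> {ffun I -> K^o}) i j :
  table_bracket c (basis_vec i) (basis_vec j) = c i j - c j i.
Proof.
have E (a b : I) :
    \sum_i' \sum_j' (basis_vec a i' * basis_vec b j') *: c i' j' = c a b.
  rewrite (big_only1 a) // => [|i' ni _].
    rewrite (big_only1 b) // => [|j' nj _]; rewrite !ffunE ?eqxx ?mul1r ?scale1r //.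
    by rewrite (negPf nj) scale0r.
  by rewrite big1 // => j' _; rewrite ffunE (negPf ni) mul0r scale0r.
rewrite -[c i j]E -[c j i]E -sumrB; apply: eq_bigr => i' _.
rewrite -sumrB; apply: eq_bigr => j' _.
by rewrite -scalerBl; congr (_ *: _); rewrite [X in _ - X]mulrC.
Qed.

Record lieTable := LieTable {
  table_coef :> I -> I -> {ffun I -> K^o};
  table_jacobi : forall x y z,
    table_bracket table_coef x (table_bracket table_coef y z) +
    table_bracket table_coef y (table_bracket table_coef z x) +
    table_bracket table_coef z (table_bracket table_coef x y) = 0
}.

Fact table_bracketE (c : I -> I -> {ffun I -> K^o}) x y l :
  table_bracket c x y l = \sum_i \sum_j (x i * y j - x j * y i) * c i j l :> K.
Proof.
rewrite sum_ffunE; apply: eq_bigr => i _; rewrite sum_ffunE.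
by apply: eq_bigr => j _; rewrite ffunE.
Qed.

Definition table_lie (c : lieTable) : Type := {ffun I -> K^o}.

Variable c : lieTable.

HB.instance Definition _ := GRing.Lmodule.on (table_lie c).

Fact table_bracketl (a : K) (x y z : table_lie c) :
  table_bracket c (a *: x + y) z = a *: table_bracket c x z + table_bracket c y z.
Proof.
rewrite /table_bracket scaler_sumr -big_split; apply: eq_bigr => i _.
rewrite scaler_sumr -big_split; apply: eq_bigr => j _ /=.
rewrite !ffunE scalerA -scalerDl; congr (_ *: _).
by rewrite /GRing.scale /=; ring.
Qed.

Fact table_bracketr (a : K) (x y z : table_lie c) :
  table_bracket c z (a *: x + y) = a *: table_bracket c z x + table_bracket c z y.
Proof.
rewrite /table_bracket scaler_sumr -big_split; apply: eq_bigr => i _.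
rewrite scaler_sumr -big_split; apply: eq_bigr => j _ /=.
rewrite !ffunE scalerA -scalerDl; congr (_ *: _).
by rewrite /GRing.scale /=; ring.
Qed.

Fact table_bracketxx (x : table_lie c) : table_bracket c x x = 0.
Proof.
rewrite /table_bracket big1 // => i _; rewrite big1 // => j _.
by rewrite [x i * _]mulrC subrr scale0r.
Qed.

HB.instance Definition _ := isLieAlgebra.Build K (table_lie c)
  table_bracketl table_bracketr table_bracketxx (table_jacobi c).

End BracketTables.

Section Models.
Variable K : fieldType.

(* h = None and X_(k+1) = Some k. *)
Definition diag_coef n (i : 'I_n -> int) (a b : option 'I_n) :
    {ffun option 'I_n -> K^o} :=
  match a, b with
  | None, Some k => - (i k)%:~R *: basis_vec K (Some k)
  | _, _ => 0
  end.

Fact diag_bracketN n (i : 'I_n -> int) x y :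
  table_bracket (diag_coef i) x y None = 0 :> K.
Proof.
rewrite table_bracketE big1 // => a _; rewrite big1 // => b _.
by case: a b => [?|] [?|] /=; rewrite ffunE ?mulr0 // ffunE /= ?scaler0 mulr0.
Qed.

Fact diag_bracketS n (i : 'I_n -> int) x y k :
  table_bracket (diag_coef i) x y (Some k) =
  - (i k)%:~R * (x None * y (Some k) - x (Some k) * y None) :> K.
Proof.
rewrite table_bracketE (big_only1 None) //; last first.
  by move=> [a|] // _ _; rewrite big1 // => b _; rewrite ffunE mulr0.
rewrite (big_only1 (Some k)) //; last first.
  case=> [b|] /= ne _; last by rewrite ffunE mulr0.
  by rewrite !ffunE eq_sym (negPf ne) scaler0 mulr0.
by rewrite /= !ffunE eqxx /GRing.scale /= mulr1 mulrC.
Qed.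

Fact diag_jacobi n (i : 'I_n -> int) x y z :
  table_bracket (diag_coef i) x (table_bracket (diag_coef i) y z) +
  table_bracket (diag_coef i) y (table_bracket (diag_coef i) z x) +
  table_bracket (diag_coef i) z (table_bracket (diag_coef i) x y) = 0.
Proof.
apply/ffunP=> -[k|]; rewrite !ffunE.
  by rewrite !diag_bracketS !diag_bracketN; ring.
by rewrite !diag_bracketN !addr0.
Qed.

Definition diag_lie n (i : 'I_n -> int) : lieAlgType K :=
  table_lie (LieTable (@diag_jacobi n i)).

Definition filiform_coef n (a b : 'I_n.+1) : {ffun 'I_n.+1 -> K^o} :=
  if (a == ord0) && (0 < b < n)%N then basis_vec K (inord b.+1) else 0.

Fact filiform_sum n (F : 'I_n.+1 -> K) (l : 'I_n.+1) :
  \sum_b F b * filiform_coef ord0 b l =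
  if (1 < l)%N then F (inord l.-1) else 0.
Proof.
case: ifP => l1; last first.
  rewrite big1 // => b _; rewrite /filiform_coef eqxx /=.
  case: ifP => [/andP[b0 bn]|_]; rewrite ffunE ?mulr0 //.
  case: eqP => [el|]; rewrite ?mulr0 //; move: l1.
  by rewrite el inordK // ltnS b0.
have ln := ltn_ord l.
rewrite (big_only1 (inord l.-1)) // => [|b nb _]; rewrite /filiform_coef eqxx /=.
  rewrite inordK; last exact: leq_ltn_trans (leq_pred _) ln.
  case: l l1 ln => [[|[|l]] /= ln'] // _ ln; rewrite -ltnS ln ffunE.
  by case: eqP => [_|[]]; [rewrite mulr1 | apply: val_inj; rewrite /= inordK].
case: ifP => [/andP[b0 bn]|_]; rewrite ffunE ?mulr0 //.
case: eqP => [el|]; rewrite ?mulr0 //; case/eqP: nb; apply: val_inj => /=.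
by rewrite el !inordK //= ltnS ltnW.
Qed.

Fact filiform_bracket n x y (l : 'I_n.+1) :
  table_bracket (@filiform_coef n) x y l =
  (if (1 < l)%N then x ord0 * y (inord l.-1) - x (inord l.-1) * y ord0 else 0)
  :> K.
Proof.
rewrite table_bracketE (big_only1 ord0) //; first by rewrite filiform_sum.
move=> a na _; rewrite big1 // => b _.
by rewrite /filiform_coef (negPf na) ffunE mulr0.
Qed.

Fact filiform_jacobi n x y z :
  table_bracket (@filiform_coef n) x (table_bracket (@filiform_coef n) y z) +
  table_bracket (@filiform_coef n) y (table_bracket (@filiform_coef n) z x) +
  table_bracket (@filiform_coef n) z (table_bracket (@filiform_coef n) x y) = 0.
Proof.
apply/ffunP=> l; rewrite !ffunE !filiform_bracket /=.
by do 2?[case: ifP => _]; ring.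
Qed.

Definition filiform n : lieAlgType K := table_lie (LieTable (@filiform_jacobi n)).

(* h = None, X_k = Some k. *)
Definition filiform_ext_coef n (a b : option 'I_n.+1) :
    {ffun option 'I_n.+1 -> K^o} :=
  match a, b with
  | None, Some k =>
      if k == ord0 then basis_vec K (Some ord0)
      else - (n - k)%N%:R *: basis_vec K (Some k)
  | Some i, Some k =>
      if (i == ord0) && (0 < k < n)%N then basis_vec K (Some (inord k.+1)) else 0
  | _, _ => 0
  end.

Definition filiform_wt n (l : 'I_n.+1) : K :=
  if l == ord0 then 1 else - (n - l)%N%:R.

Fact filiform_ext_bracketN n x y :
  table_bracket (@filiform_ext_coef n) x y None = 0 :> K.
Proof.
rewrite table_bracketE big1 // => a _; rewrite big1 // => b _.
case: a b => [a|] [b|] /=; rewrite ?ffunE ?mulr0 //.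
  by case: ifP => _; rewrite ffunE ?mulr0 //= mulr0.
by case: ifP => _; rewrite !ffunE /= ?scaler0 mulr0.
Qed.

Fact filiform_ext_bracketS n x y (l : 'I_n.+1) :
  table_bracket (@filiform_ext_coef n) x y (Some l) =
  filiform_wt l * (x None * y (Some l) - x (Some l) * y None) +
  (if (1 < l)%N then
     x (Some ord0) * y (Some (inord l.-1)) - x (Some (inord l.-1)) * y (Some ord0)
   else 0) :> K.
Proof.
rewrite table_bracketE (bigD1 None) //; congr (_ + _).
  rewrite (big_only1 (Some l)) // => [|[b|] nb _] /=.
  - rewrite /filiform_wt; case: eqP => [->|_]; rewrite !ffunE eqxx.
      by rewrite mulr1 mul1r.
    by rewrite /GRing.scale /= mulr1 mulrC.
  - have {}nb : (Some l == Some b) = false by rewrite eq_sym (negPf nb).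
    case: eqP => [b0|_]; rewrite !ffunE -?b0 nb ?mulr0 //.
    by rewrite scaler0 mulr0.
  - by rewrite ffunE mulr0.
rewrite (bigD1 (Some ord0)) //= [X in _ + X]big1 ?addr0; last first.
  case=> [a|] //= na; rewrite big1 // => -[b|] _ /=; last by rewrite ffunE mulr0.
  have -> : (a == ord0) = false.
    by apply: contraNF na => /eqP ->.
  by rewrite /= ffunE mulr0.
rewrite (bigD1 None) //= ffunE mulr0 add0r.
rewrite -(filiform_sum (fun b =>
  x (Some ord0) * y (Some b) - x (Some b) * y (Some ord0))).
rewrite (reindex_omap Some id) => [|[]] //=.
apply: eq_big => [b|b _]; first by rewrite eqxx.
by rewrite /filiform_coef eqxx /=; case: ifP; rewrite !ffunE.
Qed.

Fact filiform_wt_pred n (l : 'I_n.+1) :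
  (1 < l)%N -> filiform_wt (inord l.-1 : 'I_n.+1) = filiform_wt l - 1.
Proof.
move=> l1; have ln := ltn_ord l; rewrite /filiform_wt -!val_eqE /= inordK.
  have -> : (l == 0 :> nat) = false by case: (val l) l1.
  have -> : (l.-1 == 0)%N = false by case: (val l) l1 => [|[]].
  have -> : (n - l.-1)%N = (n - l).+1.
    by case: (val l) l1 ln => [|k] //= _ ln; rewrite -subSn.
  by rewrite -addn1 natrD opprD.
exact: leq_ltn_trans (leq_pred _) ln.
Qed.

Fact filiform_ext_jacobi n x y z :
  table_bracket (@filiform_ext_coef n) x (table_bracket (@filiform_ext_coef n) y z) +
  table_bracket (@filiform_ext_coef n) y (table_bracket (@filiform_ext_coef n) z x) +
  table_bracket (@filiform_ext_coef n) z (table_bracket (@filiform_ext_coef n) x y)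
  = 0.
Proof.
apply/ffunP=> -[l|]; last by rewrite !ffunE !filiform_ext_bracketN !addr0.
rewrite !ffunE !filiform_ext_bracketS !filiform_ext_bracketN /=.
have -> : filiform_wt (ord0 : 'I_n.+1) = 1 by rewrite /filiform_wt eqxx.
have [l1|_] := ltnP 1 l; last by ring.
by rewrite (filiform_wt_pred l1); case: ifP => _; ring.
Qed.

Definition filiform_ext n : lieAlgType K :=
  table_lie (LieTable (@filiform_ext_jacobi n)).

(* The line spanned by X_n, which is central when n > 0. *)
Definition filiform_top n : {pred filiform_ext n} :=
  fun x => `[< exists a : K, x = a *: basis_vec K (Some ord_max) >].

Fact filiform_top_submod n : submod_closed (@filiform_top n).
Proof.
split=> [|a x y /asboolP [b ->] /asboolP [c ->]]; apply/asboolP.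
  by exists 0; rewrite scale0r.
by exists (a * b + c); rewrite scalerDl scalerA.
Qed.

Fact filiform_top_lie n (x y : filiform_ext n) :
  y \in @filiform_top n -> [Lie x, y] \in @filiform_top n.
Proof.
move=> /asboolP [a ->]; apply/asboolP.
set y0 := a *: _; exists (table_bracket (@filiform_ext_coef n) x y0 (Some ord_max)).
have y0N : y0 None = 0 :> K by rewrite !ffunE /= scaler0.
have y0S (k : 'I_n.+1) : (k < n)%N -> y0 (Some k) = 0 :> K.
  move=> kn; rewrite !ffunE (_ : _ == _ = false) ?scaler0 //.
  by apply/eqP => -[ek]; rewrite ek ltnn in kn.
apply/ffunP=> -[l|]; rewrite !ffunE /= ?scaler0 ?filiform_ext_bracketN //.
case: eqP => [[->]|nl]; first by rewrite /GRing.scale /= mulr1.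
rewrite scaler0 [LHS]filiform_ext_bracketS y0N !mulr0 subr0.
have ln : (l < n)%N.
  rewrite ltn_neqAle -ltnS ltn_ord andbT; apply/eqP => eln; apply: nl.
  by congr Some; apply: val_inj.
rewrite (y0S l) // !mulr0 add0r; case: ifP => // l1.
rewrite !y0S ?mulr0 ?subrr //=; first exact: leq_ltn_trans ln.
by rewrite inordK; apply: leq_ltn_trans (leq_pred _) _; rewrite // ltnW.
Qed.

Definition filiform_ext_mod n : lieAlgType K :=
  lie_quot (LieIdeal (@filiform_top_submod n) (@filiform_top_lie n)).

End Models.

Section Weyl.
Variable K : fieldType.

Inductive weyl_term :=
  | WP | WQ | WConst of K
  | WAdd of weyl_term & weyl_term
  | WMul of weyl_term & weyl_term.

(* The smallest congruence on terms whose quotient is an associative unital *)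
(* algebra (with structure map WConst) in which pq = qp + 1.               *)
Inductive weyl_eq : weyl_term -> weyl_term -> Prop :=
  | weyl_refl x : weyl_eq x x
  | weyl_sym x y : weyl_eq x y -> weyl_eq y x
  | weyl_trans y x z : weyl_eq x y -> weyl_eq y z -> weyl_eq x z
  | weyl_add x x' y y' :
      weyl_eq x x' -> weyl_eq y y' -> weyl_eq (WAdd x y) (WAdd x' y')
  | weyl_mul x x' y y' :
      weyl_eq x x' -> weyl_eq y y' -> weyl_eq (WMul x y) (WMul x' y')
  | weyl_addA x y z : weyl_eq (WAdd x (WAdd y z)) (WAdd (WAdd x y) z)
  | weyl_addC x y : weyl_eq (WAdd x y) (WAdd y x)
  | weyl_add0 x : weyl_eq (WAdd (WConst 0) x) x
  | weyl_mulA x y z : weyl_eq (WMul x (WMul y z)) (WMul (WMul x y) z)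
  | weyl_mul1 x : weyl_eq (WMul (WConst 1) x) x
  | weyl_mul0 x : weyl_eq (WMul (WConst 0) x) (WConst 0)
  | weyl_mulDl x y z : weyl_eq (WMul (WAdd x y) z) (WAdd (WMul x z) (WMul y z))
  | weyl_mulDr x y z : weyl_eq (WMul z (WAdd x y)) (WAdd (WMul z x) (WMul z y))
  | weyl_constD a b : weyl_eq (WConst (a + b)) (WAdd (WConst a) (WConst b))
  | weyl_constM a b : weyl_eq (WConst (a * b)) (WMul (WConst a) (WConst b))
  | weyl_constC a x : weyl_eq (WMul (WConst a) x) (WMul x (WConst a))
  | weyl_pq : weyl_eq (WMul WP WQ) (WAdd (WMul WQ WP) (WConst 1)).

HB.instance Definition _ := gen_eqMixin weyl_term.
HB.instance Definition _ := gen_choiceMixin weyl_term.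

Definition weyl_eqb (x y : weyl_term) : bool := `[< weyl_eq x y >].

Fact weyl_eqb_equiv : equiv_class_of weyl_eqb.
Proof.
split=> [x|x y|y x z]; first exact/asboolP/weyl_refl.
  by apply/asboolP/asboolP => /weyl_sym.
by move=> /asboolP exy /asboolP eyz; apply/asboolP/(weyl_trans exy).
Qed.

Canonical weyl_equiv := EquivRelPack weyl_eqb_equiv.
Canonical weyl_encModRel := defaultEncModRel weyl_eqb.

Definition weyl : Type := {eq_quot weyl_eqb}.

HB.instance Definition _ := Choice.on weyl.

Definition weyl_pi (x : weyl_term) : weyl := \pi_({eq_quot weyl_eqb}) x.
Definition weyl_repr (x : weyl) : weyl_term :=
  @repr _ ({eq_quot weyl_eqb} : quotType weyl_term) x.

Fact weyl_reprK : cancel weyl_repr weyl_pi.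
Proof. exact: reprK. Qed.

Fact weyl_piP x y : weyl_pi x = weyl_pi y <-> weyl_eq x y.
Proof.
split=> [/eqP|exy]; last by apply/eqmodP/asboolP.
by move/eqP/eqmodP/asboolP.
Qed.

Fact weyl_repr_pi x : weyl_eq (weyl_repr (weyl_pi x)) x.
Proof. by apply/weyl_piP; rewrite weyl_reprK. Qed.

Definition weyl_p : weyl := weyl_pi WP.
Definition weyl_q : weyl := weyl_pi WQ.
Definition weyl_const (a : K) : weyl := weyl_pi (WConst a).
Definition weyl_addq (x y : weyl) : weyl :=
  weyl_pi (WAdd (weyl_repr x) (weyl_repr y)).
Definition weyl_mulq (x y : weyl) : weyl :=
  weyl_pi (WMul (weyl_repr x) (weyl_repr y)).
Definition weyl_oppq (x : weyl) : weyl := weyl_mulq (weyl_const (-1)) x.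

Fact weyl_piD x y : weyl_pi (WAdd x y) = weyl_addq (weyl_pi x) (weyl_pi y).
Proof. by apply/weyl_piP/weyl_sym/weyl_add; exact: weyl_repr_pi. Qed.

Fact weyl_piM x y : weyl_pi (WMul x y) = weyl_mulq (weyl_pi x) (weyl_pi y).
Proof. by apply/weyl_piP/weyl_sym/weyl_mul; exact: weyl_repr_pi. Qed.

Fact weyl_ind (P : weyl -> Prop) : (forall x, P (weyl_pi x)) -> forall x, P x.
Proof. by move=> Ppi x; rewrite -[x]weyl_reprK. Qed.

Fact weyl_addqA : associative weyl_addq.
Proof.
elim/weyl_ind=> x; elim/weyl_ind=> y; elim/weyl_ind=> z.
by rewrite -!weyl_piD; apply/weyl_piP/weyl_addA.
Qed.

Fact weyl_addqC : commutative weyl_addq.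
Proof.
elim/weyl_ind=> x; elim/weyl_ind=> y.
by rewrite -!weyl_piD; apply/weyl_piP/weyl_addC.
Qed.

Fact weyl_add0q : left_id (weyl_const 0) weyl_addq.
Proof. by elim/weyl_ind=> x; rewrite -weyl_piD; apply/weyl_piP/weyl_add0. Qed.

Fact weyl_mulqA : associative weyl_mulq.
Proof.
elim/weyl_ind=> x; elim/weyl_ind=> y; elim/weyl_ind=> z.
by rewrite -!weyl_piM; apply/weyl_piP/weyl_mulA.
Qed.

Fact weyl_mul1q : left_id (weyl_const 1) weyl_mulq.
Proof. by elim/weyl_ind=> x; rewrite -weyl_piM; apply/weyl_piP/weyl_mul1. Qed.

Fact weyl_mul0q x : weyl_mulq (weyl_const 0) x = weyl_const 0.
Proof.
by elim/weyl_ind: x => x; rewrite -weyl_piM; apply/weyl_piP/weyl_mul0.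
Qed.

Fact weyl_constCq a x : weyl_mulq (weyl_const a) x = weyl_mulq x (weyl_const a).
Proof.
by elim/weyl_ind: x => x; rewrite -!weyl_piM; apply/weyl_piP/weyl_constC.
Qed.

Fact weyl_mulq1 : right_id (weyl_const 1) weyl_mulq.
Proof. by move=> x; rewrite -weyl_constCq weyl_mul1q. Qed.

Fact weyl_mulqDl : left_distributive weyl_mulq weyl_addq.
Proof.
elim/weyl_ind=> x; elim/weyl_ind=> y; elim/weyl_ind=> z.
by rewrite -!(weyl_piM, weyl_piD); apply/weyl_piP/weyl_mulDl.
Qed.

Fact weyl_mulqDr : right_distributive weyl_mulq weyl_addq.
Proof.
elim/weyl_ind=> z; elim/weyl_ind=> x; elim/weyl_ind=> y.
by rewrite -!(weyl_piM, weyl_piD); apply/weyl_piP/weyl_mulDr.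
Qed.

Fact weyl_constDq a b :
  weyl_const (a + b) = weyl_addq (weyl_const a) (weyl_const b).
Proof. by rewrite -weyl_piD; apply/weyl_piP/weyl_constD. Qed.

Fact weyl_constMq a b :
  weyl_const (a * b) = weyl_mulq (weyl_const a) (weyl_const b).
Proof. by rewrite -weyl_piM; apply/weyl_piP/weyl_constM. Qed.

Fact weyl_addNq : left_inverse (weyl_const 0) weyl_oppq weyl_addq.
Proof.
move=> x; rewrite /weyl_oppq -[X in weyl_addq _ X]weyl_mul1q -weyl_mulqDl.
by rewrite -weyl_constDq addNr weyl_mul0q.
Qed.

(* The action on polynomials, p as the derivative and q as the multiplication *)
(* by the variable, shows that the quotient is not the zero ring.             *)
Fixpoint weyl_act (x : weyl_term) (f : {poly K}) : {poly K} :=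
  match x with
  | WP => f^`()
  | WQ => 'X * f
  | WConst a => a *: f
  | WAdd y z => weyl_act y f + weyl_act z f
  | WMul y z => weyl_act y (weyl_act z f)
  end.

Fact weyl_act_linear x : linear (weyl_act x).
Proof.
elim: x => [||b|y IHy z IHz|y IHy z IHz] a f g /=.
- by rewrite derivD derivZ.
- by rewrite mulrDr scalerAr.
- by rewrite scalerDr !scalerA mulrC.
- by rewrite IHy IHz scalerDr addrACA.
- by rewrite IHz IHy.
Qed.

Fact weyl_actD x f g : weyl_act x (f + g) = weyl_act x f + weyl_act x g.
Proof. by rewrite -[f]scale1r weyl_act_linear !scale1r. Qed.

Fact weyl_actZ x a f : weyl_act x (a *: f) = a *: weyl_act x f.
Proof.
have x0 : weyl_act x 0 = 0.
  by apply: (addIr (weyl_act x 0)); rewrite -weyl_actD !add0r.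
by rewrite -[a *: f]addr0 weyl_act_linear x0 addr0.
Qed.

Fact weyl_act_eq x y : weyl_eq x y -> weyl_act x =1 weyl_act y.
Proof.
elim=> {x y} //=.
- by move=> x y _ exy f; rewrite exy.
- by move=> x y z _ exy _ eyz f; rewrite exy eyz.
- by move=> x x' y y' _ ex _ ey f; rewrite ex ey.
- by move=> x x' y y' _ ex _ ey f; rewrite ey ex.
- by move=> x y z f; rewrite addrA.
- by move=> x y f; rewrite addrC.
- by move=> x f; rewrite scale0r add0r.
- by move=> x f; rewrite scale1r.
- by move=> x f; rewrite !scale0r.
- by move=> x y z f; rewrite weyl_actD.
- by move=> a b f; rewrite scalerDl.
- by move=> a b f; rewrite scalerA.
- by move=> a x f; rewrite weyl_actZ.
- by move=> f; rewrite derivM derivX mul1r scale1r addrC.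
Qed.

Fact weyl_oner_neq0 : weyl_const 1 != weyl_const 0.
Proof.
apply/eqP => /weyl_piP/weyl_act_eq/(_ 1) /=.
by rewrite scale1r scale0r => /eqP; rewrite oner_eq0.
Qed.

HB.instance Definition _ := GRing.isZmodule.Build weyl
  weyl_addqA weyl_addqC weyl_add0q weyl_addNq.

HB.instance Definition _ := GRing.Zmodule_isNzRing.Build weyl
  weyl_mulqA weyl_mul1q weyl_mulq1 weyl_mulqDl weyl_mulqDr weyl_oner_neq0.

Definition weyl_scale (a : K) (x : weyl) : weyl := weyl_const a * x.

Fact weyl_scalerA a b v : weyl_scale a (weyl_scale b v) = weyl_scale (a * b) v.
Proof. by rewrite /weyl_scale mulrA; congr (_ * _); rewrite weyl_constMq. Qed.

Fact weyl_scale1r : left_id 1 weyl_scale.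
Proof. exact: weyl_mul1q. Qed.

Fact weyl_scalerDr : right_distributive weyl_scale +%R.
Proof. by move=> a; exact: mulrDr. Qed.

Fact weyl_scalerDl v : {morph weyl_scale^~ v : a b / a + b}.
Proof. by move=> a b; rewrite /weyl_scale -mulrDl; congr (_ * _); rewrite weyl_constDq. Qed.

HB.instance Definition _ := GRing.Zmodule_isLmodule.Build K weyl
  weyl_scalerA weyl_scale1r weyl_scalerDr weyl_scalerDl.

Fact weyl_scalerAl (a : K) (u v : weyl) : a *: (u * v) = (a *: u) * v.
Proof. exact: mulrA. Qed.

HB.instance Definition _ := GRing.Lmodule_isLalgebra.Build K weyl weyl_scalerAl.

Fact weyl_scalerAr (a : K) (u v : weyl) : a *: (u * v) = u * (a *: v).
Proof.
rewrite -[LHS]/(weyl_const a * (u * v)) -[a *: v]/(weyl_const a * v) !mulrA.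
by congr (_ * _); exact: weyl_constCq.
Qed.

HB.instance Definition _ := GRing.Lalgebra_isAlgebra.Build K weyl weyl_scalerAr.

Fact weyl_comm : weyl_p * weyl_q - weyl_q * weyl_p = 1.
Proof.
apply/eqP; rewrite subr_eq addrC; apply/eqP.
rewrite -[LHS]weyl_piM -[weyl_q * _]weyl_piM -[RHS]weyl_piD.
exact/weyl_piP/weyl_pq.
Qed.

End Weyl.

(* Main.v *)
Require Import Defs.
From HB Require Import structures.
From mathcomp Require Import all_boot all_order all_algebra.
From mathcomp Require Import reals complex.
From mathcomp Require Import boolp.
From mathcomp Require Import ssrAC ring zify lra.

Set Implicit Arguments.
Unset Strict Implicit.
Unset Printing Implicit Defensive.

Import Order.TTheory GRing.Theory Num.Theory.
Local Open Scope ring_scope.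

(** All derivations of the Weyl algebra A are inner and its centre consists of the
scalars, so g is isomorphic to V / K, where V is a space of elements of A that
contains 1 and is closed under the commutator, and K is the field of complex
numbers. The rank of V is bounded by two properties of A, proved with the
filtration by the order in p.

- The centralizer of a non-scalar element is commutative (centralizer_comm).
- If x is an eigenvector of ad h with eigenvalue l nonzero, then ad h acts on the
  centralizer of x triangularly with respect to the order, with the eigenvalue
  (m / ord x) l in order m (sz_ad_triangular). So there are no Jordan blocks and
  no multiplicities, and the eigenvalues are nonnegative rational multiples of l
  (eigenvector_unique, eigenvalue_ratio).

Both rest on the fact that leading symbols of commuting elements have zero
Poisson bracket: in the centralizer of x, an element z of order m satisfies
z^(ord x) = c x^m up to lower order.

Suppose that some ad h has a nonzero eigenvalue on V. The vectors of extremal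
weight and the commutativity of centralizers show that ad h is diagonalizable on V,
that its nonzero eigenvalues are simple and are rational multiples of one of
them, and that the eigenspace of 0 is spanned by h and 1 (graded_exists). Weight
vectors of the same sign commute because they commute with the extremal one,
and those of opposite signs never commute because commuting eigenvectors have
eigenvalues of the same sign. This combinatorial information determines V
(graded_classification). If all weights have one sign, V / K is diagonal. If a
bracket of opposite weight vectors involves h, these vectors generate sl(2) and the
only other weights are those of the standard representation. Otherwise the weights are,
up to sign and scaling, - 1, 1, 2, ..., n - 1, and V / K is the quotient of the
extended filiform algebra.

Suppose now that no ad h has a nonzero eigenvalue on V, so that all are nilpotent.
Some x and y in V have a nonzero scalar bracket and are such that V is spanned by x and
the centralizer of y (nilpotent_codim_one). This centralizer is commutative,
and ad x acts on it as a single Jordan block since its kernel consists of the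
scalars. Hence V / K is filiform. *)

(** * Commutators and scalars in an associative algebra *)

Section Commutator.
Variables (K : fieldType) (A : algType K).
Implicit Types x y z : A.

Fact ad_key : unit. Proof. exact: tt. Qed.
(** Locked, because otherwise unification sees a difference of products behind
every bracket. *)
Definition ad : A -> A -> A := locked_with ad_key (fun x y => x * y - y * x).

Lemma adE x y : ad x y = x * y - y * x.
Proof. by rewrite /ad unlock. Qed.

Fact ad_is_linear x : linear (ad x).
Proof.
move=> a y z; rewrite !adE mulrDr mulrDl -scalerAr -scalerAl opprD addrACA.
by rewrite scalerBr.
Qed.
HB.instance Definition _ x := GRing.isLinear.Build K A A _ (ad x) (ad_is_linear x).

Lemma adDr x y z : ad x (y + z) = ad x y + ad x z.
Proof. exact: raddfD. Qed.
Lemma adBr x y z : ad x (y - z) = ad x y - ad x z.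
Proof. exact: raddfB. Qed.
Lemma adNr x z : ad x (- z) = - ad x z.
Proof. exact: raddfN. Qed.
Lemma adZr x a z : ad x (a *: z) = a *: ad x z.
Proof. exact: linearZ. Qed.
Lemma ad0r x : ad x 0 = 0.
Proof. exact: raddf0. Qed.
Lemma ad_anti x y : ad x y = - ad y x. Proof. by rewrite !adE opprB. Qed.
Lemma adxx x : ad x x = 0. Proof. by rewrite adE subrr. Qed.
Lemma adDl x y z : ad (x + y) z = ad x z + ad y z.
Proof. by rewrite ad_anti adDr opprD -!(ad_anti _ z). Qed.
Lemma adNl x z : ad (- x) z = - ad x z.
Proof. by rewrite !adE mulNr mulrN opprB opprK addrC. Qed.
Lemma adBl x y z : ad (x - y) z = ad x z - ad y z.
Proof. by rewrite adDl adNl. Qed.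
Lemma adZl a x z : ad (a *: x) z = a *: ad x z.
Proof. by rewrite ad_anti adZr -scalerN -ad_anti. Qed.
Lemma ad0l z : ad 0 z = 0.
Proof. by rewrite ad_anti ad0r oppr0. Qed.

Lemma ad_sumr (I : Type) (r : seq I) (F : I -> A) x :
  ad x (\sum_(i <- r) F i) = \sum_(i <- r) ad x (F i).
Proof. exact: raddf_sum. Qed.
Lemma ad_suml (I : Type) (r : seq I) (F : I -> A) x :
  ad (\sum_(i <- r) F i) x = \sum_(i <- r) ad (F i) x.
Proof.
by rewrite ad_anti ad_sumr -sumrN; apply: eq_bigr => i _; rewrite -ad_anti.
Qed.

Lemma ad_mulr x y z : ad x (y * z) = ad x y * z + y * ad x z.
Proof. by rewrite !adE mulrBl mulrBr !mulrA addrA subrK. Qed.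
Lemma ad_mull x y z : ad (x * y) z = x * ad y z + ad x z * y.
Proof. by rewrite !adE mulrBr mulrBl !mulrA addrA subrK. Qed.

Lemma ad_jacobi x y z : ad x (ad y z) = ad (ad x y) z + ad y (ad x z).
Proof.
rewrite [ad y z]adE adBr !ad_mulr [ad (ad x y) z]adE [ad y _]adE.
by rewrite opprD [- (ad x z * y) - _]addrC addrACA.
Qed.

Lemma ad_scalar x a : ad x a%:A = 0.
Proof. by rewrite !adE -scalerAl -scalerAr mul1r mulr1 subrr. Qed.
Lemma ad_scalarl x a : ad a%:A x = 0.
Proof. by rewrite ad_anti ad_scalar oppr0. Qed.
Lemma ad1 x : ad x 1 = 0. Proof. by rewrite -(ad_scalar x 1) scale1r. Qed.
Lemma ad1l x : ad 1 x = 0. Proof. by rewrite ad_anti ad1 oppr0. Qed.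

Lemma ad_eq0 x y : ad x y = 0 <-> x * y = y * x.
Proof.
by rewrite adE; split=> [/eqP|->]; [rewrite subr_eq0 => /eqP | rewrite subrr].
Qed.
Lemma ad_sym x y : ad x y = 0 -> ad y x = 0.
Proof. by rewrite (ad_anti y) => ->; rewrite oppr0. Qed.

Lemma ad_expr x y n : ad x y = 0 -> ad x (y ^+ n) = 0.
Proof.
move=> xy; elim: n => [|n IH]; first by rewrite expr0 ad1.
by rewrite exprS ad_mulr xy IH mul0r mulr0 addr0.
Qed.

Lemma ad_centralizer (h x y : A) l :
  ad h x = l *: x -> ad x y = 0 -> ad x (ad h y) = 0.
Proof.
move=> hx xy; rewrite ad_jacobi xy ad0r addr0.
by rewrite (ad_anti x) hx adNl adZl xy scaler0 oppr0.
Qed.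

(** The kernel of x |-> ad x is the set of scalars, so the Lie algebra of
derivations is the Weyl algebra taken modulo this predicate. *)
Definition scal x := exists k : K, x = k%:A.
Lemma scal_k k : scal k%:A. Proof. by exists k. Qed.
Lemma scal0 : scal 0. Proof. by exists 0; rewrite scale0r. Qed.
Lemma scalD x y : scal x -> scal y -> scal (x + y).
Proof. by move=> [k ->] [l ->]; exists (k + l); rewrite scalerDl. Qed.
Lemma scalZ a x : scal x -> scal (a *: x).
Proof. by move=> [k ->]; exists (a * k); rewrite scalerA. Qed.
Lemma scalN x : scal x -> scal (- x).
Proof. by move=> [k ->]; exists (- k); rewrite scaleNr. Qed.
Lemma scalB x y : scal x -> scal y -> scal (x - y).
Proof. by move=> sx sy; exact/scalD/scalN. Qed.
Lemma scal_ad x y : scal y -> ad x y = 0.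
Proof. by move=> [k ->]; exact: ad_scalar. Qed.
Lemma scal_adl x y : scal x -> ad x y = 0.
Proof. by move=> [k ->]; exact: ad_scalarl. Qed.

End Commutator.

(** * Polynomials in characteristic zero *)

Section CharZero.
Variables (K : numFieldType) (B : algType K).

Lemma natmul_eq0 (b : B) n : (b *+ n == 0) = (n == 0)%N || (b == 0).
Proof. by rewrite -scaler_nat scaler_eq0 pnatr_eq0. Qed.
End CharZero.
Section CharZeroPoly.
Variables (K : numFieldType) (B : algType K).
Lemma deriv_eq0_const (F : {poly B}) : F^`() = 0 -> F = (F`_0)%:P.
Proof.
move=> F0; apply/polyP=> -[|i]; rewrite coefC //=.
have /eqP := congr1 (fun G : {poly B} => G`_i) F0.
by rewrite coef_deriv coef0 natmul_eq0 => /eqP.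
Qed.

Lemma poly_primitive (F : {poly B}) : exists G : {poly B}, G^`() = F.
Proof.
exists (\poly_(i < (size F).+1) ((i%:R : K)^-1 *: F`_i.-1)).
apply/polyP=> i; rewrite coef_deriv coef_poly ltnS /=.
case: ltnP => [_|si]; last by rewrite mul0rn nth_default.
by rewrite -scaler_nat scalerA divff ?scale1r // pnatr_eq0.
Qed.
End CharZeroPoly.

(** The Wronskian is that of the quotient f / g: after division by the gcd, each of
the two coprime cofactors divides its own derivative, hence is constant. *)
Lemma wronskian_eq0 (K : numFieldType) (f g : {poly K}) :
  g != 0 -> f^`() * g = f * g^`() -> exists c, f = c *: g.
Proof.
move=> g0 W.
have [->|f0] := eqVneq f 0; first by exists 0; rewrite scale0r.
set d := gcdp f g.
have d0 : d != 0 by rewrite gcdp_eq0 negb_and f0.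
have [df dg] : d %| f /\ d %| g by rewrite dvdp_gcdl dvdp_gcdr.
have cop : coprimep (f %/ d) (g %/ d) by apply: coprimep_div_gcd; rewrite f0.
move: W f0 g0; rewrite -(divpK df) -(divpK dg).
move: (f %/ d) (g %/ d) cop => {df dg}u v cop W f0 g0.
have {}W : u^`() * v = u * v^`().
  apply: (mulIf (mulf_neq0 d0 d0)); move: W; rewrite !derivM.
  move=> /eqP; rewrite -subr_eq0 => /eqP W.
  by apply/eqP; rewrite -subr_eq0 -W; apply/eqP; ring.
have const (w : {poly K}) : w %| w^`() -> exists c, w = c%:P.
  move=> ww; exists w`_0; apply: (@deriv_eq0_const K K^o).
  apply/eqP; apply: contraT => w0; have := dvdp_leq w0 ww.
  rewrite leqNgt lt_size_deriv //; apply: contraNneq w0 => ->.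
  by rewrite deriv0.
have [|a ua] := const u.
  by rewrite -(Gauss_dvdpl _ cop) W dvdp_mulr.
have [|b vb] := const v.
  by rewrite coprimep_sym in cop; rewrite -(Gauss_dvdpr _ cop) -W dvdp_mull.
have b0 : b != 0 by apply: contraNneq g0 => b0; rewrite vb b0 mul0r.
exists (a / b); rewrite ua vb scalerAl -mul_polyC -polyCM divfK //.
Qed.

(** * The order filtration of the Weyl algebra *)

Section WeylPair.
Variables (K : numFieldType).
Local Notation A := (weyl K).
Variables (p q : A).
Hypothesis pq : ad p q = 1.
Hypothesis gen : forall S : A -> Prop, S p -> S q -> (forall k : K, S k%:A) ->
  (forall x y, S x -> S y -> S (x + y)) ->
  (forall x y, S x -> S y -> S (x * y)) -> forall x, S x.
Implicit Types x y z : A.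
Implicit Types (f g : {poly K}) (F G : {poly {poly K}}).

(** Since [p, q] = 1, bracketing with q is differentiation with respect to p and
bracketing with p is differentiation with respect to q. Only these two commuting
derivations are used below, for any pair (p, q) that generates the algebra, so
that everything applies to (q, - p) as well. *)
Definition dp x := ad x q.
Definition dq x := ad p x.

Lemma dpD x y : dp (x + y) = dp x + dp y. Proof. exact: adDl. Qed.
Lemma dpB x y : dp (x - y) = dp x - dp y. Proof. exact: adBl. Qed.
Lemma dpZ a x : dp (a *: x) = a *: dp x. Proof. exact: adZl. Qed.
Lemma dp0 : dp 0 = 0. Proof. exact: ad0l. Qed.
Lemma dpM x y : dp (x * y) = dp x * y + x * dp y.
Proof. by rewrite /dp ad_mull addrC. Qed.
Lemma dp_ad x y : dp (ad x y) = ad (dp x) y + ad x (dp y).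
Proof.
rewrite /dp (ad_anti _ q) ad_jacobi (ad_anti q x) (ad_anti q y).
by rewrite adNl adNr opprD !opprK.
Qed.
Lemma dp_p : dp p = 1. Proof. exact: pq. Qed.
Lemma dp_dq x : dp (dq x) = dq (dp x).
Proof. by rewrite /dq dp_ad dp_p ad1l add0r. Qed.

Definition ev f : A := horner_alg q f.

Lemma evD f g : ev (f + g) = ev f + ev g. Proof. exact: raddfD. Qed.
Lemma evN f : ev (- f) = - ev f. Proof. exact: raddfN. Qed.
Lemma evM f g : ev (f * g) = ev f * ev g. Proof. exact: rmorphM. Qed.
Lemma ev1 : ev 1 = 1. Proof. exact: rmorph1. Qed.
Lemma ev0 : ev 0 = 0. Proof. exact: raddf0. Qed.
Lemma evC a : ev a%:P = a%:A. Proof. exact: horner_algC. Qed.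
Lemma evZ a f : ev (a *: f) = a *: ev f.
Proof. by rewrite -mul_polyC evM evC -scalerAl mul1r. Qed.
Lemma evX : ev 'X = q. Proof. exact: horner_algX. Qed.
Lemma evMC f g : ev f * ev g = ev g * ev f. Proof. by rewrite -!evM mulrC. Qed.

Lemma dp_ev f : dp (ev f) = 0.
Proof. by rewrite /dp -[in ad _ _]evX !adE evMC subrr. Qed.

Lemma dq_ev f : dq (ev f) = ev f^`().
Proof.
elim/poly_ind: f => [|f c IH]; first by rewrite deriv0 ev0 /dq ad0r.
rewrite derivD derivM derivX derivC addr0 mulr1 !evD !evM evC evX.
by rewrite /dq adDr ad_scalar addr0 ad_mulr pq mulr1 -/(dq _) IH addrC.
Qed.

(** The normal form, with the powers of p on the right of their coefficients in q:
it turns dp into the derivative of polynomials. *)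
Definition nf F : A := (map_poly (horner_alg q) F).[p].

Lemma nfMXD F f : nf (F * 'X + f%:P) = nf F * p + ev f.
Proof.
by rewrite /nf rmorphD rmorphM /= map_polyX map_polyC hornerMXaddC.
Qed.
Lemma nf0 : nf 0 = 0.
Proof. by rewrite /nf rmorph0 horner0. Qed.
Lemma nfC f : nf f%:P = ev f.
Proof. by rewrite -[f%:P]add0r -(mul0r 'X) nfMXD nf0 mul0r add0r. Qed.

Lemma nfD F G : nf (F + G) = nf F + nf G.
Proof. by rewrite /nf rmorphD hornerD. Qed.
Lemma nfMX F : nf (F * 'X) = nf F * p.
Proof. by rewrite -[F * 'X]addr0 -polyC0 nfMXD ev0 addr0. Qed.

Lemma dp_nf F : dp (nf F) = nf F^`().
Proof.
elim/poly_ind: F => [|F f IH]; first by rewrite deriv0 nf0 dp0.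
rewrite nfMXD derivD derivM derivX derivC addr0 mulr1 dpD dpM dp_p dp_ev.
by rewrite addr0 mulr1 IH nfD nfMX.
Qed.

Lemma nfCM f G : nf (f%:P * G) = ev f * nf G.
Proof.
elim/poly_ind: G => [|G g IH]; first by rewrite mulr0 nf0 mulr0.
by rewrite mulrDr mulrA -polyCM !nfMXD mulrDr mulrA IH evM.
Qed.

Lemma nf_surj x : exists F, x = nf F.
Proof.
suff H : forall G, exists F, x * nf G = nf F.
  have [F] := H 1%:P; rewrite nfC ev1 mulr1.
  by exists F.
move: x; apply: gen => [||k|x y IHx IHy|x y IHx IHy] G.
- elim/poly_ind: G => [|G g IH]; first by exists 0; rewrite nf0 mulr0.
  have [F {}IH] := IH.
  exists (F * 'X + (g%:P * 'X + g^`()%:P)).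
  rewrite nfMXD [RHS]nfD nfMX nfMXD -IH mulrDr mulrA; congr (_ + _).
  by rewrite -dq_ev nfC /dq !adE addrC subrK.
- by exists ('X%:P * G); rewrite nfCM evX.
- by exists (k%:P%:P * G); rewrite nfCM evC.
- have [F Fx] := IHx G; have [H Hy] := IHy G; exists (F + H).
  by rewrite mulrDl Fx Hy nfD.
- have [F Fy] := IHy G; have [H Hx] := IHx F; exists H.
  by rewrite -mulrA Fy.
Qed.

Lemma ev_inj f : ev f = 0 -> f = 0.
Proof.
have [n] := ubnP (size f); elim: n f => // n IH f sf ef.
have [//|f0] := eqVneq f 0.
have : f^`() = 0.
  apply: IH; last by rewrite -dq_ev ef /dq ad0r.
  by rewrite (leq_trans (lt_size_deriv f0)).
move/(@deriv_eq0_const K K^o) => fc; move: ef.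
rewrite fc evC => /eqP; rewrite scaler_eq0 oner_eq0 orbF => /eqP ->.
by rewrite polyC0.
Qed.

Lemma nf_inj F : nf F = 0 -> F = 0.
Proof.
have [n] := ubnP (size F); elim: n F => // n IH F sF eF.
have [//|F0] := eqVneq F 0.
have : F^`() = 0.
  apply: IH; last by rewrite -dp_nf eF dp0.
  by rewrite (leq_trans (lt_size_deriv F0)).
by move/deriv_eq0_const => Fc; move: eF; rewrite Fc nfC => /ev_inj ->.
Qed.

Lemma dp_eq0 x : dp x = 0 -> exists f, x = ev f.
Proof.
have [F ->] := nf_surj x; rewrite dp_nf => /nf_inj/deriv_eq0_const ->.
by exists F`_0; rewrite nfC.
Qed.

Lemma dp_surj x : exists y, dp y = x.
Proof.
have [F ->] := nf_surj x; have [G GF] := poly_primitive F.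
by exists (nf G); rewrite dp_nf GF.
Qed.

(** A Poincare lemma: x must solve dp x = D q and dq x = - D p. An antiderivative
of D q for dp solves the first equation, and the second is then corrected by a
polynomial in q, thanks to the compatibility of D with [p, q] = 1. *)
Lemma derivation_inner (D : derivation A) : exists x, D =1 ad x.
Proof.
have D0 : D 0 = 0 by have := derB D 0 0; rewrite !subrr.
have DZ a y : D (a *: y) = a *: D y.
  by rewrite -[a *: y]addr0 der_linear D0 addr0.
have D1 : D 1 = 0.
  have /eqP := derM D 1 1; rewrite !mulr1 mul1r -{1}[D 1]addr0.
  by rewrite (inj_eq (addrI _)) eq_sym => /eqP.
have [x0 x0q] := dp_surj (D q).
(* the compatibility of D with pq - qp = 1 makes (D p, D q) a closed form *)
have closed : dp (D p + dq x0) = 0.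
  have := congr1 D pq; rewrite D1 !adE derB !derM dpD dp_dq x0q => <-.
  rewrite /dp /dq !adE; by rewrite opprD [- (D q * p) - _]addrC addrACA.
have [f Ef] := dp_eq0 closed.
have [g gf] := @poly_primitive K K^o (- f).
exists (x0 + ev g).
have eP : D p = ad (x0 + ev g) p.
  apply/eqP; rewrite adDl -subr_eq0 opprD addrA; apply/eqP.
  rewrite (ad_anti x0) (ad_anti (ev g)) !opprK -/(dq x0) -/(dq (ev g)).
  by rewrite Ef dq_ev gf -evD subrr ev0.
have eq : D q = ad (x0 + ev g) q.
  by rewrite adDl -/(dp (ev g)) dp_ev addr0 -x0q.
apply: gen => //.
- by move=> k; rewrite DZ D1 scaler0 ad_scalar.
- by move=> x y Dx Dy; rewrite derD Dx Dy adDr.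
- by move=> x y Dx Dy; rewrite derM Dx Dy ad_mulr.
Qed.


Lemma dp_nil x : exists n, iter n dp x == 0.
Proof.
have [F ->] := nf_surj x; exists (size F).
have -> n : iter n dp (nf F) = nf F^`(n).
  by elim: n => //= n ->; rewrite dp_nf.
by rewrite derivn_poly0 ?nf0.
Qed.

(** One plus the order of x as a polynomial in p, and 0 for x = 0. *)
Definition sz x := ex_minn (dp_nil x).
Arguments sz x%_R.

Lemma iter_dp0 n : iter n dp 0 = 0.
Proof. by elim: n => //= n ->; rewrite dp0. Qed.
Lemma iter_dpB n x y : iter n dp (x - y) = iter n dp x - iter n dp y.
Proof. by elim: n => //= n ->; rewrite dpB. Qed.
Lemma iter_dpD n x y : iter n dp (x + y) = iter n dp x + iter n dp y.
Proof. by elim: n => //= n ->; rewrite dpD. Qed.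
Lemma iter_dpZ n a x : iter n dp (a *: x) = a *: iter n dp x.
Proof. by elim: n => //= n ->; rewrite dpZ. Qed.

Lemma szP n x : (iter n dp x == 0) = (sz x <= n)%N.
Proof.
rewrite /sz; case: ex_minnP => m /eqP mx min; apply/idP/idP => [/min //|mn].
by rewrite -(subnK mn) iterD mx iter_dp0.
Qed.

Lemma sz_eq0 x : (sz x == 0)%N = (x == 0).
Proof. by rewrite -leqn0 -szP. Qed.
Lemma sz0 : sz 0 = 0%N. Proof. by apply/eqP; rewrite sz_eq0. Qed.

Lemma szD n x y : (sz x <= n -> sz y <= n -> sz (x + y) <= n)%N.
Proof.
by rewrite -!szP iter_dpD => /eqP -> /eqP ->; rewrite addr0.
Qed.
Lemma szB n x y : (sz x <= n -> sz y <= n -> sz (x - y) <= n)%N.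
Proof.
by rewrite -!szP iter_dpB => /eqP -> /eqP ->; rewrite subr0.
Qed.
Lemma szZ n a x : (sz x <= n -> sz (a *: x) <= n)%N.
Proof. by rewrite -!szP iter_dpZ => /eqP ->; rewrite scaler0. Qed.

(** The leading coefficient of an element of order n, up to the factor n!. *)
Lemma szS x n : sz x = n.+1 -> exists2 f, f != 0 & iter n dp x = ev f.
Proof.
move=> sx; have [|f fx] := dp_eq0 (x := iter n dp x).
  by apply/eqP; rewrite -iterS szP sx.
exists f => //; apply: contraT; rewrite negbK => /eqP f0.
have : (n < sz x)%N by rewrite sx.
by rewrite ltnNge -szP fx f0 ev0 eqxx.
Qed.

Lemma sz_top x n f : f != 0 -> iter n dp x = ev f -> sz x = n.+1.
Proof.
move=> f0 fx; apply/eqP; rewrite eqn_leq -szP iterS fx dp_ev eqxx ltnNge -szP fx.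
by apply: contraNN f0 => /eqP/ev_inj ->.
Qed.

Lemma iter_dp_leibniz (B : A -> A -> A) k x y :
    (forall u v, dp (B u v) = B (dp u) v + B u (dp v)) ->
  iter k dp (B x y)
  = \sum_(i < k.+1) B (iter i dp x) (iter (k - i) dp y) *+ 'C(k, i).
Proof.
move=> BL; elim: k => [|k IH]; first by rewrite big_ord1 bin0.
have dp_sum n (T : 'I_n -> A) c :
    dp (\sum_(i < n) T i *+ c i) = \sum_(i < n) dp (T i) *+ c i.
  apply: (big_rec2 (fun u v => dp u = v)) => [|i u v _ <-]; first exact: dp0.
  by rewrite dpD -!scaler_nat dpZ.
rewrite iterS IH dp_sum [RHS]big_ord_recl /= bin0.
under [in RHS]eq_bigr => i _ do rewrite /bump /= add1n binS mulrnDr subSS.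
rewrite big_split addrA.
have -> : B x (iter k.+1 dp y) *+ 1 + 
    \sum_(i < k.+1) B (iter i.+1 dp x) (iter (k - i) dp y) *+ 'C(k, i.+1)
    = \sum_(i < k.+1) B (iter i dp x) (iter (k - i).+1 dp y) *+ 'C(k, i).
  rewrite big_ord_recr /= bin_small // addr0 [RHS]big_ord_recl /= bin0 subn0.
  by congr (_ + _); apply: eq_bigr => i _; rewrite /bump /= add1n -!iterS subnSK.
by rewrite -big_split; apply: eq_bigr => i _; rewrite BL mulrnDl addrC.
Qed.

(** The last nonzero term of the Leibniz formula. With B the product it shows that
orders add up; with B the bracket, that brackets lose at least one order since
polynomials in q commute. *)
Lemma iter_dp_top (B : A -> A -> A) n m x y :
    (forall u, B 0 u = 0) -> (forall u, B u 0 = 0) ->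
    (forall u v, dp (B u v) = B (dp u) v + B u (dp v)) ->
    (sz x <= n.+1)%N -> (sz y <= m.+1)%N ->
  iter (n + m) dp (B x y) = B (iter n dp x) (iter m dp y) *+ 'C(n + m, n).
Proof.
move=> B0l B0r BL sx sy; have nm : (n < (n + m).+1)%N by rewrite ltnS leq_addr.
rewrite iter_dp_leibniz // (bigD1 (Ordinal nm)) //= addKn big1 ?addr0 // => i.
rewrite -val_eqE neq_ltn /= => /orP[lt_in|lt_ni]; last first.
  have /eqP -> : iter i dp x == 0 by rewrite szP (leq_trans sx).
  by rewrite B0l mul0rn.
have /eqP -> : iter (n + m - i) dp y == 0; last by rewrite B0r mul0rn.
by rewrite szP (leq_trans sy) // ltn_subRL ltn_add2r.
Qed.

(** An element of order one is a multiple of p up to a polynomial in q. *)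
Lemma ad_slice z b f : dp z = ev b -> ad z (ev f) = ev (b * f^`()).
Proof.
move=> zb; have [c zc] : exists c, z - ev b * p = ev c.
  by apply: dp_eq0; rewrite dpB dpM dp_ev dp_p zb mul0r add0r mulr1 subrr.
rewrite -[z](subrK (ev b * p)) zc adDl ad_mull -/(dq _) dq_ev.
have evad g h : ad (ev g) (ev h) = 0 by rewrite !adE evMC subrr.
by rewrite !evad mul0r add0r addr0 evM.
Qed.

(** The Poisson bracket of the leading symbols of two commuting elements
vanishes. The factor k is chosen before x and y: it depends only on the orders,
which allows two elements y of the same order to be compared. *)
Lemma commuting_leads n m : exists k, forall x y a b,
    (sz x <= n.+2)%N -> (sz y <= m.+1)%N -> ad x y = 0 ->
    iter n.+1 dp x = ev a -> iter m dp y = ev b ->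
  (a * b^`()) *+ 'C(n + m, n) = (b * a^`()) *+ k.
Proof.
have nm : (n < (n + m).+1)%N by rewrite ltnS leq_addr.
(* only i = n and i = n + 1 contribute to the Leibniz formula *)
pose c (i : 'I_(n + m).+1) := if i == n.+1 :> nat then 'C(n + m, i) else 0%N.
exists (\sum_(i | i != Ordinal nm) c i)%N => x y a b sx sy xy xa yb.
have := iter_dp_leibniz (n + m) x y dp_ad; rewrite xy iter_dp0.
rewrite (bigD1 (Ordinal nm)) //= addKn yb (ad_slice _ xa).
rewrite (eq_bigr (fun i => ev (- (b * a^`())) *+ c i)) => [|i].
  rewrite sumrMnr => E.
  apply/eqP; rewrite -subr_eq0 -mulNrn; apply/eqP/ev_inj.
  by rewrite E evD -!scaler_nat !evZ !scaler_nat.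
rewrite -val_eqE /c neq_ltn /= => /orP[lt_in|lt_ni].
  have /eqP -> : iter (n + m - i) dp y == 0.
    by rewrite szP (leq_trans sy) // ltn_subRL ltn_add2r.
  by rewrite ad0r mul0rn ltn_eqF ?mulr0n // (leq_trans lt_in) // ltnW.
case: eqP => [ei|/eqP nei]; last first.
  have /eqP -> : iter i dp x == 0; last by rewrite ad0l mul0rn mulr0n.
  by rewrite szP (leq_trans sx) // ltn_neqAle eq_sym nei.
congr (_ *+ _); rewrite ei xa ad_anti (ad_slice (b := b)) ?evN //.
have ni : (n.+1 <= n + m)%N by rewrite -ei -ltnS.
by rewrite -yb -iterS -subSn // subSS addKn.
Qed.

(** In the centralizer of an element of positive order, the elements of a given
order have proportional leading coefficients: by commuting_leads their Wronskian
vanishes. *)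
Lemma same_order x y z n :
    sz x = n.+2 -> ad x y = 0 -> ad x z = 0 -> sz y = sz z ->
  exists c, (y == 0) || (sz (y - c *: z) < sz y)%N.
Proof.
move=> sx xy xz syz; have [->|y0] := eqVneq y 0; first by exists 0.
have [m sy] : exists m, sz y = m.+1.
  by exists (sz y).-1; rewrite prednK // lt0n sz_eq0.
have [a a0 xa] := szS sx; have [b b0 yb] := szS sy.
have [d d0 zd] := szS (etrans (esym syz) sy).
have [k kP] := commuting_leads n m.
have Eb := kP x y a b (eq_leq sx) (eq_leq sy) xy xa yb.
have Ed := kP x z a d (eq_leq sx) (eq_leq (etrans (esym syz) sy)) xz xa zd.
have [c bc] : exists c, b = c *: d.
  apply: wronskian_eq0 => //; apply: (mulfI a0); apply/eqP.
  have N0 : 'C(n + m, n) != 0%N by rewrite -lt0n bin_gt0 leq_addr.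
  rewrite -subr_eq0; have := natmul_eq0 (a * (b^`() * d) - a * (b * d^`())) 'C(n + m, n).
  rewrite (negPf N0) /= => <-; apply/eqP.
  rewrite mulrnBl mulrA [a * (b * _)]mulrCA -mulrnAl Eb -[b * (a * _) *+ _]mulrnAr Ed
    mulrnAl mulrnAr.
  by rewrite -mulrnBl -mulrA [a^`() * _]mulrC subrr mul0rn.
exists c; rewrite sy ltnS -szP iter_dpB iter_dpZ yb zd bc evZ subrr.
by rewrite eqxx orbT.
Qed.

Lemma szM x y : x != 0 -> y != 0 -> (sz (x * y)).+1 = (sz x + sz y)%N.
Proof.
rewrite -!sz_eq0 -!lt0n.
case sx: (sz x) => [|n] // _; case sy: (sz y) => [|m] // _.
have [a a0 xa] := szS sx; have [b b0 yb] := szS sy.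
rewrite (@sz_top _ (n + m) ((a * b) *+ 'C(n + m, n))) ?addSn ?addnS //.
  by rewrite natmul_eq0 mulf_eq0 (negPf a0) (negPf b0) !orbF -lt0n bin_gt0 leq_addr.
rewrite (iter_dp_top (@mul0r A) (@mulr0 A) dpM) ?sx ?sy // xa yb -evM.
by rewrite -!scaler_nat evZ.
Qed.


Lemma sz_ad x y : (sz (ad x y) <= (sz x + sz y).-2)%N.
Proof.
have [->|x0] := eqVneq x 0; first by rewrite ad0l sz0.
have [->|y0] := eqVneq y 0; first by rewrite ad0r sz0.
move: x0 y0; rewrite -!sz_eq0 -!lt0n.
case sx: (sz x) => [|n] // _; case sy: (sz y) => [|m] // _.
have [a a0 xa] := szS sx; have [b b0 yb] := szS sy.
rewrite addSn addnS /= -szP (iter_dp_top (@ad0l _ A) (@ad0r _ A) dp_ad) ?sx ?sy //.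
by rewrite xa yb !adE evMC subrr mul0rn.
Qed.

Lemma sz_pred x : x != 0 -> exists n, sz x = n.+1.
Proof. by rewrite -sz_eq0; case: (sz x) => // n _; exists n. Qed.

Lemma szZ_eq c x : c != 0 -> sz (c *: x) = sz x.
Proof.
move=> c0; apply/eqP; rewrite eqn_leq szZ //=.
by rewrite -{1}[x](scalerK c0) szZ.
Qed.

Lemma sz_scal_le1 k : (sz k%:A <= 1)%N.
Proof. by rewrite -szP /= /dp ad_scalarl. Qed.
Lemma sz1 : sz 1 = 1%N.
Proof.
apply/eqP; rewrite eqn_leq -{1}(scale1r 1) sz_scal_le1 lt0n sz_eq0.
exact: oner_neq0.
Qed.

Lemma szM_le x y n m : (sz x <= n.+1 -> sz y <= m -> sz (x * y) <= n + m)%N.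
Proof.
have [->|x0] := eqVneq x 0; first by rewrite mul0r sz0.
have [->|y0] := eqVneq y 0; first by rewrite mulr0 sz0.
by move=> sx sy; rewrite -ltnS szM // -addSn leq_add.
Qed.

Lemma szX x n k : sz x = n.+1 -> sz (x ^+ k) = (n * k).+1.
Proof.
move=> sx; have x0 : x != 0 by rewrite -sz_eq0 sx.
elim: k => [|k IH]; first by rewrite muln0 expr0 sz1.
have xk0 : x ^+ k != 0 by rewrite -sz_eq0 IH.
by apply/eqP; rewrite exprS -eqSS szM // sx IH mulnS addSn addnS.
Qed.

Lemma sz_close x y n : (sz (x - y) <= n)%N -> sz y = n.+1 -> sz x = n.+1.
Proof.
move=> sxy sy; apply/eqP; rewrite eqn_leq; apply/andP; split.
  by rewrite -[x](subrK y) szD // ?sy // ltnW.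
rewrite ltnNge; apply/negP => sx.
by have := szB sx sxy; rewrite opprB addrC subrK sy ltnn.
Qed.

(** Both powers lie in the centralizer of x and have the same order. *)
Lemma lower_power x z n m : sz x = n.+2 -> sz z = m.+1 -> ad x z = 0 ->
  exists c, (sz (z ^+ n.+1 - c *: x ^+ m) <= m * n.+1)%N.
Proof.
move=> sx sz_z xz.
have szn := szX n.+1 sz_z; have sxm := szX m sx; rewrite mulnC in sxm.
have [|||c] := @same_order x (z ^+ n.+1) (x ^+ m) n sx.
- exact: ad_expr.
- exact/ad_expr/adxx.
- by rewrite szn sxm.
by rewrite -sz_eq0 szn /= ltnS => cP; exists c.
Qed.

(** Symbols commute, so ad w (z^(k+1)) and (k+1) z^k (ad w z) have the same one. *)
Lemma sz_ad_expr w z m r k : sz z = m.+1 -> sz (ad w z) = r.+1 ->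
  sz (ad w (z ^+ k.+1)) = (m * k + r).+1.
Proof.
move=> sz_z sR; have z0 : z != 0 by rewrite -sz_eq0 sz_z.
have R0 : ad w z != 0 by rewrite -sz_eq0 sR.
apply: (@sz_close _ (k.+1%:R *: (z ^+ k * ad w z))); last first.
  rewrite szZ_eq ?pnatr_eq0 //; apply/eqP.
  by rewrite -eqSS szM // ?(szX k sz_z) ?sR ?addSn ?addnS // -sz_eq0 (szX k sz_z).
elim: k => [|k IH]; first by rewrite expr1 expr0 mul1r scale1r subrr sz0.
have -> : ad w (z ^+ k.+2) - k.+2%:R *: (z ^+ k.+1 * ad w z)
    = ad (ad w z) (z ^+ k.+1)
      + z * (ad w (z ^+ k.+1) - k.+1%:R *: (z ^+ k * ad w z)).
  rewrite (exprS z k.+1) ad_mulr [ad (ad w z) _]adE [z * (_ - _ *: _)]mulrBr -scalerAr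
    mulrA -exprS.
  rewrite -[k.+2]addn1 natrD scalerDl scale1r opprD.
  by rewrite [- (_ *: _) - _]addrC !addrA; congr (_ - _); rewrite addrAC.
apply: szD; last by rewrite mulnS -addnA szM_le // sz_z.
by rewrite (leq_trans (sz_ad _ _)) // sR (szX _ sz_z) addSn addnS /= addnC.
Qed.

(** Descent on the number of orders lost in the bracket of z and y. Replacing y by
y^(n+1) - c x^m, which has a lower order than y^(n+1) but the same bracket with
z, lowers this number strictly as long as the bracket does not vanish. *)
Lemma centralizer_comm_pos x y z n :
  sz x = n.+2 -> ad x y = 0 -> ad x z = 0 -> ad z y = 0.
Proof.
move=> sx xy xz; have [k] := ubnP (sz y + sz z - sz (ad z y)).
elim: k y xy => // k IH y xy; rewrite ltnS => sk.
have [//|R0] := eqVneq (ad z y) 0; have [r sR] := sz_pred R0.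
have [|m sy] := @sz_pred y; first by apply: contraNneq R0 => ->; rewrite ad0r.
have [c cP] := lower_power sx sy xy.
have zE : ad z (y ^+ n.+1 - c *: x ^+ m) = ad z (y ^+ n.+1).
  by rewrite adBr adZr [ad z (x ^+ m)]ad_expr ?scaler0 ?subr0 //; apply: ad_sym.
have sE := sz_ad_expr n sy sR.
have := IH (y ^+ n.+1 - c *: x ^+ m); rewrite zE sE => H.
suff : ad z (y ^+ n.+1) = 0 by move=> E; move: sE; rewrite E sz0.
apply: H; first by rewrite adBr adZr !ad_expr ?scaler0 ?subr0 // adxx.
have := sz_ad z y; move: sk cP; rewrite sR sy mulnS.
by move: (sz z) (sz _) (m * n)%N => a b e; lia.
Qed.

Lemma scal_of_sz_le1 x y n :
  sz x = n.+2 -> ad x y = 0 -> (sz y <= 1)%N -> scal y.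
Proof.
move=> sx xy sy; have [->|y0] := eqVneq y 0; first exact: scal0.
have sy1 : sz y = 1%N.
  by apply/eqP; rewrite eqn_leq sy lt0n sz_eq0.
have [c] := same_order sx xy (ad1 x) (etrans sy1 (esym sz1)).
rewrite (negPf y0) sy1 ltnS leqn0 sz_eq0 subr_eq0 => /eqP ->.
exact: scal_k.
Qed.

Lemma ad_eigen_expr h x l m : ad h x = l *: x ->
  ad h (x ^+ m) = (m%:R * l) *: x ^+ m.
Proof.
move=> hx; elim: m => [|m IH]; first by rewrite ad1 mul0r scale0r.
rewrite exprS ad_mulr hx IH -scalerAl -scalerAr -exprS -scalerDl.
by congr (_ *: _); rewrite -[m.+1]add1n natrD; ring.
Qed.

(** The same descent as for centralizer_comm_pos: if ad h raised the order of z, it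
would raise that of z^(n+1) - c x^m by more, whereas the increase is bounded by
the order of h. *)
Lemma sz_ad_centralizer h x l n z :
  sz x = n.+2 -> ad h x = l *: x -> ad x z = 0 -> (sz (ad h z) <= sz z)%N.
Proof.
move=> sx hx xz; have [k] := ubnP (sz z + sz h - sz (ad h z)).
elim: k z xz => // k IH z xz; rewrite ltnS => sk.
rewrite leqNgt; apply/negP => lt.
have [r sR] : exists r, sz (ad h z) = r.+1.
  by exists (sz (ad h z)).-1; rewrite prednK // (leq_ltn_trans _ lt).
have [|m sz_z] := @sz_pred z; first by apply: contraTneq lt => ->; rewrite ad0r ltnn.
have [c cP] := lower_power sx sz_z xz.
have sE := sz_ad_expr n sz_z sR.
have sxm := szX m sx.
have sE' : sz (ad h (z ^+ n.+1 - c *: x ^+ m)) = (m * n + r).+1.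
  apply: sz_close sE; rewrite [X in ad h X]addrC adDr addrK adNr adZr.
  rewrite (ad_eigen_expr m hx) -scaleNr; do 2?apply: szZ.
  by rewrite sxm mulSn [(n * m)%N]mulnC; move: lt; rewrite sR sz_z; lia.
have := IH (z ^+ n.+1 - c *: x ^+ m); rewrite sE' => H.
have := sz_ad h z; move: sk cP lt H; rewrite sR sz_z mulnS => sk cP lt H bd.
have := H _ _; rewrite adBr adZr !ad_expr ?scaler0 ?subr0 ?adxx // => /(_ erefl).
by move: sk cP lt bd; move: (sz h) (sz _) (m * n)%N => a b e; lia.
Qed.

(** On the centralizer of an eigenvector x of ad h, the derivation ad h is
triangular for the order filtration, and the eigenvalue in order m is m / ord x
times that of x: up to lower order z^(ord x) is a multiple of x^m. *)
Lemma sz_ad_triangular h x l n z m :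
  sz x = n.+2 -> ad h x = l *: x -> ad x z = 0 -> sz z = m.+1 ->
  (sz (n.+1%:R *: ad h z - (m%:R * l) *: z) <= m)%N.
Proof.
move=> sx hx xz sz_z.
have [c cP] := lower_power sx sz_z xz.
set r := _ - _ in cP.
have zn : z ^+ n.+1 = c *: x ^+ m + r by rewrite addrC subrK.
have xr : ad x r = 0.
  by rewrite /r adBr adZr !ad_expr ?scaler0 ?subr0 // adxx.
have sDr : (sz (ad h r) <= m * n.+1)%N.
  by rewrite (leq_trans (sz_ad_centralizer sx hx xr)).
set u := _ - _; have [->|u0] := eqVneq u 0; first by rewrite sz0.
have zDz : ad z (ad h z) = 0.
  apply: (centralizer_comm_pos sx) => //; exact: (ad_centralizer hx).
have Dzk k : ad h (z ^+ k.+1) = k.+1%:R *: (z ^+ k * ad h z).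
  elim: k => [|k IH]; first by rewrite mul1r scale1r.
  rewrite exprS ad_mulr IH -scalerAr mulrA -exprS.
  have /ad_eq0 <- : ad (z ^+ k.+1) (ad h z) = 0 by apply/ad_sym/ad_expr/ad_sym.
  by rewrite -[k.+2]addn1 natrD scalerDl scale1r addrC.
have zu : z ^+ n * u = ad h r - (m%:R * l) *: r.
  rewrite mulrBr -!scalerAr -Dzk -exprSr zn adDr adZr (ad_eigen_expr m hx).
  by rewrite scalerDr opprD addrACA !scalerA [c * _]mulrC subrr add0r.
have zn0 : z ^+ n != 0 by rewrite -sz_eq0 (szX n sz_z).
have := szM zn0 u0; rewrite zu (szX n sz_z) addSn => -[E].
have : (sz (ad h r - (m%:R * l) *: r) <= m * n.+1)%N by rewrite szB ?szZ.
by rewrite E mulnS addnC leq_add2r.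
Qed.

(** In the centralizer of x the eigenvalue l of ad h belongs to the order of x
alone, by sz_ad_triangular. *)
Lemma eigenvector_sz h x l b n y :
  sz x = n.+2 -> ad h x = l *: x -> l != 0 -> ad x y = 0 ->
  ad h y = l *: y + b *: x -> y != 0 -> sz y = n.+2.
Proof.
move=> sx hx l0 xy hy /sz_pred[m sy]; rewrite sy.
have := sz_ad_triangular sx hx xy sy.
have -> : n.+1%:R *: ad h y - (m%:R * l) *: y
   = (n.+1%:R * b) *: x + ((n.+1%:R - m%:R) * l) *: y.
  rewrite hy scalerDr !scalerA addrAC addrC -scalerBl; congr (_ + _ *: _); ring.
have [->//|nm] := eqVneq m n.+1.
set u := _ *: x; set v := _ *: y => suv.
have sv : sz v = m.+1.
  by rewrite szZ_eq ?mulf_neq0 // subr_eq0 eqr_nat eq_sym.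
have : sz u = m.+1.
  apply: (@sz_close _ (- v)); first by rewrite opprK.
  by rewrite -scaleN1r szZ_eq // oppr_eq0 oner_eq0.
rewrite /u; have [->|c0] := eqVneq (n.+1%:R * b) 0; first by rewrite scale0r sz0.
by rewrite szZ_eq // sx.
Qed.

Lemma eigenvector_unique_pos h x l b n y :
  sz x = n.+2 -> ad h x = l *: x -> l != 0 -> ad x y = 0 ->
  ad h y = l *: y + b *: x -> exists c, y = c *: x.
Proof.
move=> sx hx l0 xy hy.
have [->|y0] := eqVneq y 0; first by exists 0; rewrite scale0r.
have sy := eigenvector_sz sx hx l0 xy hy y0.
have [c] := same_order sx xy (adxx x) (etrans sy (esym sx)).
rewrite (negPf y0) /= => lt; exists c; apply/eqP; rewrite -subr_eq0.
apply: contraTT lt => yc0; rewrite -leqNgt sy.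
rewrite (eigenvector_sz (b := b) sx hx) //; first by rewrite adBr adZr xy adxx scaler0
  subr0.
rewrite adBr adZr hy hx scalerBr addrAC; congr (_ + _ + _).
by rewrite !scalerA mulrC.
Qed.

Lemma eigenvalue_ratio_pos h x l n y mu :
  sz x = n.+2 -> ad h x = l *: x -> ad x y = 0 -> ad h y = mu *: y -> y != 0 ->
  exists m, n.+1%:R * mu = m%:R * l /\ (m = 0%N -> scal y).
Proof.
move=> sx hx xy hy y0; have [m sy] := sz_pred y0; exists m; split; last first.
  by move=> m0; apply: (scal_of_sz_le1 sx xy); rewrite sy m0.
have := sz_ad_triangular sx hx xy sy; rewrite hy scalerA -scalerBl.
have [/eqP|nz] := eqVneq (n.+1%:R * mu - m%:R * l) 0.
  by rewrite subr_eq0 => /eqP.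
by rewrite szZ_eq // sy ltnn.
Qed.

Lemma ad_scalar_pos h x l n y b :
  sz x = n.+2 -> ad h x = l *: x -> l != 0 -> ad x y = 0 -> ad h y = b%:A ->
  scal y.
Proof.
move=> sx hx l0 xy hy; have [->|y0] := eqVneq y 0; first exact: scal0.
have [m sy] := sz_pred y0; have := sz_ad_triangular sx hx xy sy.
case: m sy => [|m] sy; first by move=> _; apply: (scal_of_sz_le1 sx xy); rewrite sy.
rewrite hy => le; have := szB (szZ n.+1%:R (leq_trans (sz_scal_le1 b) (ltn0Sn m))) le.
by rewrite subKr szZ_eq ?mulf_neq0 ?pnatr_eq0 // sy ltnn.
Qed.

End WeylPair.

(** * Consequences for the Weyl algebra *)

Section WeylConsequences.
Variable K : numFieldType.
Local Notation A := (weyl K).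
Local Notation p := (weyl_p K).
Local Notation q := (weyl_q K).
Implicit Types (x y z h : A) (a b l mu : K).

Lemma weyl_const_scale k : weyl_const k = k%:A :> A.
Proof. by rewrite -[RHS]/(weyl_const k * 1) mulr1. Qed.

Lemma weyl_gen (S : A -> Prop) : S p -> S q -> (forall k : K, S k%:A) ->
  (forall x y, S x -> S y -> S (x + y)) ->
  (forall x y, S x -> S y -> S (x * y)) -> forall x, S x.
Proof.
move=> Sp Sq Sk SD SM; elim/weyl_ind; elim=> [//|//|k|s IHs t IHt|s IHs t IHt].
- by rewrite -/(weyl_const k) weyl_const_scale.
- by rewrite weyl_piD; exact: SD.
- by rewrite weyl_piM; exact: SM.
Qed.

Lemma weyl_gen' (S : A -> Prop) : S q -> S (- p) -> (forall k : K, S k%:A) ->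
  (forall x y, S x -> S y -> S (x + y)) ->
  (forall x y, S x -> S y -> S (x * y)) -> forall x, S x.
Proof.
move=> Sq Sp Sk SD SM; apply: weyl_gen => //.
by rewrite -[p]opprK -mulN1r -scaleN1r; apply: SM.
Qed.

Lemma ad_pq : ad p q = 1. Proof. by rewrite adE; exact: weyl_comm. Qed.
Lemma ad_qp' : ad q (- p) = 1.
Proof. by rewrite adNr -ad_anti ad_pq. Qed.

Lemma weyl_derivation_inner (D : derivation A) : exists x, D =1 ad x.
Proof. exact: (derivation_inner ad_pq weyl_gen). Qed.

(** A non-scalar element has positive order for one of the Weyl pairs (p, q) and
(q, - p). *)
Lemma nonscalar_order x : ~ scal x ->
  (exists n, sz ad_pq weyl_gen x = n.+2) \/ (exists n, sz ad_qp' weyl_gen' x = n.+2).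
Proof.
move=> nx; have [|s1] := ltnP 1 (sz ad_pq weyl_gen x).
  by case: (sz _ _ _) => [|[|n]] // _; left; exists n.
have [|s2] := ltnP 1 (sz ad_qp' weyl_gen' x).
  by case: (sz _ _ _) => [|[|n]] // _; right; exists n.
case: nx; move: s1 s2; rewrite -!szP /= => /eqP /(dp_eq0 ad_pq weyl_gen)[f ->].
rewrite /dp adNr -ad_anti -/(dq p (ev q f)) dq_ev ?ad_pq // => /eqP.
move/(ev_inj ad_pq)/(@deriv_eq0_const K K^o) ->; rewrite evC; exact: scal_k.
Qed.

(** Used as the transitivity of commutation on non-scalar elements. *)
Lemma centralizer_comm x y z : ~ scal x -> ad x y = 0 -> ad x z = 0 -> ad y z = 0.
Proof.
move=> /nonscalar_order[] [n sx] xy xz; exact: (centralizer_comm_pos sx).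
Qed.

Lemma eigenvector_nonscal h x l : ad h x = l *: x -> l != 0 -> x != 0 -> ~ scal x.
Proof.
move=> hx l0 x0 /(scal_ad h)/eqP; rewrite hx scaler_eq0.
by rewrite (negPf l0) (negPf x0).
Qed.

(** No Jordan block and no multiplicity for ad h on the centralizer of an
eigenvector. *)
Lemma eigenvector_unique h x l b y :
  ad h x = l *: x -> l != 0 -> x != 0 -> ad x y = 0 ->
  ad h y = l *: y + b *: x -> exists c, y = c *: x.
Proof.
move=> hx l0 x0; have := eigenvector_nonscal hx l0 x0.
by move=> /nonscalar_order[] [n sx]; exact: (eigenvector_unique_pos sx hx).
Qed.

(** The ratio r is the ratio of the orders of y and x. *)
Lemma eigenvalue_ratio h x l y mu :
  ad h x = l *: x -> l != 0 -> x != 0 -> ad x y = 0 -> ad h y = mu *: y -> y != 0 ->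
  exists r : rat, [/\ mu = ratr r * l, 0 <= r & r = 0 -> scal y].
Proof.
move=> hx l0 x0 xy hy y0.
have [n [m [E m0]]] : exists n m, n.+1%:R * mu = m%:R * l /\ (m = 0%N -> scal y).
  have := eigenvector_nonscal hx l0 x0.
  by move=> /nonscalar_order[] [n sx]; exists n; exact: (eigenvalue_ratio_pos sx hx).
exists (m%:R / n.+1%:R); split.
- rewrite rmorphM fmorphV !rmorph_nat mulrAC -E mulrAC divff ?mul1r //.
  by rewrite pnatr_eq0.
- by rewrite divr_ge0 ?ler0n.
- by move/eqP; rewrite mulf_eq0 invr_eq0 !pnatr_eq0 orbF => /eqP.
Qed.

Lemma ad_eq_scalar h x l y b :
  ad h x = l *: x -> l != 0 -> x != 0 -> ad x y = 0 -> ad h y = b%:A -> scal y.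
Proof.
move=> hx l0 x0; have := eigenvector_nonscal hx l0 x0.
by move=> /nonscalar_order[] [n sx]; exact: (ad_scalar_pos sx hx).
Qed.

End WeylConsequences.

(** * Eigenvectors in a finite-dimensional space of Weyl algebra elements *)

Section Spectrum.
Variables (K : numClosedFieldType).
Local Notation A := (weyl K).
Implicit Types (t u v w x y z h : A) (s : seq K) (a b c l mu nu : K).

(** The product of the operators ad t - a for a in s, applied to v. An annihilating
product of this form, for each t, is how finite dimension enters: it bounds the
eigenvalues and gives decompositions into eigenvectors. *)
Definition shifts t s v := foldr (fun a w => ad t w - a *: w) v s.

Lemma shiftsB t s v w : shifts t s (v - w) = shifts t s v - shifts t s w.
Proof.
by elim: s => //= a s ->; rewrite adBr scalerBr !opprD !opprK addrACA.
Qed.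
Lemma shiftsZ t s a v : shifts t s (a *: v) = a *: shifts t s v.
Proof. by elim: s => //= b s ->; rewrite adZr [RHS]scalerBr !scalerA [b * a]mulrC. Qed.
Lemma shifts_ad t s v : shifts t s (ad t v) = ad t (shifts t s v).
Proof. by elim: s => //= a s ->; rewrite [RHS]adBr adZr. Qed.
Lemma shifts_eigen t s mu v : ad t v = mu *: v ->
  shifts t s v = (\prod_(a <- s) (mu - a)) *: v.
Proof.
move=> tv; elim: s => [|a s IH]; first by rewrite big_nil scale1r.
by rewrite /= IH big_cons adZr tv !scalerA -scalerBl mulrBl mulrC.
Qed.

(** What the preimage in the Weyl algebra of a finite-dimensional Lie algebra of
derivations satisfies. *)
Record lie_space (V : A -> Prop) : Prop := LieSpace {
  ls1 : V 1;
  lsL : forall a x y, V x -> V y -> V (a *: x + y);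
  lsad : forall x y, V x -> V y -> V (ad x y);
  lsfin : forall t, V t -> exists s, forall v, V v -> shifts t s v = 0
}.

Variable V : A -> Prop.
Hypothesis HV : lie_space V.

Lemma ls0 : V 0.
Proof. by rewrite -(subrr 1) addrC -scaleN1r; apply: (lsL HV); apply: (ls1 HV). Qed.
Lemma lsZ a x : V x -> V (a *: x).
Proof. by move=> Vx; rewrite -[_ *: _]addr0; apply: (lsL HV) => //; apply: ls0. Qed.
Lemma lsD x y : V x -> V y -> V (x + y).
Proof. by move=> Vx Vy; rewrite -[x]scale1r; apply: (lsL HV). Qed.
Lemma lsN x : V x -> V (- x).
Proof. by move=> Vx; rewrite -scaleN1r; apply: lsZ. Qed.
Lemma lsB x y : V x -> V y -> V (x - y).
Proof. by move=> Vx Vy; apply/lsD/lsN. Qed.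
Lemma ls_scal x : scal x -> V x.
Proof. by move=> [k ->]; apply/lsZ/(ls1 HV). Qed.
Lemma ls_sum (I : Type) (r : seq I) (F : I -> A) :
  (forall i, V (F i)) -> V (\sum_(i <- r) F i).
Proof.
by move=> VF; apply: (big_ind V) => // [|x y]; [exact: ls0|exact: lsD].
Qed.

Definition eigen h mu z := V z /\ ad h z = mu *: z.

Lemma eigenD h mu y z : eigen h mu y -> eigen h mu z -> eigen h mu (y + z).
Proof. by move=> [Vy hy] [Vz hz]; split; [exact: lsD|rewrite adDr hy hz scalerDr]. Qed.
Lemma eigenZ h mu a z : eigen h mu z -> eigen h mu (a *: z).
Proof. by move=> [Vz hz]; split; [exact: lsZ|rewrite adZr hz !scalerA mulrC]. Qed.
Lemma eigen0 h mu : eigen h mu 0.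
Proof. by split; [exact: ls0|rewrite ad0r scaler0]. Qed.
Lemma eigen_ad h mu nu y z :
  eigen h mu y -> eigen h nu z -> eigen h (mu + nu) (ad y z).
Proof.
move=> [Vy hy] [Vz hz]; split; first exact: (lsad HV).
by rewrite ad_jacobi hy hz adZl adZr scalerDl.
Qed.

(** Otherwise infinitely many values of this progression would be eigenvalues. *)
Lemma eigen_finite h mu nu : V h -> nu != 0 ->
  exists k, forall z, eigen h (mu + k%:R * nu) z -> z = 0.
Proof.
move=> Vh nu0; have [s sP] := lsfin HV Vh; apply: contrapT => /forallNP noK.
have all_s k : mu + k%:R * nu \in s.
  have /existsNP[z /not_implyP[[Vz hz] /eqP z0]] := noK k.
  have /eqP := sP z Vz; rewrite (shifts_eigen _ hz) scaler_eq0 (negPf z0) orbF.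
  rewrite prodf_seq_eq0 => /hasP[a a_s /=]; rewrite subr_eq0 => /eqP -> //.
have : (size [seq (mu + k%:R * nu)%R | k <- iota 0 (size s).+1] <= size s)%N.
  apply: uniq_leq_size => [|_ /mapP[k _ ->]//].
  rewrite map_inj_uniq ?iota_uniq // => i j /addrI/(mulIf nu0)/eqP.
  by rewrite eqr_nat => /eqP.
by rewrite size_map size_iota ltnn.
Qed.

Lemma eigen_extremal h mu z : V h -> mu != 0 -> eigen h mu z -> z != 0 ->
  exists x kappa, [/\ eigen h kappa x, x != 0, kappa != 0 &
    forall y, eigen h (kappa + mu) y -> y = 0].
Proof.
move=> Vh mu0 hz z0; have [k] := eigen_finite mu Vh mu0.
elim: k => [|k IH].
  by rewrite mul0r addr0 => /(_ z hz) zE; rewrite zE eqxx in z0.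
have [/IH //|/existsNP[x /not_implyP[hx /eqP x0]] ex] :=
  pselect (forall y, eigen h (mu + k%:R * mu) y -> y = 0).
exists x, (mu + k%:R * mu); split => //; last first.
  move=> y; have -> : mu + k%:R * mu + mu = mu + k.+1%:R * mu.
    by rewrite -natr1; ring.
  exact: ex.
have -> : mu + k%:R * mu = k.+1%:R * mu by rewrite -natr1; ring.
by rewrite mulf_neq0 // pnatr_eq0.
Qed.

(** Multiplicity one: an extremal eigenvector x commutes with the generalized
eigenspace, which therefore is commutative, so that its members are multiples of
each other. *)
Lemma eigen_mult1 h mu z y : V h -> mu != 0 -> eigen h mu z -> z != 0 ->
  V y -> eigen h mu (ad h y - mu *: y) -> exists c, y = c *: z.
Proof.
move=> Vh mu0 hz z0 Vy hu; set u := _ - _ in hu.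
have [x [kappa [hx x0 k0 ex]]] := eigen_extremal Vh mu0 hz z0.
have comm w : eigen h mu w -> ad x w = 0 by move=> hw; apply/ex/eigen_ad.
have hyu : ad h y = mu *: y + u by rewrite addrC subrK.
have xy : ad x y = 0.
  apply: ex; split; first by apply: (lsad HV) => //; case: hx.
  rewrite ad_jacobi hyu adDr (comm u hu) addr0 (proj2 hx) adZl adZr.
  by rewrite scalerDl.
have nx := eigenvector_nonscal (proj2 hx) k0 x0.
have zy : ad z y = 0 by apply: (centralizer_comm nx) => //; apply: comm.
have zu : ad z u = 0 by apply: (centralizer_comm nx); apply: comm.
have [b ub] : exists b, u = b *: z.
  apply: (eigenvector_unique (proj2 hz) mu0 z0 zu (b := 0)).
  by rewrite scale0r addr0; case: hu.
by apply: (eigenvector_unique (proj2 hz) mu0 z0 zy (b := b)); rewrite -ub.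
Qed.

Lemma eigen_unique h mu z y : V h -> mu != 0 -> eigen h mu z -> z != 0 ->
  eigen h mu y -> exists c, y = c *: z.
Proof.
move=> Vh mu0 hz z0 [Vy hy]; apply: eigen_mult1 hz z0 Vy _ => //.
by rewrite hy subrr; exact: eigen0.
Qed.

(** A semisimple operator: V is spanned by eigenvectors, stated as an induction
principle. The induction removes one factor ad t - a at a time; Q expresses that
u is in the image of the combinations of eigenvectors under ad t - a, up to an
eigenvector for a. *)
Lemma spectral_ind t (P : A -> Prop) : V t ->
  (forall a v, V v -> eigen t a (ad t v - a *: v) -> ad t v = a *: v) ->
  P 0 -> (forall v w, P v -> P w -> P (v + w)) ->
  (forall a w, eigen t a w -> P w) -> forall v, V v -> P v.
Proof.
move=> Vt ss P0 PD PE v Vv; have [s /(_ v Vv) sv] := lsfin HV Vt.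
elim: s P P0 PD PE v Vv sv => [|a s IH] P P0 PD PE v Vv /= sv; first by rewrite sv.
pose Q u := exists v' e,
  [/\ V v', P v', eigen t a e & ad t v' - a *: v' = u - e].
have Vtv : V (ad t v - a *: v) by apply: lsB; [exact: (lsad HV)|exact: lsZ].
have [||b w hw||v' [e [Vv' Pv' he E]]] := IH Q _ _ _ (ad t v - a *: v) Vtv.
- exists 0, 0; split=> //; [exact: ls0|exact: eigen0|].
  by rewrite ad0r scaler0 subrr.
- move=> u1 u2 [v1 [e1 [V1 P1 h1 E1]]] [v2 [e2 [V2 P2 h2 E2]]].
  exists (v1 + v2), (e1 + e2); split.
  + exact: lsD.
  + exact: PD.
  + exact: eigenD.
  + by rewrite adDr scalerDr opprD addrACA E1 E2 addrACA -opprD.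
- have [ba|ba] := eqVneq b a.
    exists 0, w; split=> //; [exact: ls0|by rewrite -ba|].
    by rewrite ad0r scaler0 !subrr.
  exists ((b - a)^-1 *: w), 0; split.
  + exact/lsZ/(proj1 hw).
  + exact/(PE b)/eigenZ.
  + exact: eigen0.
  + rewrite subr0 adZr (proj2 hw) !scalerA -scalerBl [a * _]mulrC -mulrBr.
    by rewrite mulVf ?scale1r // subr_eq0.
- by rewrite shiftsB shifts_ad shiftsZ.
rewrite -[v](subrK v'); apply: PD => //; apply: (PE a).
have Vvv : V (v - v') by exact: lsB.
split=> //; apply: ss => //.
have -> : ad t (v - v') - a *: (v - v') = e; last by [].
rewrite adBr scalerBr opprD opprK addrACA. rewrite [- ad t v' + _]addrC.
by rewrite -[X in _ + X]opprB E subKr.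
Qed.

End Spectrum.

(** * Weight decompositions *)

Section RankOne.
Variables (K : numClosedFieldType) (V : weyl K -> Prop).
Hypothesis HV : lie_space V.
Local Notation A := (weyl K).
Implicit Types (u v w x y z : A) (a b c mu nu : K).

Section RationalWeights.
Variables (h x0 : A) (l0 : K).
Hypotheses (Vh : V h) (hx0 : eigen V h l0 x0) (l0N0 : l0 != 0) (x0N0 : x0 != 0).

Let hx0E : ad h x0 = l0 *: x0. Proof. by case: hx0. Qed.
Let x0_nonscal : ~ scal x0. Proof. exact: eigenvector_nonscal hx0E l0N0 x0N0. Qed.

(** An element c of weight 0 preserves the line of x0; after subtraction of a
multiple of h it commutes both with h and with x0, which do not commute with each
other, so it is scalar. *)
Lemma eigen_zero (c : A) : eigen V h 0 c -> exists a b, c = a *: h + b%:A.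
Proof.
move=> hc; have [] := eigen_unique HV Vh l0N0 hx0 x0N0 (y := ad c x0).
  by rewrite -[l0]add0r; exact: (eigen_ad HV).
move=> nu cx0; exists (nu / l0).
(* c' commutes with h and with x0 *)
set c' := c - (nu / l0) *: h.
have c'x0 : ad x0 c' = 0.
  rewrite ad_anti adBl adZl cx0 hx0E scalerA divfK // subrr.
  by rewrite oppr0.
have c'h : ad c' h = 0.
  by rewrite adBl adZl adxx scaler0 subr0 ad_anti (proj2 hc) scale0r oppr0.
suff [b cb] : scal c' by exists b; rewrite -cb addrC subrK.
apply: contrapT => nc; have /eqP := centralizer_comm nc c'h (ad_sym c'x0).
by rewrite hx0E scaler_eq0 (negPf l0N0) (negPf x0N0).
Qed.

(** For a nonzero eigenvalue this is eigen_mult1. For the eigenvalue 0, the image of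
v is a combination of h and 1 by eigen_zero; the coefficient of h vanishes because it
would create a Jordan block on the line of x0, and that of 1 because of
ad_eq_scalar. *)
Lemma ad_semisimple a v :
  V v -> eigen V h a (ad h v - a *: v) -> ad h v = a *: v.
Proof.
move=> Vv hu; apply/eqP; rewrite -subr_eq0; apply/eqP.
have [a0|a0] := eqVneq a 0; last first.
  set u := _ - _ in hu *; apply: contrapT => /eqP u0.
  have [c vc] := eigen_mult1 HV Vh a0 hu u0 Vv hu.
  by move: (u0); rewrite {1}/u vc adZr (proj2 hu) !scalerA mulrC subrr eqxx.
rewrite a0 scale0r subr0 in hu *.
have [b [d bd]] := eigen_zero hu.
have E : ad h (ad v x0) = l0 *: ad v x0 + (b * l0) *: x0.
  rewrite ad_jacobi bd adDl ad_scalarl addr0 adZl hx0E adZr scalerA.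
  by rewrite addrC.
have [] := eigen_mult1 HV Vh l0N0 hx0 x0N0 (y := ad v x0).
- by apply: (lsad HV) => //; case: hx0.
- by rewrite E addrC addKr; exact/(eigenZ HV).
move=> nu vx0; have b0 : b = 0.
  apply/eqP; move/eqP: E; rewrite vx0 adZr hx0E !scalerA mulrC -subr_eq0.
  rewrite opprD addrA subrr sub0r oppr_eq0 scaler_eq0 (negPf x0N0) orbF.
  by rewrite mulf_eq0 (negPf l0N0) orbF.
set v' := v - (nu / l0) *: h.
have v'x0 : ad x0 v' = 0.
  rewrite ad_anti adBl adZl vx0 hx0E scalerA divfK // subrr.
  by rewrite oppr0.
have hv' : ad h v' = d%:A by rewrite adBr adZr adxx scaler0 subr0 bd b0 scale0r add0r.
have [k v'k] := ad_eq_scalar hx0E l0N0 x0N0 v'x0 hv'.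
by rewrite -[v](subrK ((nu / l0) *: h)) -/v' v'k adDr ad_scalar add0r adZr adxx scaler0.
Qed.

(** The string of z under ad x0 ends in the centralizer of x0, where the weights
are rational multiples of that of x0. *)
Lemma weight_rational mu z : eigen V h mu z -> z != 0 -> exists r : rat, mu = ratr r * l0.
Proof.
have [k] := eigen_finite HV mu Vh l0N0; elim: k mu z => [|k IH] mu z kP hz z0.
  by move: z0; rewrite (kP z) ?eqxx // mul0r addr0.
have [x0z|x0z] := eqVneq (ad x0 z) 0.
  have [r [-> _ _]] := eigenvalue_ratio hx0E l0N0 x0N0 x0z (proj2 hz) z0.
  by exists r.
have [||r E] := IH (l0 + mu) (ad x0 z) _ _ x0z.
- move=> w hw; apply: kP; rewrite -natr1 mulrDl mul1r addrA addrAC.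
  by rewrite [mu + l0]addrC.
- exact: (eigen_ad HV).
exists (r - 1); rewrite rmorphB rmorph1 mulrBl mul1r -E addrC addKr //.
Qed.

End RationalWeights.

(** A weight decomposition of rank one. S lists the nonzero weights, X r spans the
space of weight r and is 0 outside S, and the space of weight 0 is spanned by h
and 1. *)
Record graded (h : A) (S : seq rat) (X : rat -> A) : Prop := Graded {
  gr_uniq : uniq S;
  gr_S0 : 0 \notin S;
  gr_h : V h;
  gr_X : forall r, eigen V h (ratr r) (X r);
  gr_XN0 : forall r, (X r != 0) = (r \in S);
  gr_weight : forall r z, r != 0 -> eigen V h (ratr r) z -> exists c, z = c *: X r;
  gr_weight0 : forall z, eigen V h 0 z -> exists a b, z = a *: h + b%:A;
  gr_span : forall v, V v ->
    exists a b (c : rat -> K), v = a *: h + b%:A + \sum_(r <- S) c r *: X r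
}.

Lemma rat_sublist (s : seq K) (Q : rat -> Prop) : exists S : seq rat,
  uniq S /\ forall r, r \in S <-> ratr r \in s /\ Q r.
Proof.
elim: s => [|a s [S [uS SP]]].
  by exists [::]; split=> // r; split=> // -[].
have [[r [ra Qr]]|no] := pselect (exists r : rat, ratr r = a /\ Q r); last first.
  exists S; split=> // r; rewrite SP in_cons; split=> [[-> ?]|[/orP[/eqP ra|] //]].
    by rewrite orbT.
  by move=> Qr; case: no; exists r.
exists (undup (r :: S)); split=> [|r']; first exact: undup_uniq.
rewrite mem_undup !in_cons -ra (inj_eq (fmorph_inj _)).
have [->|_] //= := eqVneq r' r; by split.
Qed.

(** By weight_rational all eigenvalues of ad h become rational once one of them is
normalized to 1. *)
Lemma graded_exists h x l : V h -> eigen V h l x -> l != 0 -> x != 0 ->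
  exists S X, graded (l^-1 *: h) S X /\ S != [::].
Proof.
move=> Vh hx l0 x0; set k := _ *: h.
have Vk : V k by exact: (lsZ HV).
have kx : eigen V k 1 x.
  by case: hx => Vx hx; split; rewrite // adZl hx scalerA mulVf.
have n1 : (1 : K) != 0 := oner_neq0 K.
have [s sP] := lsfin HV Vk.
have [S [uS SP]] := rat_sublist s
  (fun r => r != 0 /\ exists z, eigen V k (ratr r) z /\ z != 0).
have in_S r z : eigen V k (ratr r) z -> z != 0 -> r != 0 -> r \in S.
  move=> hz z0 r0; apply/SP; split; last by split=> //; exists z.
  have /eqP := sP z (proj1 hz); rewrite (shifts_eigen _ (proj2 hz)) scaler_eq0.
  rewrite (negPf z0) orbF prodf_seq_eq0 => /hasP[a a_s /=].
  by rewrite subr_eq0 => /eqP ->.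
have /choice[X XP] : forall r, exists z, eigen V k (ratr r) z /\ (z != 0) = (r \in S).
  move=> r; have [rS|rS] := boolP (r \in S).
    by have /SP[_ [_ [z [hz z0]]]] := rS; exists z; rewrite z0.
  by exists 0; rewrite eqxx; split=> //; exact: eigen0.
have S0 : 0 \notin S by apply/negP => /SP[_ []]; rewrite eqxx.
have wt r z : r != 0 -> eigen V k (ratr r) z -> exists c, z = c *: X r.
  move=> r0 hz; have [hX] := XP r; have [rS X0|rS _] := boolP (r \in S).
    by apply: (eigen_unique HV Vk _ hX) => //; rewrite fmorph_eq0.
  have [->|z0] := eqVneq z 0; first by exists 0; rewrite scale0r.
  by rewrite (in_S r z) in rS.
have wt0 := eigen_zero Vk kx n1 x0.
exists S, X; split.
  split=> //; [by move=> r; case: (XP r)|by move=> r; case: (XP r)|].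
  apply: (spectral_ind HV Vk (fun a v => ad_semisimple (a := a) (v := v) Vk kx n1 x0)).
  - exists 0, 0, (fun=> 0); rewrite !scale0r !add0r big1 // => r _.
    by rewrite scale0r.
  - move=> u w [a [b [c ->]]] [a' [b' [c' ->]]].
    exists (a + a'), (b + b'), (fun r => c r + c' r).
    rewrite addrACA; congr (_ + _); first by rewrite addrACA !scalerDl.
    by rewrite -big_split; apply: eq_bigr => r _; rewrite scalerDl.
  - move=> a w hw; have [->|w0] := eqVneq w 0.
      exists 0, 0, (fun=> 0); rewrite !scale0r !add0r big1 // => r _.
      by rewrite scale0r.
    have [r ar] := weight_rational Vk kx n1 x0 hw w0; rewrite mulr1 in ar.
    have [r0|r0] := eqVneq r 0.
      rewrite ar r0 rmorph0 in hw; have [b [c ->]] := wt0 _ hw.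
      exists b, c, (fun=> 0); rewrite big1 ?addr0 // => i _; exact: scale0r.
    rewrite ar in hw; have rS := in_S r w hw w0 r0.
    have [c ->] := wt r w r0 hw.
    exists 0, 0, (fun i => if i == r then c else 0); rewrite !scale0r !add0r.
    rewrite (bigD1_seq r) //= eqxx big1 ?addr0 // => i /negPf ->.
    by rewrite scale0r.
have : 1 \in S by apply: (in_S 1 x) => //; rewrite rmorph1.
by case: (S).
Qed.

End RankOne.

(** * Lifting a Lie algebra of derivations to the Weyl algebra *)

Section Inner.
Variable K : numClosedFieldType.
Local Notation A := (weyl K).
Implicit Types (x y z t w : A).

Fact ad_is_derivation x : ad x \in @is_derivation K A.
Proof.
apply/asboolP; split; first by move=> a y z; rewrite adDr adZr.
by move=> a b; exact: ad_mulr.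
Qed.
Definition inner x : derivation A := Derivation (ad_is_derivation x).

Lemma inner_surj (D : derivation A) : exists x, inner x = D.
Proof.
have [x Dx] := weyl_derivation_inner D; exists x.
by apply: der_ext => y; rewrite Dx.
Qed.

Lemma inner0 : inner 0 = 0.
Proof. by apply: der_ext => z; rewrite /= ad0l. Qed.

Lemma innerL a x y : inner (a *: x + y) = a *: inner x + inner y.
Proof. by apply: der_ext => z; rewrite derDE derZE /= adDl adZl. Qed.

Lemma inner_ad x y : inner (ad x y) = [Lie inner x, inner y].
Proof.
apply: der_ext => z; rewrite [RHS]der_bracketE /=.
by rewrite ad_jacobi addrK.
Qed.

(** The centre of the Weyl algebra consists of scalars: otherwise p and q would
commute, as members of the centralizer of a non-scalar element. *)
Lemma inner_eq x y : inner x = inner y <-> scal (x - y).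
Proof.
split=> [E|s]; last first.
  apply: der_ext => z /=; apply/eqP; rewrite -subr_eq0 -adBl.
  by rewrite (scal_adl _ s).
have c z : ad (x - y) z = 0.
  by rewrite adBl -[ad x z]/(inner x z) E subrr.
apply: contrapT => nc; have := centralizer_comm nc (c (weyl_p K)) (c (weyl_q K)).
by rewrite ad_pq => /eqP; rewrite oner_eq0.
Qed.

Definition lift_space (g : lieSubalg (derivation A)) x : Prop := inner x \in g.

Section LieSpace.
Variables (g : lieSubalg (derivation A)) (n : nat) (v : 'I_n.+1 -> g).
Hypothesis g_span : forall x : g, exists a : 'I_n.+1 -> K, x = \sum_i a i *: v i.

Lemma lift_generators : exists b : 'I_n.+1 -> A,
  (forall i, lift_space g (b i)) /\
  forall w, lift_space g w -> exists u : 'rV_n.+1, scal (w - \sum_i u 0 i *: b i).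
Proof.
have /choice[b bP] i : exists x, inner x = val (v i) by exact: inner_surj.
exists b; split=> [i|w gw].
  by rewrite /lift_space bP; exact: (lsub_valP (v i)).
have [a Ew] := g_span (LSub gw); exists (\row_i a i); apply/inner_eq.
rewrite -[inner w]/(val (LSub gw)) Ew.
have -> : forall I (r : seq I) (F : I -> g), val (\sum_(i <- r) F i) = \sum_(i <- r)
  val (F i).
  by move=> I r F; elim/big_rec2: _ => // i x y _ <-.
symmetry; elim/big_rec2: _ => [|i x y _ <-]; first exact: inner0.
by rewrite innerL mxE bP.
Qed.

(** Cayley-Hamilton for the matrix M of ad t in a system of generators, modulo
scalars; the additional factor ad t kills the scalars. *)
Lemma lift_annihilator t : lift_space g t ->
  exists s : seq K, forall w, lift_space g w -> shifts t s w = 0.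
Proof.
move=> gt; have [b [gb bP]] := lift_generators.
pose psi (u : 'rV_n.+1) := \sum_i u 0 i *: b i.
have psiD a u u' : psi (a *: u + u') = a *: psi u + psi u'.
  rewrite /psi scaler_sumr -big_split; apply: eq_bigr => i _.
  by rewrite !mxE scalerDl scalerA.
have gad w : lift_space g w -> lift_space g (ad t w).
  by rewrite /lift_space inner_ad => gw; apply: lsub_lie.
have /choice[r rP] i := bP _ (gad _ (gb i)).
pose M : 'M[K]_n.+1 := \matrix_(i, j) r i 0 j.
have psiM u : scal (ad t (psi u) - psi (u *m M)).
  rewrite /psi raddf_sum.
  under [X in _ - X]eq_bigr => j _ do rewrite mxE scaler_suml.
  rewrite [X in _ - X]exchange_big -sumrB /=.
  elim/big_ind: _ => [|x y|i _]; [exact: scal0|exact: scalD|].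
  under eq_bigr => j _ do rewrite mxE -scalerA.
  by rewrite adZr -scaler_sumr -scalerBr; apply: scalZ; exact: rP.
have [s Ms] := closed_field_poly_normal (char_poly M).
have shiftsM u : scal (shifts t s (psi u) - psi (u *m horner_mx M (\prod_(a <- s) ('X -
  a%:P)))).
  elim: (s) => [|a s' IH]; first by rewrite big_nil rmorph1 mulmx1 subrr; exact: scal0.
  rewrite big_cons mulrC rmorphM /= mulmxA.
  set u' := u *m _ in IH *; set w := shifts _ _ _ in IH *.
  have -> : horner_mx M ('X - a%:P) = M - a%:M by rewrite rmorphB /= horner_mx_X
    horner_mx_C.
  have -> : ad t w = ad t (psi u').
    by apply/eqP; rewrite -subr_eq0 -adBr (scal_ad _ IH).
  have -> : u' *m (M - a%:M) = - a *: u' + u' *m M.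
    by rewrite mulmxBr mul_mx_scalar addrC scaleNr.
  rewrite psiD scaleNr.
  have -> : ad t (psi u') - a *: w - (- (a *: psi u') + psi (u' *m M))
    = (ad t (psi u') - psi (u' *m M)) - a *: (w - psi u').
    by rewrite scalerBr !opprD !opprK [a *: psi u' - _]addrC addrACA.
  by apply: scalB; [exact: psiM|exact: scalZ].
have psi0 : psi 0 = 0 by rewrite /psi big1 // => i _; rewrite mxE scale0r.
have shifts_scal x : scal x -> scal (shifts t s x).
  move=> sx; elim: (s) => //= a s' IH.
  by rewrite (scal_ad _ IH) sub0r; apply/scalN/scalZ.
exists (0 :: s) => w gw; rewrite /= scale0r subr0; apply: scal_ad.
have [u wu] := bP w gw; rewrite -[w](subKr (psi u)) shiftsB; apply: scalB.
  have := shiftsM u; have := Cayley_Hamilton M; rewrite Ms (monicP (char_poly_monic M))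
    scale1r.
  by move=> ->; rewrite mulmx0 psi0 subr0.
by apply: shifts_scal; rewrite -opprB; apply: scalN.
Qed.

Lemma lift_lie_space : lie_space (lift_space g).
Proof.
have inner1 : inner 1 = 0 by apply: der_ext => z; rewrite /= ad1l.
split=> [|a x y|x y|].
- by rewrite /lift_space inner1; case: (lsub_submod g).
- by rewrite /lift_space innerL; case: (lsub_submod g) => _; apply.
- by rewrite /lift_space inner_ad; exact: lsub_lie.
- exact: lift_annihilator.
Qed.
End LieSpace.
End Inner.

(** * Recognizing a model *)

Lemma lie_isomorphic_sym (K : fieldType) (L M : lieAlgType K) :
  lie_isomorphic L M -> lie_isomorphic M L.
Proof.
move=> [f [[f' fK f'K] fl]].
have f'lin : linear f'.
  by move=> a x y; apply: (can_inj fK); rewrite f'K linearP !f'K.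
pose F : {linear M -> L} :=
  HB.pack_for {linear M -> L} f' (GRing.isLinear.Build K M L _ f' f'lin).
exists F; split; first by exists f.
by move=> x y; apply: (can_inj fK); rewrite fl !f'K.
Qed.

Section Models.
Variable K : numClosedFieldType.
Local Notation A := (weyl K).

(** An isomorphism from L onto V modulo scalars, presented by representatives in
the Weyl algebra for which linearity and brackets hold up to scalars. *)
Record is_model (L : lieAlgType K) (V : A -> Prop) (F : L -> A) : Prop := {
  md_V : forall m, V (F m);
  md_lin : forall a m n, scal (F (a *: m + n) - (a *: F m + F n));
  md_lie : forall m n, scal (F [Lie m, n] - ad (F m) (F n));
  md_inj : forall m, scal (F m) -> m = 0;
  md_surj : forall v, V v -> exists m, scal (v - F m)
}.

Lemma model_isomorphic (L : lieAlgType K) (g : lieSubalg (derivation A)) (F : L -> A) :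
  is_model (lift_space g) F -> lie_isomorphic g L.
Proof.
move=> HF; apply: lie_isomorphic_sym.
pose G m : g := LSub (md_V HF m).
have Glin : linear G.
  move=> a m n; apply: val_inj; rewrite /= -innerL; apply/inner_eq.
  exact: (md_lin HF).
pose GL : {linear L -> g} :=
  HB.pack_for {linear L -> g} G (GRing.isLinear.Build K L g _ G Glin).
exists GL; split; last first.
  move=> m n; apply: val_inj; rewrite /= -inner_ad; apply/inner_eq.
  exact: (md_lie HF).
have Ginj : injective GL.
  move=> m n /(congr1 val) /= /inner_eq mn; apply/eqP; rewrite -subr_eq0.
  apply/eqP/(md_inj HF); have := md_lin HF (-1) n m.
  rewrite !scaleN1r [- n + m]addrC [- F n + _]addrC => s.
  by rewrite -[F _](subrK (F m - F n)); apply: scalD.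
have Gsurj D : exists m, GL m = D.
  have [x xD] := inner_surj (val D).
  have [|m xm] := md_surj HF (v := x).
    by rewrite /lift_space xD; exact: (lsub_valP D).
  by exists m; apply: val_inj; rewrite /= -xD; apply/esym/inner_eq.
by have [f fK] := choice Gsurj; exists f => // m; apply: Ginj; rewrite fK.
Qed.

Section Tables.
Variables (I : finType) (c : lieTable K I) (B : I -> A).

Definition comb (x : {ffun I -> K^o}) : A := \sum_i x i *: B i.

Lemma comb_linear a x y : comb (a *: x + y) = a *: comb x + comb y.
Proof.
rewrite /comb scaler_sumr -big_split; apply: eq_bigr => i _.
by rewrite !ffunE scalerDl scalerA.
Qed.

Lemma comb0 : comb 0 = 0.
Proof. by rewrite /comb big1 // => i _; rewrite ffunE scale0r. Qed.
Lemma combZ a u : comb (a *: u) = a *: comb u.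
Proof. by rewrite -[a *: u]addr0 comb_linear comb0 addr0. Qed.
Lemma combD u v : comb (u + v) = comb u + comb v.
Proof. by rewrite -[u]scale1r comb_linear !scale1r. Qed.
Lemma combB u v : comb (u - v) = comb u - comb v.
Proof. by rewrite combD -scaleN1r combZ scaleN1r. Qed.
Lemma comb_basis i : comb (basis_vec K i) = B i.
Proof.
rewrite /comb (bigD1 i) //= ffunE eqxx scale1r big1 ?addr0 // => j /negPf ji.
by rewrite ffunE ji scale0r.
Qed.

Lemma comb_lie (x y : table_lie c) :
    (forall i j, scal (ad (B i) (B j) - comb (c i j - c j i))) ->
  scal (comb [Lie x, y] - ad (comb x) (comb y)).
Proof.
move=> HB.
have comb_sum (r : seq I) (P : I -> {ffun I -> K^o}) :
    comb (\sum_(i <- r) P i) = \sum_(i <- r) comb (P i).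
  by elim/big_rec2: _ => [|i u v _ <-]; [exact: comb0|exact: combD].
have -> : [Lie x, y] = \sum_i \sum_j (x i * y j) *: (c i j - c j i).
  rewrite -[LHS]/(table_bracket c x y) /table_bracket.
  under eq_bigr => i _ do under eq_bigr => j _ do rewrite scalerBl.
  under eq_bigr => i _ do rewrite sumrB.
  rewrite sumrB [X in _ - X]exchange_big -sumrB; apply: eq_bigr => i _.
  by rewrite -sumrB; apply: eq_bigr => j _; rewrite -scalerBr mulrC.
have -> : ad (comb x) (comb y) = \sum_i \sum_j (x i * y j) *: ad (B i) (B j).
  rewrite /comb ad_suml; apply: eq_bigr => i _; rewrite ad_sumr.
  by apply: eq_bigr => j _; rewrite adZl adZr scalerA.
rewrite comb_sum -sumrB; elim/big_ind: _ => [|u v|i _]; [exact: scal0|exact: scalD|].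
rewrite comb_sum -sumrB; elim/big_ind: _ => [|u v|j _]; [exact: scal0|exact: scalD|].
by rewrite combZ -scalerBr; apply: scalZ; rewrite -opprB; apply/scalN/HB.
Qed.

Lemma table_model (V : A -> Prop) : lie_space V ->
    (forall i, V (B i)) ->
    (forall i j, scal (ad (B i) (B j) - comb (c i j - c j i))) ->
    (forall x, scal (comb x) -> x = 0) ->
    (forall v, V v -> exists x, scal (v - comb x)) ->
  is_model (L := table_lie c) V comb.
Proof.
move=> HV BV Bc Binj Bsurj; split=> //.
- move=> x; apply: (ls_sum HV) => i; exact: (lsZ HV).
- by move=> a x y; rewrite comb_linear subrr; exact: scal0.
- by move=> x y; exact: comb_lie.
Qed.
End Tables.
End Models.

(** * Brackets of weight vectors *)

Lemma seq_rat_max (S : seq rat) : S != [::] ->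
  exists2 a, a \in S & forall r, r \in S -> r <= a.
Proof.
elim: S => [|r S IH] // _; have [->|S0] := eqVneq S [::].
  by exists r; rewrite ?mem_head // => r'; rewrite inE => /eqP ->.
have [a aS aM] := IH S0; have [le|lt] := leP r a.
  exists a => [|r']; first by rewrite in_cons aS orbT.
  by rewrite in_cons => /orP[/eqP ->|/aM].
exists r => [|r']; first exact: mem_head.
by rewrite in_cons => /orP[/eqP ->|/aM] // /le_trans -> //; exact: ltW.
Qed.

Section GradedTheory.
Variables (K : numClosedFieldType) (V : weyl K -> Prop).
Hypothesis HV : lie_space V.
Local Notation A := (weyl K).
Implicit Types (h u v w x y z : A) (S : seq rat) (X : rat -> A) (r s t : rat).

(** Replacing h by - h exchanges positive and negative weights. *)
Lemma graded_opp h S X : graded V h S X ->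
  graded V (- h) (map -%R S) (fun r => X (- r)).
Proof.
have opp_eigen a z : eigen V (- h) a z <-> eigen V h (- a) z.
  split=> -[Vz E]; split=> //; last by rewrite adNl E scaleNr opprK.
  by rewrite scaleNr -E adNl opprK.
case=> uS S0 Vh hX XN0 wt wt0 span; split.
- by rewrite (map_inj_uniq oppr_inj).
- by rewrite -[0]oppr0 (mem_map oppr_inj).
- exact: (lsN HV).
- by move=> r; apply/opp_eigen; rewrite -rmorphN; exact: hX.
- by move=> r; rewrite XN0 -{2}[r]opprK (mem_map oppr_inj).
- move=> r z r0 /opp_eigen; rewrite -rmorphN; apply: wt; by rewrite oppr_eq0.
- move=> z /opp_eigen; rewrite oppr0 => /wt0[a [b ->]].
  by exists (- a), b; rewrite scalerN scaleNr opprK.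
- move=> v /span[a [b [c ->]]]; exists (- a), b, (fun r => c (- r)).
  rewrite scalerN scaleNr opprK big_map; congr (_ + _).
  by apply: eq_bigr => r _; rewrite opprK.
Qed.

Lemma graded_perm h S S' X : perm_eq S S' -> graded V h S X -> graded V h S' X.
Proof.
move=> SS' [uS S0 Vh hX XN0 wt wt0 span]; split=> //.
- by rewrite -(perm_uniq SS').
- by rewrite -(perm_mem SS').
- by move=> r; rewrite XN0 (perm_mem SS').
- move=> v /span[a [b [c ->]]]; exists a, b, c.
  by rewrite (perm_big _ SS').
Qed.

Section OneGrading.
Variables (h : A) (S : seq rat) (X : rat -> A).
Hypothesis HG : graded V h S X.

Lemma gr_adX r : ad h (X r) = ratr r *: X r.
Proof. by case: (gr_X HG r). Qed.
Lemma gr_VX r : V (X r).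
Proof. by case: (gr_X HG r). Qed.

Lemma gr_neq0 r : r \in S -> r != 0.
Proof. by apply: contraTneq => ->; exact: (gr_S0 HG). Qed.

Lemma gr_nonscal r : r \in S -> ~ scal (X r).
Proof.
move=> rS; apply: (eigenvector_nonscal (gr_adX r)).
  by rewrite fmorph_eq0 gr_neq0.
by rewrite (gr_XN0 HG).
Qed.

Lemma gr_notin r : r \notin S -> X r = 0.
Proof. by rewrite -(gr_XN0 HG) negbK => /eqP. Qed.

Lemma gr_eigen_ad r s : eigen V h (ratr (r + s)) (ad (X r) (X s)).
Proof. by rewrite rmorphD; apply: (eigen_ad HV); exact: (gr_X HG). Qed.

Lemma gr_ad r s : r + s != 0 -> exists c, ad (X r) (X s) = c *: X (r + s).
Proof. by move=> rs; apply: (gr_weight HG) => //; exact: gr_eigen_ad. Qed.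

Lemma gr_ad0 r : exists a b, ad (X r) (X (- r)) = a *: h + b%:A.
Proof.
by apply: (gr_weight0 HG); have := gr_eigen_ad r (- r); rewrite subrr rmorph0.
Qed.

(** The vector of largest weight commutes with all vectors of positive weight, so
these lie in a commutative centralizer. *)
Lemma gr_pos_comm r s : 0 < r -> 0 < s -> ad (X r) (X s) = 0.
Proof.
move=> r0 s0; have [rS|/gr_notin ->] := boolP (r \in S); last exact: ad0l.
have [|a aS aM] := @seq_rat_max S; first by case: (S) rS.
have a0 : 0 < a by exact: lt_le_trans (aM r rS).
have comm t : 0 < t -> ad (X a) (X t) = 0.
  move=> t0; have at0 : a < a + t by rewrite ltrDl.
  have [|c ->] := @gr_ad a t; first by rewrite gt_eqF // addr_gt0.
  rewrite gr_notin ?scaler0 //; apply/negP => /aM.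
  by rewrite leNgt at0.
by apply: (centralizer_comm (gr_nonscal aS)); exact: comm.
Qed.

(** Commuting eigenvectors have eigenvalues of the same sign, by
eigenvalue_ratio. *)
Lemma gr_opp_ad r s : r \in S -> s \in S -> 0 < r -> s < 0 -> ad (X r) (X s) != 0.
Proof.
move=> rS sS r0 s0; apply/eqP => c.
have rN0 : ratr r != 0 :> K by rewrite fmorph_eq0 gt_eqF.
have [||t [E t0 _]] := eigenvalue_ratio (gr_adX r) rN0 _ c (gr_adX s).
- by rewrite (gr_XN0 HG).
- by rewrite (gr_XN0 HG).
move: E; rewrite -rmorphM => /fmorph_inj E.
by move: s0; rewrite E ltNge mulr_ge0 // ltW.
Qed.

Lemma eigen_indep (T : seq rat) (w : rat -> A) :
  uniq T -> (forall r, ad h (w r) = ratr r *: w r) ->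
  \sum_(r <- T) w r = 0 -> forall r, r \in T -> w r = 0.
Proof.
elim: T w => // a T IH w /= /andP[aT uT] hw; rewrite big_cons => E.
have wT r : r \in T -> w r = 0.
  move=> rT; have ra : ratr r - ratr a != 0 :> K.
    rewrite -rmorphB fmorph_eq0 subr_eq0.
    by apply: contraNneq aT => <-.
  have : (ratr r - ratr a) *: w r = 0.
    apply: (IH (fun r => (ratr r - ratr a) *: w r)) => //.
      by move=> r'; rewrite adZr hw !scalerA mulrC.
    transitivity (ad h (w a + \sum_(r <- T) w r) - ratr a *: (w a + \sum_(r <- T) w r)).
      rewrite adDr hw ad_sumr scalerDr opprD addrACA subrr add0r scaler_sumr -sumrB.
      by apply: eq_bigr => r' _; rewrite hw scalerBl.
    by rewrite E ad0r scaler0 subrr.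
  by move/eqP; rewrite scaler_eq0 (negPf ra) => /eqP.
move=> r; rewrite in_cons => /orP[/eqP ->|]; last exact: wT.
by move: E; rewrite big_seq big1 ?addr0.
Qed.

Lemma gr_h_nonscal : S != [::] -> ~ scal h.
Proof.
case: S (HG) => // r S' HG' _ sh; have := gr_XN0 HG' r; rewrite mem_head => X0.
have /eqP := scal_adl (X r) sh; case: (gr_X HG' r) => _ ->.
rewrite scaler_eq0 (negPf X0) orbF fmorph_eq0 => /eqP r0.
by have := gr_S0 HG'; rewrite r0 mem_head.
Qed.

Lemma gr_free a (c : rat -> K) : S != [::] ->
  scal (a *: h + \sum_(r <- S) c r *: X r) -> a = 0 /\ forall r, r \in S -> c r = 0.
Proof.
move=> S0 sc.
have E : \sum_(r <- S) ratr r *: (c r *: X r) = 0.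
  rewrite -[RHS](scal_ad h sc) adDr adZr adxx scaler0 add0r ad_sumr.
  by apply: eq_bigr => r _; rewrite adZr gr_adX !scalerA mulrC.
have c0 r : r \in S -> c r = 0.
  have hw r' : ad h (ratr r' *: (c r' *: X r')) = ratr r' *: (ratr r' *: (c r' *: X r')).
    by rewrite !adZr gr_adX !scalerA; congr (_ *: _); ring.
  move=> rS; have /eqP := eigen_indep (gr_uniq HG) hw E rS.
  rewrite !scaler_eq0 fmorph_eq0 (negPf (gr_neq0 rS)) /=.
  by have := gr_XN0 HG r; rewrite rS => /negPf ->; rewrite orbF => /eqP.
split=> //; have [//|a0] := eqVneq a 0; case: (gr_h_nonscal S0).
move: sc; rewrite big_seq big1 => [|r rS]; last by rewrite c0 // scale0r.
by rewrite addr0 => /(scalZ a^-1); rewrite scalerK.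
Qed.

End OneGrading.

Lemma gr_neg_comm h S X : graded V h S X ->
  forall r s, r < 0 -> s < 0 -> ad (X r) (X s) = 0.
Proof.
move=> /graded_opp HG r s r0 s0; have := gr_pos_comm HG (r := - r) (s := - s).
by rewrite !opprK !oppr_gt0; apply.
Qed.

End GradedTheory.

(** * Weights of one sign: the diagonal algebras *)

Lemma sum_option (A : zmodType) (I : finType) (F : option I -> A) :
  \sum_o F o = F None + \sum_i F (Some i).
Proof.
rewrite (bigD1 None) //=; congr (_ + _).
rewrite (reindex_omap Some id) => [|[]] //=.
by apply: eq_bigl => i; rewrite eqxx.
Qed.

Lemma common_denominator (S : seq rat) : exists D : int, 0 < D /\
  forall r, r \in S -> exists k : int, D%:~R * r = k%:~R.
Proof.
elim: S => [|r S [D [D0 DP]]]; first by exists 1.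
exists (denq r * D); split=> [|s]; first by rewrite mulr_gt0 // denq_gt0.
rewrite in_cons => /orP[/eqP ->|/DP[k Dk]].
  by exists (D * numq r); rewrite !intrM numqE; ring.
by exists (denq r * k); rewrite intrM -mulrA Dk intrM.
Qed.

Lemma seq_interpolation (K : Type) (x0 : K) (S : seq rat) (x : 'I_(size S) -> K) :
  uniq S -> exists c : rat -> K, forall k : 'I_(size S), c (nth 0 S k) = x k.
Proof.
move=> uS; exists (fun r => if insub (index r S) is Some k then x k else x0) => k.
by rewrite index_uniq // valK.
Qed.

Section Diagonal.
Variables (K : numClosedFieldType) (V : weyl K -> Prop).
Hypothesis HV : lie_space V.

(** All brackets of weight vectors vanish; the weights become integers after
multiplication of h by a common denominator, with a sign to match the convention
of the model. *)
Lemma diag_case h S X : graded V h S X -> S != [::] -> (forall r, r \in S -> 0 < r) ->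
  exists n (i : 'I_n -> int), [/\ (1 <= n)%N, (forall k, 0 < i k),
    (forall j k : 'I_n, (j < k)%N -> i j < i k) & exists F, is_model (L := diag_lie K
      i) V F].
Proof.
move=> HG0 S0 pos0; set T := sort <=%O S.
have ST : perm_eq S T by rewrite perm_sym perm_sort.
have HG := graded_perm ST HG0.
have pos r : r \in T -> 0 < r by rewrite -(perm_mem ST); exact: pos0.
have T0 : T != [::] by rewrite -size_eq0 -(perm_size ST) size_eq0.
have uT := gr_uniq HG; have [D [D0 DP]] := common_denominator T.
pose n := size T; pose r (k : 'I_n) := nth 0 T k.
have rT k : r k \in T by rewrite mem_nth.
pose i (k : 'I_n) := numq (D%:~R * r k).
have iE k : (i k)%:~R = D%:~R * r k.
  by have [m Em] := DP _ (rT k); rewrite /i Em numq_int.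
have iK k : (i k)%:~R = D%:~R * ratr (r k) :> K.
  by rewrite -[LHS]ratr_int iE rmorphM /= ratr_int.
have D0' : 0 < D%:~R :> rat by rewrite ltr0z.
have DK : D%:~R != 0 :> K by rewrite intr_eq0 gt_eqF.
exists n, i; split.
- by rewrite lt0n size_eq0.
- by move=> k; rewrite -(ltr0z rat) iE mulr_gt0 // pos.
- move=> j k jk; rewrite -(ltr_int rat) !iE ltr_pM2l //.
  have : sorted <%O T by rewrite sort_lt_sorted (gr_uniq HG0).
  move=> sT; apply: (sorted_ltn_nth lt_trans) => //; exact: ltn_ord.
pose B (o : option 'I_n) := if o is Some k then X (r k) else - D%:~R *: h.
have sumT (c : rat -> K) : \sum_(s <- T) c s *: X s = \sum_(k < n) c (r k) *: X (r k).
  by rewrite (big_nth 0) big_mkord.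
have combE x : comb B x = (- D%:~R * x None) *: h + \sum_k x (Some k) *: X (r k).
  by rewrite /comb sum_option /= scalerA mulrC.
exists (comb B); apply: table_model => //.
- case=> [k|]; first exact: (gr_VX HG).
  by apply: (lsZ HV); exact: (gr_h HG).
- have hX k : ad (B None) (B (Some k)) = comb B (diag_coef K i None (Some k)).
    rewrite /= adZl (gr_adX HG) combZ comb_basis /= scalerA iK.
    by rewrite mulNr.
  have cS j o : comb B (diag_coef K i (Some j) o) = 0 by case: o => *; exact: comb0.
  have cN : comb B (diag_coef K i None None) = 0 by exact: comb0.
  case=> [j|] [k|]; rewrite combB ?cN ?cS ?subr0 ?sub0r.
  + by rewrite (gr_pos_comm HV HG) ?pos //; exact: scal0.
  + by rewrite -hX (ad_anti (B None)) opprK subrr; exact: scal0.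
  + by rewrite -hX subrr; exact: scal0.
  + by rewrite adxx; exact: scal0.
- move=> x; rewrite combE; have [c cx] := seq_interpolation 0 (fun k => x (Some k)) uT.
  have -> : \sum_k x (Some k) *: X (r k) = \sum_(s <- T) c s *: X s.
    by rewrite sumT; apply: eq_bigr => k _; rewrite cx.
  move=> /(gr_free HG T0)[/eqP x0 c0]; apply/ffunP => -[k|]; rewrite ffunE.
    by rewrite -cx; exact: c0 (rT k).
  by move: x0; rewrite mulf_eq0 oppr_eq0 (negPf DK) => /eqP.
- move=> v /(gr_span HG)[a [b [c ->]]].
  exists [ffun o => if o is Some k then c (r k) else - (D%:~R)^-1 * a].
  rewrite combE ffunE sumT mulrA mulrNN divff // mul1r.
  under [X in _ - (_ + X)]eq_bigr => k _ do rewrite ffunE.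
  rewrite [X in scal (X - _)]addrAC [X in scal (X - _)]addrC addrK; exact: scal_k.
Qed.
End Diagonal.

(** * Ladders of weights: the extended filiform algebras *)

Lemma quotient_model (K : numClosedFieldType) (V : weyl K -> Prop)
    (L : lieAlgType K) (I : lieIdeal L) (F : L -> weyl K) :
    (forall m, V (F m)) ->
    (forall a m n, F (a *: m + n) = a *: F m + F n) ->
    (forall m n, scal (F [Lie m, n] - ad (F m) (F n))) ->
    (forall m, scal (F m) <-> m \in I) ->
    (forall v, V v -> exists m, scal (v - F m)) ->
  is_model (L := lie_quot I) V (fun m => F (lquot_repr m)).
Proof.
move=> FV Flin Flie Fker Fsurj.
have FB m n : F (m - n) = F m - F n by rewrite addrC -scaleN1r Flin scaleN1r addrC.
have repr_pi m : scal (F (lquot_repr (lquot_pi I m) - m)).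
  by apply/Fker/lquot_eq; rewrite lquot_reprK.
split=> [m|a m n|m n|m|v /Fsurj[m vm]]; first exact: FV.
- rewrite -Flin -FB; apply/Fker/lquot_eq.
  by rewrite lquot_reprK lquot_pi_linear !lquot_reprK.
- have := scalD (repr_pi [Lie lquot_repr m, lquot_repr n]) (Flie (lquot_repr m)
  (lquot_repr n)).
  by rewrite FB addrA subrK.
- move=> /Fker mI; rewrite -[m]lquot_reprK -(lquot_pi0 I).
  by apply/lquot_eq; rewrite subr0.
- exists (lquot_pi I m); have := scalB vm (repr_pi m).
  by rewrite FB opprB addrA subrK.
Qed.

Section FiliformExt.
Variables (K : numClosedFieldType) (V : weyl K -> Prop).
Hypothesis HV : lie_space V.
Local Notation A := (weyl K).

(** The weights of X_0, ..., X_n; that of the central vector X_n is 0. *)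
Definition filiform_weight (b : rat) n (j : nat) : rat :=
  if j == 0%N then - b else (n - j)%:R * b.

Lemma filiform_weight_inj b n : b != 0 -> 
  {in iota 0 n &, injective (filiform_weight b n)}.
Proof.
move=> b0 i j; rewrite !mem_iota /filiform_weight /= add0n => ilt jlt.
case: eqP => [->|i0]; case: eqP => [->|j0] //.
- move/eqP; rewrite -subr_eq0 -opprD oppr_eq0 -{1}[b]mul1r -mulrDl mulf_eq0 (negPf b0).
  by rewrite nat1r pnatr_eq0.
- move/eqP; rewrite -subr_eq0 opprK -{2}[b]mul1r -mulrDl mulf_eq0 (negPf b0).
  by rewrite natr1 pnatr_eq0.
- by move/(mulIf b0)/eqP; rewrite eqr_nat; lia.
Qed.

Section Chain.
Variables (h : A) (X : rat -> A) (b : rat) (n : nat).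
Let wt := filiform_weight b n.
Hypotheses (HG : graded V h [seq wt j | j <- iota 0 n] X).
Hypotheses (b0 : 0 < b) (n2 : (2 <= n)%N) (bb : scal (ad (X (- b)) (X b))).

(** The vectors X_0, ..., X_n of the model: X_0 has weight - b, X_1 has the largest
weight, and each further one is the bracket of X_0 with its predecessor; X_n is
scalar, as the central vector of the model has to be. *)
Definition chain (j : nat) : A :=
  if j == 0%N then X (- b) else iter j.-1 (ad (X (- b))) (X (wt 1)).

Let wtS j : (0 < j < n)%N -> - b + wt j = wt j.+1.
Proof.
move=> /andP[j0 jn]; rewrite /wt /filiform_weight /= -[j == 0%N]negbK -lt0n j0 /=.
have -> : (n - j = (n - j.+1).+1)%N by lia.
by rewrite -natr1; ring.
Qed.

Let wt_pos j : (0 < j < n)%N -> 0 < wt j.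
Proof.
move=> /andP[j0 jn]; rewrite /wt /filiform_weight gtn_eqF //.
by rewrite mulr_gt0 // ltr0n subn_gt0.
Qed.

Let wt_in j : (j < n)%N -> wt j \in [seq wt j | j <- iota 0 n].
Proof. by move=> jn; apply: map_f; rewrite mem_iota. Qed.

Lemma chainS j : (0 < j)%N -> ad (chain 0) (chain j) = chain j.+1.
Proof. by case: j. Qed.

Lemma chain_weight j : (j < n)%N -> exists2 y, y != 0 & chain j = y *: X (wt j).
Proof.
have X0 : chain 0 = X (- b) by [].
case: j => [_|j]; first by exists 1; rewrite ?oner_neq0 // scale1r.
elim: j => [|j IH] jn; first by exists 1; rewrite ?oner_neq0 // scale1r.
have [y y0 yE] := IH (ltnW jn).
have j1 : (0 < j.+1 < n)%N by rewrite (ltnW jn).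
have wN0 : - b + wt j.+1 != 0 by rewrite wtS // gt_eqF ?wt_pos.
have [c cE] := gr_ad HV HG wN0.
exists (y * c); last first.
  by rewrite -chainS // yE adZr X0 -scalerA -(wtS j1); congr (_ *: _); exact: cE.
rewrite mulf_neq0 //; apply: contraTneq (gr_opp_ad HG (r := wt j.+1) (s := - b) _ _
  (wt_pos j1) _).
- by move=> c0; rewrite ad_anti cE c0 scale0r oppr0 eqxx.
- by apply: wt_in; rewrite ltnW.
- by rewrite -[- b]/(wt 0); apply: wt_in; apply: ltnW.
- by rewrite oppr_lt0.
Qed.

Lemma chain_scal : scal (chain n).
Proof.
have [y _ yE] := chain_weight (j := n.-1) ltac:(lia).
have <- : ad (chain 0) (chain n.-1) = chain n by rewrite chainS ?prednK //; lia.
rewrite yE adZr; apply: scalZ.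
suff -> : wt n.-1 = b by [].
rewrite /wt /filiform_weight.
have -> : (n.-1 == 0)%N = false by lia.
have -> : (n - n.-1)%N = 1%N by lia.
by rewrite mul1r.
Qed.

Definition ext_basis (o : option 'I_n.+1) : A :=
  if o is Some j then chain j else - (ratr b)^-1 *: h.

Let bK : ratr b != 0 :> K. Proof. by rewrite fmorph_eq0 gt_eqF. Qed.

Lemma chain_V j : (j <= n)%N -> V (chain j).
Proof.
rewrite leq_eqVlt => /orP[/eqP ->|jn]; first exact/(ls_scal HV)/chain_scal.
have [y _ ->] := chain_weight jn; apply: (lsZ HV); exact: (gr_VX HG).
Qed.

Lemma ext_basis_h (j : 'I_n.+1) :
  ad (ext_basis None) (chain j) = filiform_wt K j *: chain j.
Proof.
rewrite /filiform_wt -val_eqE /=; have := ltn_ord j; rewrite ltnS leq_eqVlt.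
case/orP => [/eqP jn|jn].
  have -> : (j == 0 :> nat) = false by lia.
  by rewrite jn subnn oppr0 scale0r; apply/scal_ad/chain_scal.
have [y _ ->] := chain_weight jn.
rewrite adZl adZr (gr_adX HG) !scalerA; congr (_ *: _).
rewrite /wt /filiform_weight; case: ifP => _; rewrite ?rmorphN ?rmorphM ?rmorph_nat.
  by rewrite /=; field.
by rewrite -?mulNrn /=; field.
Qed.

Lemma ext_basis_V o : V (ext_basis o).
Proof.
case: o => [j|] /=; first by apply: chain_V; rewrite -ltnS.
by apply: (lsZ HV); exact: (gr_h HG).
Qed.

Lemma chain_comm i j : (0 < i <= n)%N -> (0 < j <= n)%N -> ad (chain i) (chain j) = 0.
Proof.
move=> /andP[i0 i_n] /andP[j0 j_n].
move: i_n; rewrite leq_eqVlt => /orP[/eqP ->|i_n]; first exact/scal_adl/chain_scal.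
move: j_n; rewrite leq_eqVlt => /orP[/eqP ->|j_n]; first exact/scal_ad/chain_scal.
have [y _ ->] := chain_weight i_n; have [y' _ ->] := chain_weight j_n.
by rewrite adZl adZr (gr_pos_comm HV HG) ?scaler0 ?wt_pos // ?i0 ?j0.
Qed.

Lemma ext_basis_bracket o o' :
  scal (ad (ext_basis o) (ext_basis o') -
        comb ext_basis (filiform_ext_coef K o o' - filiform_ext_coef K o' o)).
Proof.
have hE (k : 'I_n.+1) : ad (ext_basis None) (ext_basis (Some k)) =
    comb ext_basis (filiform_ext_coef K None (Some k)).
  rewrite [LHS]ext_basis_h /filiform_wt /=; case: ifP => [/eqP ->|_].
    by rewrite comb_basis scale1r.
  by rewrite combZ comb_basis.
have cN (k : option 'I_n.+1) : comb ext_basis (filiform_ext_coef K k None) = 0.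
  by case: k => *; exact: comb0.
rewrite combB; case: o o' => [i|] [j|]; rewrite ?cN ?subr0 ?sub0r.
- have fE (i' k : 'I_n.+1) : (i' == ord0) && (k != ord0) ->
      scal (ad (ext_basis (Some i')) (ext_basis (Some k)) -
      comb ext_basis (filiform_ext_coef K (Some i') (Some k))) /\
      comb ext_basis (filiform_ext_coef K (Some k) (Some i')) = 0.
    case/andP => /eqP -> k0; rewrite /= ?eqxx (negPf k0) comb0; split=> //.
    have k_pos : (0 < k)%N by rewrite lt0n; apply: contraNneq k0 => k0; apply/eqP/val_inj.
    rewrite k_pos /=; case: ltnP => kn.
      by rewrite comb_basis /= inordK ?ltnS // chainS // subrr; exact: scal0.
    have -> : k = n :> nat by apply/eqP; rewrite eqn_leq kn -ltnS ltn_ord.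
    by rewrite comb0 subr0 (scal_ad _ chain_scal); exact: scal0.
  have [i0|i0] := eqVneq i ord0; have [j0|j0] := eqVneq j ord0.
  + by rewrite i0 j0 subrr subr0 adxx; exact: scal0.
  + by have [|s ->] := fE i j; [rewrite i0 eqxx j0 | rewrite subr0].
  + have [|s ->] := fE j i; first by rewrite j0 eqxx i0.
    by rewrite sub0r opprK ad_anti addrC -opprB; apply: scalN.
  + rewrite /= (negPf i0) (negPf j0) /= comb0 subrr subr0 chain_comm; first exact: scal0.
      by rewrite -(ltnS _ n) ltn_ord andbT lt0n; apply: contraNneq i0 => i0;
        apply/eqP/val_inj.
    by rewrite -(ltnS _ n) ltn_ord andbT lt0n; apply: contraNneq j0 => j0;
      apply/eqP/val_inj.
- by rewrite ad_anti hE opprK addNr; exact: scal0.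
- by rewrite hE subrr; exact: scal0.
- by rewrite adxx; exact: scal0.
Qed.

Lemma ext_comb (x : {ffun option 'I_n.+1 -> K^o}) (c : rat -> K) (y : nat -> K) :
    (forall j, (j < n)%N -> chain j = y j *: X (wt j)) ->
    (forall j : 'I_n.+1, (j < n)%N -> c (wt j) = x (Some j) * y j) ->
  comb ext_basis x = (- (ratr b)^-1 * x None) *: h
    + \sum_(r <- [seq wt j | j <- iota 0 n]) c r *: X r + x (Some ord_max) *: chain n.
Proof.
move=> yE cE; rewrite /comb sum_option big_ord_recr /= addrA scalerA mulrC.
rewrite big_map -{1}[n in iota 0 n]subn0 big_mkord; congr (_ + _ + _).
apply: eq_bigr => j _; have jn := ltn_ord j.
by rewrite yE // (cE (widen_ord (leqnSn n) j)) // scalerA.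
Qed.

(** The line of X_n consists exactly of the combinations that are scalar in the
Weyl algebra, so passing to the quotient by it gives an isomorphism. *)
Lemma filiform_ext_model : exists F, is_model (L := filiform_ext_mod K n) V F.
Proof.
have /choice[y yP] : forall j, exists y, (j < n)%N -> y != 0 /\ chain j = y *: X (wt j).
  move=> j; have [jn|nj] := ltnP j n; last by exists 0.
  by have [y y0 yE] := chain_weight jn; exists y.
have y0 j : (j < n)%N -> y j != 0 by move=> /yP[].
have yE j : (j < n)%N -> chain j = y j *: X (wt j) by move=> /yP[].
have S0 : [seq wt j | j <- iota 0 n] != [::].
  by rewrite -size_eq0 size_map size_iota; lia.
have idx j : (j < n)%N -> index (wt j) [seq wt j | j <- iota 0 n] = j.
  move=> jn; have <- : nth 0 [seq wt j | j <- iota 0 n] j = wt j.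
    by rewrite (nth_map 0%N) ?size_iota // nth_iota.
  by rewrite index_uniq ?size_map ?size_iota //; exact: (gr_uniq HG).
eexists; apply: (quotient_model (F := comb ext_basis : filiform_ext K n -> A)).
- by move=> x; apply: (ls_sum HV) => o; apply/(lsZ HV)/ext_basis_V.
- by move=> a x x'; exact: comb_linear.
- by move=> x x'; apply: comb_lie; exact: ext_basis_bracket.
- move=> x; split; last first.
    move=> /asboolP[a ->]; rewrite combZ comb_basis; apply: scalZ; exact: chain_scal.
  pose c r := let j := index r [seq wt j | j <- iota 0 n] in x (Some (inord j)) * y j.
  have cE (j : 'I_n.+1) : (j < n)%N -> c (wt j) = x (Some j) * y j.
    by move=> jn; rewrite /c idx // inord_val.
  rewrite (ext_comb yE cE) => /scalB/(_ (scalZ (x (Some ord_max)) chain_scal)).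
  rewrite addrK => /(gr_free HG S0)[/eqP xN c0]; apply/asboolP.
  exists (x (Some ord_max)); apply/ffunP => -[j|]; rewrite !ffunE; last first.
    by move: xN; rewrite mulf_eq0 oppr_eq0 invr_eq0 (negPf bK) /= scaler0 => /eqP.
  have [->|jn] := eqVneq j ord_max; first by rewrite eqxx /GRing.scale /= mulr1.
  have jn' : (j < n)%N by rewrite ltn_neqAle -ltnS ltn_ord andbT.
  have -> : (Some j == Some ord_max) = false by apply: contraNF jn => /eqP[->].
  rewrite scaler0; have /eqP := cE j jn'; rewrite c0 ?wt_in // eq_sym mulf_eq0.
  by rewrite (negPf (y0 _ jn')) orbF => /eqP.
- move=> v /(gr_span HG)[a [d [c ->]]].
  pose x : {ffun option 'I_n.+1 -> K^o} := [ffun o : option 'I_n.+1 => if o is Some j then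
     (if (j < n)%N then c (wt j) / y j else 0) else - (ratr b * a)].
  have cE (j : 'I_n.+1) : (j < n)%N -> c (wt j) = x (Some j) * y j.
    by move=> jn; rewrite ffunE jn divfK // y0.
  exists x; rewrite (ext_comb yE cE) !ffunE ltnn scale0r addr0 mulrNN mulKf //.
  rewrite [X in scal (X - _)]addrAC [X in scal (X - _)]addrC addrK; exact: scal_k.
Qed.
End Chain.
End FiliformExt.

(** * Triples: sl(2) and its semi-direct product *)

Section Sl2Triple.
Variables (K : numClosedFieldType) (e f H : weyl K).
Hypotheses (ef : ad e f = H) (He : ad H e = 2 *: e) (Hf : ad H f = -2 *: f).

Definition sl2_comb (a b c : K) : weyl K := a *: H + b *: e + c *: f.

Lemma sl2_comb_linear t a b c a' b' c' :
  sl2_comb (t * a + a') (t * b + b') (t * c + c')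
  = t *: sl2_comb a b c + sl2_comb a' b' c'.
Proof.
rewrite /sl2_comb !scalerDl !scalerDr !scalerA.
by rewrite [RHS](AC (3*3) ((1*4)*(2*5)*(3*6))).
Qed.

Lemma sl2_comb_ad a b c a' b' c' :
  ad (sl2_comb a b c) (sl2_comb a' b' c') =
  sl2_comb (b * c' - c * b') (2 * (a * b' - b * a')) (2 * (c * a' - a * c')).
Proof.
have fe : ad f e = - H by rewrite ad_anti ef.
have eH : ad e H = -2 *: e by rewrite ad_anti He scaleNr.
have fH : ad f H = 2 *: f by rewrite ad_anti Hf scaleNr opprK.
rewrite /sl2_comb !adDl !adDr !adZl !adZr ef He Hf fe eH fH !adxx !scaler0.
rewrite add0r addr0 !scalerN !scalerA -!scaleNr addr0.
rewrite [LHS](AC ((2*2)*2) ((4*6)*(1*3)*(2*5))) /= -!scalerDl.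
by congr (_ *: _ + _ *: _ + _ *: _); ring.
Qed.

Variables u v : weyl K.
Hypotheses (eu : ad e u = 0) (ev : ad e v = u) (fu : ad f u = v) (fv : ad f v = 0).
Hypotheses (Hu : ad H u = u) (Hv : ad H v = - v).

(** The action of sl(2) on its standard representation with basis u, v. *)
Lemma sl2_comb_act a b c x y :
  ad (sl2_comb a b c) (x *: u + y *: v) =
  (a * x + b * y) *: u + (c * x - a * y) *: v.
Proof.
rewrite /sl2_comb !adDl !adDr !adZl !adZr eu ev fu fv Hu Hv !scaler0.
rewrite !scalerN !scalerA -!scaleNr add0r addr0.
rewrite [LHS](AC (2*1*1) ((1*3)*(4*2))) /= -!scalerDl.
by congr (_ *: _ + _ *: _); ring.
Qed.
End Sl2Triple.

Lemma sum_ord2 (V : zmodType) (F : 'I_2 -> V) : \sum_i F i = F 0 + F 1.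
Proof. by rewrite big_ord_recl big_ord1; congr (F _ + F _); apply: val_inj. Qed.

Lemma ord2P (P : 'I_2 -> Prop) : P 0 -> P 1 -> forall i, P i.
Proof.
move=> P0 P1 [[|[|i]] lt] //; [have -> : Ordinal lt = 0 | have -> : Ordinal lt = 1] => //;
  exact: val_inj.
Qed.

Section Sl2Matrices.
Variable K : numClosedFieldType.

Lemma sl2_tr (M : sl K 2) : lsub_val M 1 1 = - lsub_val M 0 0.
Proof.
have /eqP := lsub_valP M; rewrite /mxtrace sum_ord2 addrC => /eqP.
by rewrite addr_eq0 => /eqP.
Qed.

Lemma sl2_bracket (M N : sl K 2) :
  let m := lsub_val M in let n := lsub_val N in
  [/\ lsub_val [Lie M, N] 0 0 = m 0 1 * n 1 0 - m 1 0 * n 0 1,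
      lsub_val [Lie M, N] 0 1 = 2 * (m 0 0 * n 0 1 - m 0 1 * n 0 0)
    & lsub_val [Lie M, N] 1 0 = 2 * (m 1 0 * n 0 0 - m 0 0 * n 1 0)].
Proof.
have -> : lsub_val [Lie M, N] = lsub_val M *m lsub_val N - lsub_val N *m lsub_val M by [].
by split; rewrite !mxE !sum_ord2 ?sl2_tr; ring.
Qed.

Lemma sl2_lin a (M N : sl K 2) i j :
  lsub_val (a *: M + N) i j = a * lsub_val M i j + lsub_val N i j.
Proof. by rewrite -[LHS]/((a *: lsub_val M + lsub_val N) i j) !mxE. Qed.

Lemma sl2_eq0 (M : sl K 2) :
  lsub_val M 0 0 = 0 -> lsub_val M 0 1 = 0 -> lsub_val M 1 0 = 0 -> M = 0.
Proof.
move=> m0 m1 m2; apply: val_inj; apply/matrixP.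
by apply: ord2P; apply: ord2P; rewrite ?sl2_tr ?m0 ?m1 ?m2 mxE ?oppr0.
Qed.

Definition sl2_mx (a b c : K) : 'M[K]_2 :=
  \matrix_(i, j) if i == 0 then (if j == 0 then a else b) else (if j == 0 then c else -
    a).

Lemma sl2_mx_traceless a b c : sl2_mx a b c \in @traceless K 2.
Proof. by rewrite /traceless /in_mem /= /mxtrace sum_ord2 !mxE /= subrr. Qed.

Definition sl2_of a b c : sl K 2 :=
  @LSub K _ (sl K 2) (sl2_mx a b c) (sl2_mx_traceless a b c).
End Sl2Matrices.

Lemma eq_opp_pos (x y : rat) : 0 < x -> 0 < y -> (x == - y) = false.
Proof. by move=> x0 y0; rewrite gt_eqF // (lt_trans _ x0) // oppr_lt0. Qed.

Lemma scal_mod0 (K : fieldType) (A : algType K) (u w w' t : A) :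
  w = w' -> scal t -> scal (u + w - (u + w' + t)).
Proof. by move=> -> st; rewrite opprD addrA subrr sub0r; exact: scalN. Qed.

Lemma ad_split (K : fieldType) (A : algType K) (x w y z : A) :
  ad (x + w) (y + z) = ad x y + (ad x z - ad y w) + ad w z.
Proof. by rewrite adDl !adDr -(ad_anti w y) !addrA. Qed.

Lemma scal_ad_plane (K : fieldType) (A : algType K) (u v : A) a b c d :
  scal (ad u v) -> scal (ad (a *: u + b *: v) (c *: u + d *: v)).
Proof.
move=> uv; rewrite !adDl !adDr !adZl !adZr !adxx !scaler0 add0r addr0 (ad_anti v).
by apply: scalD; do ![apply: scalZ|apply: scalN|exact: uv].
Qed.

Lemma scal_mod (K : fieldType) (A : algType K) (u w s t : A) :
  scal s -> scal t -> scal (u + s + w - (u + w + t)).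
Proof.
move=> ss st; rewrite [u + s + w]addrAC opprD addrACA subrr add0r.
exact: scalB.
Qed.

Section Sl2Case.
Variables (K : numClosedFieldType) (V : weyl K -> Prop).
Hypothesis HV : lie_space V.
Local Notation A := (weyl K).

(** Another positive weight vector X nu commutes with X mu. Lowering it by mu gives
a nonzero z which X mu raises back, and z has negative weight since positive
weight vectors commute. So z commutes with X (- mu), and the Jacobi identity for
X mu, X (- mu) and z forces 2 nu = mu. *)
Lemma sl2_pos_weights h S X mu (al be : K) :
  graded V h S X -> 0 < mu -> mu \in S -> - mu \in S ->
  ad (X mu) (X (- mu)) = al *: h + be%:A -> al != 0 ->
  forall nu, nu \in S -> 0 < nu -> nu = mu \/ nu = mu / 2.
Proof.
move=> HG mu0 muS muNS EF al0 nu nuS nu0.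
have [->|ne] := eqVneq nu mu; [by left | right].
have X0 : X nu != 0 by rewrite (gr_XN0 HG).
have Cad z r : ad h z = ratr r *: z ->
    ad (ad (X mu) (X (- mu))) z = (al * ratr r) *: z.
  by move=> hz; rewrite EF adDl ad_scalarl addr0 adZl hz scalerA.
set z := ad (X (- mu)) (X nu).
have hz : ad h z = ratr (nu - mu) *: z.
  by have [_] := gr_eigen_ad HV HG (- mu) nu; rewrite addrC.
have z0 : z != 0.
  rewrite /z ad_anti oppr_eq0; apply: (gr_opp_ad HG) => //.
  by rewrite oppr_lt0.
have Ez : ad (X mu) z = (al * ratr nu) *: X nu.
  rewrite /z ad_jacobi (Cad _ nu) ?(gr_adX HG) // (gr_pos_comm HV HG) //.
  by rewrite ad0r addr0.
have nm0 : - mu + nu != 0 by rewrite addrC subr_eq0.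
have [c zc] := gr_ad HV HG nm0; rewrite -/z in zc.
have nu_lt : nu < mu.
  rewrite ltNge; apply/negP; rewrite le_eqVlt eq_sym (negPf ne) /= => lt.
  have /eqP := Ez; rewrite zc adZr (gr_pos_comm HV HG) //; last by rewrite addrC subr_gt0.
  rewrite scaler0 eq_sym scaler_eq0 (negPf X0) orbF mulf_eq0 (negPf al0).
  by rewrite fmorph_eq0 gt_eqF.
have Fz : ad (X (- mu)) z = 0.
  rewrite zc adZr (gr_neg_comm HV HG) ?scaler0 ?oppr_lt0 //.
  by rewrite addrC subr_lt0.
have := ad_jacobi (X mu) (X (- mu)) z; rewrite Fz ad0r (Cad _ _ hz) Ez adZr -/z.
rewrite -scalerDl -mulrDr -rmorphD => /esym/eqP.
rewrite scaler_eq0 (negPf z0) orbF mulf_eq0 (negPf al0) fmorph_eq0 => /eqP E.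
by lra.
Qed.


Section Triple.
Variables (h : A) (S : seq rat) (X : rat -> A) (mu : rat) (al be : K).
Hypotheses (HG : graded V h S X) (mu0 : 0 < mu) (muS : mu \in S) (muNS : - mu \in S).
Hypotheses (EF : ad (X mu) (X (- mu)) = al *: h + be%:A) (al0 : al != 0).

Let k := 2 / (al * ratr mu).
Let e := X mu.
Let f := k *: X (- mu).
Let H := k *: (al *: h + be%:A).

Let m0 : ratr mu != 0 :> K. Proof. by rewrite fmorph_eq0 gt_eqF. Qed.
Let k0 : k != 0. Proof. by rewrite /k mulf_neq0 ?pnatr_eq0 // invr_eq0 mulf_neq0. Qed.
Let kal0 : k * al != 0. Proof. by apply: mulf_neq0. Qed.
Let ef : ad e f = H. Proof. by rewrite adZr EF. Qed.
Let HX r : ad H (X r) = (2 * ratr (r / mu)) *: X r.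
Proof.
rewrite /H adZl adDl ad_scalarl addr0 adZl (gr_adX HG) !scalerA; congr (_ *: _).
by rewrite /k rmorphM fmorphV; field; apply/andP.
Qed.
Let He : ad H e = 2 *: e.
Proof. by rewrite HX divff ?gt_eqF // rmorph1 mulr1. Qed.
Let Hf : ad H f = - 2 *: f.
Proof.
rewrite adZr HX mulNr divff ?gt_eqF // rmorphN rmorph1 mulrN1 !scalerA.
by rewrite mulrC.
Qed.

Lemma sl2_combE a b c : sl2_comb e f H a b c =
  (a * k * al) *: h + (b *: X mu + (c * k) *: X (- mu)) + (a * k * be)%:A.
Proof.
rewrite /sl2_comb /H /f !scalerA scalerDr !scalerA -!addrA; congr (_ + _).
by rewrite addrC -addrA.
Qed.

Lemma sl2_weights r : r \in S -> [\/ r = mu, r = - mu, r = mu / 2 | r = - (mu / 2)].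
Proof.
move=> rS; have : r != 0 by exact: (gr_neq0 HG).
rewrite neq_lt => /orP[r0|r0]; last first.
  by have [->|->] := sl2_pos_weights HG mu0 muS muNS EF al0 rS r0; [constructor
    1|constructor 3].
have EF' : ad (X (- mu)) (X (- - mu)) = al *: - h + (- be)%:A.
  by rewrite opprK ad_anti EF opprD scalerN scaleNr.
have memN s : (- s \in map -%R S) = (s \in S) by rewrite (mem_map oppr_inj).
have [||||E|E] := sl2_pos_weights (graded_opp HV HG) mu0 _ _ EF' al0 (nu := - r).
- by rewrite -[mu]opprK memN.
- by rewrite memN.
- by rewrite memN.
- by rewrite oppr_gt0.
- by constructor 2; rewrite -E opprK.
- by constructor 4; rewrite -E opprK.
Qed.

Lemma sl2_case_simple : mu / 2 \notin S -> - (mu / 2) \notin S ->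
  exists F, is_model (L := sl K 2) V F.
Proof.
move=> n1 n2.
have eS : perm_eq S [:: mu; - mu].
  apply: uniq_perm; first exact: (gr_uniq HG).
    by rewrite /= andbT inE eq_opp_pos.
  move=> r; rewrite !inE; apply/idP/orP => [rS|[/eqP ->|/eqP ->]] //.
  have [E|E|E|E] := sl2_weights rS; rewrite E in rS *; first by left.
  + by right.
  + by rewrite rS in n1.
  + by rewrite rS in n2.
have HG' := graded_perm eS HG.
have sumE (c : rat -> K) : \sum_(r <- [:: mu; - mu]) c r *: X r
    = c mu *: X mu + c (- mu) *: X (- mu) by rewrite big_cons big_seq1.
exists (fun M : sl K 2 => sl2_comb e f H (lsub_val M 0 0) (lsub_val M 0 1) (lsub_val M
  1 0)).
have VX := gr_VX HG; have Vh := gr_h HG.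
split.
- move=> M; rewrite sl2_combE; apply: (lsD HV); last by apply/(lsZ HV)/(ls1 HV).
  by do 2?[apply: (lsD HV)]; apply: (lsZ HV).
- by move=> a M N; rewrite !sl2_lin sl2_comb_linear subrr; exact: scal0.
- move=> M N; rewrite (sl2_comb_ad ef He Hf).
  by have [-> -> ->] := sl2_bracket M N; rewrite subrr; exact: scal0.
- move=> M; rewrite sl2_combE => /scalB/(_ (scal_k _ (lsub_val M 0 0 * k * be))).
  pose c r := if r == mu then lsub_val M 0 1 else lsub_val M 1 0 * k.
  have cN : c (- mu) = lsub_val M 1 0 * k.
    by rewrite /c eq_sym eq_opp_pos.
  have c1 : c mu = lsub_val M 0 1 by rewrite /c eqxx.
  rewrite addrK -cN -c1 -sumE => /(gr_free HG')[//|/eqP a0 c0].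
  apply: sl2_eq0.
  + by move: a0; rewrite mulf_eq0 (negPf al0) orbF mulf_eq0 (negPf k0) orbF => /eqP.
  + by rewrite -c1 c0 // mem_head.
  + have /eqP : c (- mu) = 0 by apply: c0; rewrite !inE eqxx orbT.
    by rewrite cN mulf_eq0 (negPf k0) orbF => /eqP.
- move=> v /(gr_span HG')[a [b [c ->]]].
  exists (sl2_of (a / (k * al)) (c mu) (c (- mu) / k)).
  rewrite sl2_combE /= !mxE /= sumE divfK // -mulrA divfK ?kal0 //.
  by apply: scal_mod; exact: scal_k.
Qed.

(** With nu = mu / 2, u of weight nu and v = [f, u] span a copy of the standard
representation. Their bracket has weight 0 and is killed by e, so it is scalar:
in the quotient by scalars this plane is an abelian ideal. *)
Lemma sl2_case_std : mu / 2 \in S -> exists F, is_model (L := sl_std K 2) V F.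
Proof.
set nu := mu / 2 => nuS.
have nu0 : 0 < nu by rewrite divr_gt0.
have NmuE : - mu + nu = - nu by rewrite /nu; field.
have ne0 : - mu + nu != 0 by rewrite NmuE oppr_eq0 gt_eqF.
have [y0 y0E] := gr_ad HV HG ne0; rewrite NmuE in y0E.
have fu_N0 : ad (X (- mu)) (X nu) != 0.
  by rewrite ad_anti oppr_eq0 (gr_opp_ad HG) ?oppr_lt0.
have nuNS : - nu \in S.
  by rewrite -(gr_XN0 HG); apply: contraNneq fu_N0 => E; rewrite y0E E scaler0.
pose u := X nu; pose y := k * y0; pose v := y *: X (- nu).
have yN0 : y != 0.
  rewrite mulf_neq0 //; apply: contraNneq fu_N0 => E.
  by rewrite y0E E scale0r.
have fu : ad f u = v by rewrite adZl y0E scalerA.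
have fv : ad f v = 0 by rewrite adZl adZr (gr_neg_comm HV HG) ?oppr_lt0 ?scaler0.
have eu : ad e u = 0 by rewrite (gr_pos_comm HV HG).
have mun0 : mu != 0 by rewrite gt_eqF.
have half : ratr (nu / mu) = 2^-1 :> K.
  have -> : nu / mu = 2^-1 by rewrite /nu; field.
  by rewrite fmorphV rmorph_nat.
have Hu : ad H u = u by rewrite HX half divff ?scale1r // pnatr_eq0.
have Hv : ad H v = - v.
  rewrite adZr HX mulNr rmorphN /= mulrN half divff ?pnatr_eq0 //.
  by rewrite scaleN1r scalerN.
have ev : ad e v = u by rewrite -fu ad_jacobi ef Hu eu ad0r addr0.
have uv : scal (ad u v).
  have [ga [de E]] := gr_ad0 HV HG nu.
  have : ad e (ad u v) = 0 by rewrite ad_jacobi eu ad0l add0r ev adxx.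
  rewrite /v adZr E adZr adDr ad_scalar addr0 adZr ad_anti (gr_adX HG).
  have /negPf Xmu0 : X mu != 0 by rewrite (gr_XN0 HG).
  move/eqP; rewrite scaler_eq0 (negPf yN0) scalerN oppr_eq0 scalerA scaler_eq0.
  rewrite Xmu0 orbF mulf_eq0 (negPf m0) orbF => /eqP ga0.
  by rewrite ga0 scale0r add0r; exact/scalZ/scal_k.
have e1 (a b : rat) : 0 < a -> 0 < b -> (a == - b) = false := @eq_opp_pos a b.
have e2 : (mu == nu) = false.
  have E : mu = nu + nu by rewrite /nu; field.
  by apply: gt_eqF; rewrite E ltrDl.
have eS : perm_eq S [:: mu; - mu; nu; - nu].
  apply: uniq_perm; first exact: (gr_uniq HG).
    by rewrite /= !inE !eqr_opp [- mu == nu]eq_sym !e1 // e2.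
  move=> r; rewrite !inE; apply/idP/or4P => [rS|[]/eqP -> //].
  by have [E|E|E|E] := sl2_weights rS; rewrite E; [constructor 1|constructor
    2|constructor 3|constructor 4].
have HG' := graded_perm eS HG.
have sumE (c : rat -> K) : \sum_(r <- [:: mu; - mu; nu; - nu]) c r *: X r
    = (c mu *: X mu + c (- mu) *: X (- mu)) + (c nu *: X nu + c (- nu) *: X (- nu)).
  by rewrite !big_cons big_nil addr0 -addrA.
pose F (s : sl_std K 2) := sl2_comb e f H (lsub_val s.1 0 0) (lsub_val s.1 0 1)
  (lsub_val s.1 1 0) + (s.2 0 0 *: u + s.2 1 0 *: v).
have VX := gr_VX HG; have Vh := gr_h HG.
exists F; split.
- move=> M; rewrite /F sl2_combE /u /v; do ![apply: (lsD HV)|apply: (lsZ HV)] => //.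
  exact: (ls1 HV).
- move=> a M N; suff -> : F (a *: M + N) = a *: F M + F N by rewrite subrr; exact: scal0.
  rewrite /F [(a *: M + N).1]/(a *: M.1 + N.1) [(a *: M + N).2]/(a *: M.2 + N.2).
  rewrite !sl2_lin sl2_comb_linear [X in _ = X + _]scalerDr [RHS]addrACA; congr (_ + _).
  by rewrite !mxE !scalerDl !scalerDr !scalerA addrACA.
- move=> M N; pose w i (P : sl_std K 2) := P.2 i 0.
  have act (P Q : sl_std K 2) i : (lsub_val P.1 *m Q.2) i 0
      = lsub_val P.1 i 0 * w 0 Q + lsub_val P.1 i 1 * w 1 Q by rewrite mxE sum_ord2.
  have E i : [Lie M, N].2 i 0 = (lsub_val M.1 *m N.2) i 0 - (lsub_val N.1 *m M.2) i 0.
    by rewrite -[LHS]/((lsub_val M.1 *m N.2 - lsub_val N.1 *m M.2) i 0) !mxE.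
  have W a b c d : scal (ad (a *: u + b *: v) (c *: u + d *: v)).
    exact: scal_ad_plane.
  rewrite /F ad_split (sl2_comb_ad ef He Hf).
  rewrite !(sl2_comb_act eu ev fu fv Hu Hv) !E !act !sl2_tr.
  have [-> -> ->] := sl2_bracket M.1 N.1; apply: scal_mod0; last exact: W.
  rewrite [X in _ = _ + X]opprD [RHS]addrACA -!scalerBl.
  by congr (_ *: _ + _ *: _); rewrite /w; ring.
- case=> M w; rewrite /F /= sl2_combE => sF.
  pose c r := if r == mu then lsub_val M 0 1 else if r == - mu then lsub_val M 1 0 * k
    else if r == nu then w 0 0 else w 1 0 * y.
  have [c1 c2 c3 c4] : [/\ c mu = lsub_val M 0 1, c (- mu) = lsub_val M 1 0 * k,
      c nu = w 0 0 & c (- nu) = w 1 0 * y].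
    by rewrite /c !eqxx !eqr_opp ![- _ == _]eq_sym !e1 // ![nu == mu]eq_sym e2.
  have : scal ((lsub_val M 0 0 * k * al) *: h + \sum_(r <- [:: mu; - mu; nu; - nu]) c r
    *: X r).
    rewrite sumE c1 c2 c3 c4 -[(w 1 0 * y) *: _]scalerA -/v -/u addrA.
    have := scalB sF (scal_k _ (lsub_val M 0 0 * k * be)).
    by rewrite [X in scal (X - _)]addrAC addrK.
  move=> /(gr_free HG')[//|/eqP a0 c0].
  have {}c0 r : r \in [:: mu; - mu; nu; - nu] -> c r = 0 by apply: c0.
  have [d1 d2 d3 d4] : [/\ c mu = 0, c (- mu) = 0, c nu = 0 & c (- nu) = 0].
    by split; apply: c0; rewrite !inE eqxx ?orbT.
  have M0 : M = 0.
    apply: sl2_eq0; last 1 first.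
    + by move/eqP: d2; rewrite c2 mulf_eq0 (negPf k0) orbF => /eqP.
    + by move: a0; rewrite mulf_eq0 (negPf al0) orbF mulf_eq0 (negPf k0) orbF => /eqP.
    + by rewrite -c1.
  have w0 : w = 0.
    apply/matrixP => i j; rewrite [j]ord1 mxE; elim/ord2P: i; first by rewrite -c3.
    by move/eqP: d4; rewrite c4 mulf_eq0 (negPf yN0) orbF => /eqP.
  by rewrite M0 w0.
- move=> z /(gr_span HG')[a [b [c ->]]].
  exists (sl2_of (a / (k * al)) (c mu) (c (- mu) / k),
    \col_i (if i == 0 then c nu else c (- nu) / y)).
  rewrite /F sl2_combE /= !mxE /= sumE divfK // -mulrA divfK ?kal0 //.
  rewrite /v /u scalerA divfK // [X in scal (_ - X)]addrAC -[X in scal (_ - (X +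
    _))]addrA.
  by apply: scal_mod; exact: scal_k.
Qed.
End Triple.
End Sl2Case.

(** * Classification of the weight decompositions *)

Section Ladder.
Variables (K : numClosedFieldType) (V : weyl K -> Prop).
Hypothesis HV : lie_space V.
Local Notation A := (weyl K).

Lemma gr_opp_add h S X : graded V h S X -> forall r s : rat,
  r \in S -> s \in S -> 0 < r -> s < 0 -> r + s != 0 ->
  r + s \in S /\ exists2 c, c != 0 & ad (X r) (X s) = c *: X (r + s).
Proof.
move=> HG r s rS sS r0 s0 rs0; have ad0 := gr_opp_ad HG rS sS r0 s0.
have [c E] := gr_ad HV HG rs0; rewrite E scaler_eq0 negb_or in ad0 *.
have /andP[c0 X0] := ad0.
by split; [rewrite -(gr_XN0 HG) | exists c].
Qed.

Section OneLadder.
Variables (h : A) (S : seq rat) (X : rat -> A) (a b : rat).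
Hypothesis HG : graded V h S X.
Hypotheses (aS : a \in S) (aM : forall r : rat, r \in S -> r <= a).
Hypotheses (bS : - b \in S) (bM : forall r : rat, r \in S -> - b <= r).
Hypotheses (b0 : 0 < b) (ba : b <= a).
Hypothesis no_sl2 : forall r : rat, 0 < r -> scal (ad (X r) (X (- r))).

Let a0 : 0 < a. Proof. exact: lt_le_trans ba. Qed.
Let bN0 : - b < 0. Proof. by rewrite oppr_lt0. Qed.

(** Lowering a positive weight by b never skips 0: a weight in ]-b, 0[ reached in
this way would commute with the top weight vector. *)
Lemma ladder_lower (mu : rat) : mu \in S -> 0 < mu -> b <= mu.
Proof.
move=> muS mu0; rewrite leNgt; apply/negP => lt.
have lt0 : mu - b < 0 by rewrite subr_lt0.
have [sS [c c0 E]] := gr_opp_add HG muS bS mu0 bN0 (ltr0_neq0 lt0).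
have /eqP := gr_opp_ad HG aS sS a0 lt0; apply.
apply: (scalerI c0); rewrite scaler0 -adZr -E ad_jacobi (gr_pos_comm HV HG a0 mu0).
rewrite ad0l add0r; have [ab|ab] := eqVneq a b.
  by rewrite {1}ab (scal_ad _ (no_sl2 b0)).
have ab0 : a - b != 0 by rewrite subr_eq0.
have [d ->] := gr_ad HV HG ab0; rewrite adZr (gr_pos_comm HV HG mu0) ?scaler0 //.
by rewrite subr_gt0 lt_neqAle eq_sym ab.
Qed.

Lemma ladder_pos (mu : rat) : mu \in S -> 0 < mu ->
  exists k : nat, mu = k.+1%:R * b /\ forall j, (j <= k)%N -> j.+1%:R * b \in S.
Proof.
move=> muS mu0; have [N] : exists N : nat, mu <= N%:R * b.
  exists (Num.bound (mu / b)); rewrite -ler_pdivrMr // ltW // archi_boundP //.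
  by rewrite divr_ge0 // ltW.
elim: N mu muS mu0 => [|N IH] mu muS mu0 le; first by move: mu0; rewrite ltNge -(mul0r
  b) le.
have := ladder_lower muS mu0; rewrite le_eqVlt => /orP[/eqP bmu|lt].
  by exists 0%N; rewrite mul1r; split=> // -[|j] // _; rewrite mul1r bmu.
have mub : 0 < mu - b by rewrite subr_gt0.
have [sS _] := gr_opp_add HG muS bS mu0 bN0 (lt0r_neq0 mub).
have [|k [E kS]] := IH (mu - b) sS mub; first by rewrite lerBlDr -{2}[b]mul1r -mulrDl
  natr1.
exists k.+1; have muE : mu = k.+2%:R * b.
  by rewrite -[mu](subrK b) E -[k.+2]addn1 natrD; ring.
split=> // j; rewrite leq_eqVlt => /orP[/eqP ->|]; first by rewrite -muE.
exact: kS.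
Qed.

(** Lowering the largest weight by b repeatedly ends at 0 exactly, by
ladder_lower, so the positive weights are b, 2b, ..., a. A negative weight r other
than - b would lie in ]- b, 0[, and a + r would be a positive weight that is not
a multiple of b. *)
Lemma ladder_weights : exists n, (2 <= n)%N /\
  perm_eq S [seq filiform_weight b n j | j <- iota 0 n].
Proof.
have [k [ak kS]] := ladder_pos aS a0; exists k.+2; split=> //.
apply: uniq_perm; first exact: (gr_uniq HG).
  rewrite map_inj_in_uniq ?iota_uniq //.
  by apply: filiform_weight_inj; rewrite gt_eqF.
move=> r; apply/idP/mapP => [rS|[j]].
  have : r != 0 by exact: (gr_neq0 HG).
  rewrite neq_lt => /orP[r0|r0].
    exists 0%N => //; rewrite /filiform_weight /=.
    apply/eqP; have := bM rS; rewrite le_eqVlt => /orP[/eqP <- //|lt].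
    have ar0 : 0 < a + r by rewrite -[0](subrr b) ler_ltD.
    have [arS _] := gr_opp_add HG aS rS a0 r0 (lt0r_neq0 ar0).
    have [j [arj _]] := ladder_pos arS ar0.
    have rE : r = (j%:R - k%:R) * b.
      by rewrite -[r](addKr a) arj ak -[j.+1]addn1 -[k.+1]addn1 !natrD; ring.
    have := lt; rewrite rE -{1}[b]mul1r -mulNr ltr_pM2r // => lt1.
    move: r0; rewrite rE pmulr_llt0 // => lt2; exfalso.
    have : (j < k)%N by rewrite -(ltr_nat rat) -subr_lt0.
    by move: lt1; rewrite ltrBrDr addrC ltrBlDr natr1 ltr_nat; lia.
  have [j [E _]] := ladder_pos rS r0.
  have jk : (j <= k)%N.
    by have := aM rS; rewrite E ak ler_pM2r // ler_nat.
  exists (k.+1 - j)%N; first by rewrite mem_iota; lia.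
  rewrite /filiform_weight; have -> : (k.+1 - j == 0)%N = false by lia.
  by have -> : (k.+2 - (k.+1 - j))%N = j.+1 by lia.
rewrite mem_iota /= add0n => jk ->; rewrite /filiform_weight; case: eqP => // j0.
have -> : (k.+2 - j)%N = (k.+1 - j).+1 by lia.
by apply: kS; lia.
Qed.

Lemma ladder_case : exists n, (2 <= n)%N /\
  exists F, is_model (L := filiform_ext_mod K n) V F.
Proof.
have [n [n2 Sn]] := ladder_weights; exists n; split=> //.
apply: (filiform_ext_model HV (graded_perm Sn HG)) => //.
by rewrite ad_anti; apply/scalN/no_sl2.
Qed.
End OneLadder.

(** Weights of one sign give a diagonal algebra. With both signs present, either
some opposite weight vectors have a bracket that involves h, which gives sl(2),
possibly with its standard representation, or all such brackets are scalar and the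
weights form a ladder, on the side of the larger extremal weight. *)
Lemma graded_classification h S X : graded V h S X -> S != [::] ->
  (exists F, is_model (L := sl K 2) V F) \/
  (exists F, is_model (L := sl_std K 2) V F) \/
  (exists n, (2 <= n)%N /\ exists F, is_model (L := filiform_ext_mod K n) V F) \/
  (exists n (i : 'I_n -> int), [/\ (1 <= n)%N, (forall k, 0 < i k),
    (forall j k : 'I_n, (j < k)%N -> i j < i k) & exists F, is_model (L := diag_lie K
      i) V F]).
Proof.
move=> HG S0.
have [pos|/existsNP[m /not_implyP[mS mN]]] := pselect (forall r : rat, r \in S -> 0 < r).
  by do 3!right; exact: (diag_case HV HG).
have m0 : m < 0 by rewrite lt_neqAle (gr_neq0 HG) //= leNgt; apply/negP.
have HN := graded_opp HV HG.
have memN (s : rat) : (- s \in map -%R S) = (s \in S) by rewrite (mem_map oppr_inj).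
have [neg|/existsNP[p /not_implyP[pS pN]]] := pselect (forall r : rat, r \in S -> r < 0).
  do 3!right; apply: (diag_case HV HN); first by case: (S) S0.
  by move=> r; rewrite -[r]opprK memN oppr_gt0; exact: neg.
have p0 : 0 < p by rewrite lt_neqAle eq_sym (gr_neq0 HG) //= leNgt; apply/negP.
have [no|/existsNP[mu /not_implyP[mu0 nsc]]] :=
    pselect (forall r : rat, 0 < r -> scal (ad (X r) (X (- r)))); last first.
  have [al [be E]] := gr_ad0 HV HG mu.
  have al0 : al != 0.
    by apply/eqP => al0; apply: nsc; rewrite E al0 scale0r add0r; exact: scal_k.
  have muS : mu \in S.
    by rewrite -(gr_XN0 HG); apply/eqP => Z; apply: nsc; rewrite Z ad0l; exact: scal0.
  have muNS : - mu \in S.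
    by rewrite -(gr_XN0 HG); apply/eqP => Z; apply: nsc; rewrite Z ad0r; exact: scal0.
  have [nuS|nuS] := boolP (mu / 2 \in S).
    by right; left; exact: (sl2_case_std HV HG mu0 muS muNS E al0).
  left; apply: (sl2_case_simple HV HG mu0 muS muNS E al0) => //.
  apply/negP => nuNS; case/negP: nuS.
  have nu0 : - (mu / 2) < 0 by rewrite oppr_lt0 divr_gt0.
  have nuE : mu - mu / 2 = mu / 2 by field.
  have [|+ _] := gr_opp_add HG muS nuNS mu0 nu0; last by rewrite nuE.
  by rewrite nuE gt_eqF // divr_gt0.
have [a aS aM] := seq_rat_max S0.
have [b'] := @seq_rat_max (map -%R S) ltac:(by case: (S) S0).
move=> bN bNM; have bS : - b' \in S by rewrite -memN opprK.
have bM (r : rat) : r \in S -> - b' <= r by rewrite lerNl -memN; exact: bNM.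
have a0 : 0 < a := lt_le_trans p0 (aM p pS).
have b0 : 0 < b' by rewrite -oppr_lt0 (le_lt_trans (bM m mS)).
do 2!right; left; have [ba|/ltW ab] := leP b' a.
  exact: (ladder_case HG aS aM bS bM b0 ba no).
apply: (ladder_case HN bN bNM _ _ a0 ab).
- by rewrite memN.
- by move=> r; rewrite -[r]opprK memN lerN2; exact: aM.
- by move=> r r0; rewrite opprK ad_anti; exact/scalN/no.
Qed.
End Ladder.

(** * The nilpotent case: the filiform algebras *)

Lemma last_outside (T : Type) (C : T -> Prop) (f : T -> T) v N :
  ~ C v -> C (iter N f v) -> exists j, ~ C (iter j f v) /\ C (iter j.+1 f v).
Proof.
elim: N => [|N IH] nv //; have [CN|nN] := pselect (C (iter N f v)).
  by move=> _; exact: IH.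
by exists N.
Qed.

Section Nilpotent.
Variables (K : numClosedFieldType) (V : weyl K -> Prop).
Hypothesis HV : lie_space V.
Local Notation A := (weyl K).
Implicit Types (t u v w x y z : A).
Hypothesis no_eigen : forall t mu z, V t -> eigen V t mu z -> z != 0 -> mu = 0.

(** Nonzero factors ad t - a are injective on V, so they can be cancelled in an
annihilating product. *)
Lemma nilpotent_iter t : V t -> exists N, forall v, V v -> iter N (ad t) v = 0.
Proof.
move=> Vt; have [s sP] := lsfin HV Vt; exists (size s) => v Vv.
have shiftsV s' w : V w -> V (shifts t s' w).
  move=> Vw; elim: s' => //= a s' IH; apply: (lsB HV); last exact: (lsZ HV).
  exact: (lsad HV).
have it0 n : iter n (ad t) 0 = 0 by elim: n => //= n ->; rewrite ad0r.
elim: s v Vv {sP}(sP v Vv) => //= a s IH v Vv E.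
have [a0|a0] := eqVneq a 0.
  rewrite a0 scale0r subr0 -shifts_ad in E; rewrite -iterS iterSr.
  by apply: IH => //; exact: (lsad HV).
rewrite IH ?ad0r //; apply/eqP; apply: contraNT a0 => w0; apply/eqP.
apply: (no_eigen Vt _ w0); split; first exact: shiftsV.
by apply/eqP; rewrite -subr_eq0 E.
Qed.

Lemma iter_V t v n : V t -> V v -> V (iter n (ad t) v).
Proof. by move=> Vt Vv; elim: n => //= n IH; exact: (lsad HV). Qed.

Definition in_span1 y v := exists a b, v = a *: y + b%:A.

Definition heisenberg x y c := [/\ V x, V y, c != 0 & ad x y = c%:A].

Lemma heisenberg_nonscal x y c : heisenberg x y c -> ~ scal y.
Proof.
move=> [_ _ c0 xy] /(scal_ad x)/eqP; rewrite xy scaler_eq0 (negPf c0).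
by rewrite oner_eq0.
Qed.

(** Otherwise x and y would commute, as members of its centralizer. *)
Lemma heisenberg_commutant x y c w : heisenberg x y c ->
  ad x w = 0 -> ad y w = 0 -> scal w.
Proof.
move=> [_ _ c0 xy] xw yw; apply: contrapT => nw.
have /eqP := centralizer_comm nw (ad_sym xw) (ad_sym yw).
by rewrite xy scaler_eq0 (negPf c0) oner_eq0.
Qed.

Lemma heisenberg_span x y c w d : heisenberg x y c ->
  ad y w = 0 -> ad x w = d%:A -> in_span1 y w.
Proof.
move=> hxy yw xw; have [_ _ c0 xy] := hxy.
have [||k E] := heisenberg_commutant (w := w - (d / c) *: y) hxy.
- by rewrite adBr adZr xw xy scalerA divfK // subrr.
- by rewrite adBr adZr adxx yw scaler0 subrr.
by exists (d / c), k; rewrite -E addrC subrK.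
Qed.

Lemma heisenberg_stable x y c w : heisenberg x y c ->
  ad y w = 0 -> forall n, ad y (iter n (ad x) w) = 0.
Proof.
move=> [_ _ c0 xy] yw; elim=> //= n IH.
by rewrite ad_jacobi IH ad0r addr0 (ad_anti y) xy adNl ad_scalarl oppr0.
Qed.

Lemma no_eigen_neg t z a : V t -> V z -> ad t z = a *: z -> a != 0 -> z = 0.
Proof.
move=> Vt Vz E a0; apply/eqP; apply: contraNT a0 => z0.
by apply/eqP; apply: (no_eigen Vt _ z0).
Qed.

(** Otherwise the string under ad x of w = [y, z] contains a vector a y + b with a
nonzero, and the corresponding vector z' of the string of z has y + b / a as an
eigenvector with eigenvalue - a. *)
Lemma heisenberg_second_kernel x y c z : heisenberg x y c -> V z ->
  ad y (ad y z) = 0 -> scal (ad y z).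
Proof.
move=> hxy Vz yyz; have [Vx Vy c0 xy] := hxy; set w := ad y z in yyz *.
apply: contrapT => nw; have [N NP] := nilpotent_iter Vx.
have Vw : V w by exact: (lsad HV).
have [|j [nj [d Ed]]] := @last_outside _ (@scal K A) (ad x) w N nw.
  by rewrite NP //; exact: scal0.
set w' := iter j (ad x) w in nj Ed.
have yw' : ad y w' = 0 by apply: (heisenberg_stable hxy).
have [a [b E]] := heisenberg_span hxy yw' Ed.
have a0 : a != 0.
  by apply/eqP => a0; apply: nj; rewrite E a0 scale0r add0r; exact: scal_k.
pose z' := iter j (ad x) z; have Vz' : V z' by exact: iter_V.
have yz' : ad y z' = w'.
  rewrite /z' /w'; elim: (j) => //= i IH.
  by rewrite ad_jacobi IH (ad_anti y) xy adNl ad_scalarl oppr0 add0r.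
have : y + (b / a)%:A = 0.
  apply: (no_eigen_neg (t := z') (a := - a)); rewrite ?oppr_eq0 //.
    by apply: (lsD HV) => //; apply/(ls_scal HV)/scal_k.
  rewrite adDr ad_scalar addr0 ad_anti yz' E scaleNr scalerDr scalerA mulrC.
  by rewrite divfK.
move=> /eqP; rewrite addr_eq0 => /eqP Ey; apply: (heisenberg_nonscal hxy).
by rewrite Ey; apply/scalN/scal_k.
Qed.

Definition codim_one x y := forall z, V z -> exists b, ad y (z - b *: x) = 0.

Definition large_centralizer y :=
  exists v, [/\ V v, ad y v = 0 & ~ in_span1 y v].

(** If x and the centralizer of y do not span V, then x can be changed to a vector
x' = [y, z], and [x', z] commutes with y. A vector w commuting with y such that
[x', w] is a nonzero multiple of y up to scalars would make x' an eigenvector of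
ad [w, z]: so the centralizer of y is spanned by y and 1. Then [x', z] = a y + b,
and a = 0, since otherwise x' and y span modulo scalars a plane on which ad z has
the square roots of a as eigenvalues. Hence a combination of z and y commutes with x'. *)
Lemma heisenberg_dichotomy x y c : heisenberg x y c ->
  codim_one x y \/
  (~ large_centralizer y /\ exists x', [/\ V x', ~ scal x' & large_centralizer x']).
Proof.
move=> hxy; have [Vx Vy c0 xy] := hxy; have [N NP] := nilpotent_iter Vy.
have [all0|/existsNP[z0 /not_implyP[Vz0 nz0]]] :=
    pselect (forall z, V z -> ad y (ad y z) = 0).
  left=> z Vz; have [d Ed] := heisenberg_second_kernel hxy Vz (all0 z Vz).
  exists (- (d / c)); rewrite scaleNr opprK adDr adZr Ed (ad_anti y) xy scalerN.
  by rewrite scalerA divfK // subrr.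
right; have [|j []] := @last_outside _ (fun z => ad y (ad y z) = 0) (ad y) z0 N nz0.
  by rewrite NP // !ad0r.
rewrite iterS; set z := iter j (ad y) z0 => nyy yyy.
have Vz : V z by exact: iter_V.
set x' := ad y z in nyy yyy *; have Vx' : V x' by exact: (lsad HV).
have [d Ed] := heisenberg_second_kernel hxy Vx' yyy.
have d0 : d != 0 by apply: contra_notN nyy => /eqP d0; rewrite Ed d0 scale0r.
have hx'y : heisenberg x' y (- d).
  by split=> //; rewrite ?oppr_eq0 // ad_anti Ed scaleNr.
have yx'z : ad y (ad x' z) = 0.
  by rewrite ad_jacobi Ed ad_scalarl add0r adxx.
have x'0 : x' != 0 by apply: contra_notN nyy => /eqP ->; rewrite ad0r.
have small : ~ large_centralizer y.
  move=> [v [Vv yv nv]]; have [M MP] := nilpotent_iter Vx'.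
  have [|i [ni]] := @last_outside _ (in_span1 y) (ad x') v M nv.
    by rewrite MP //; exists 0, 0; rewrite !scale0r addr0.
  rewrite iterS; set w := iter i (ad x') v => -[a [b E]].
  have yw : ad y w = 0 by exact: (heisenberg_stable hx'y).
  have a0 : a != 0.
    apply/eqP => a0; apply: ni; apply: (heisenberg_span hx'y yw (d := b)).
    by rewrite E a0 scale0r add0r.
  case/eqP: x'0; apply: (no_eigen_neg (t := ad w z) (a := - a)) => //.
  - by apply: (lsad HV) => //; exact: iter_V.
  - rewrite ad_anti ad_jacobi E adDl ad_scalarl addr0 adZl scaleNr.
    by rewrite (centralizer_comm (heisenberg_nonscal hx'y) yw yx'z) addr0.
  - by rewrite oppr_eq0.
split=> //; have [a [b E]] : in_span1 y (ad x' z).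
  apply: contrapT => n; apply: small; exists (ad x' z); split=> //.
  exact: (lsad HV).
have nx' : ~ scal x' by move=> /(scal_ad y)/eqP; rewrite Ed scaler_eq0 (negPf d0)
  oner_eq0.
exists x'; split=> //.
have [a0|a0] := eqVneq a 0; last first.
  (* s is chosen so that x' + s y' is an eigenvector of ad z, with eigenvalue - s *)
  pose y' := y + (b / a)%:A; pose s := sqrtC a.
  have s2 : s * s = a by rewrite -expr2 sqrtCK.
  have s0 : s != 0 by apply: contraNneq a0 => s0; rewrite -s2 s0 mul0r.
  have zy' : ad z y' = - x' by rewrite adDr ad_scalar addr0 ad_anti.
  have zx' : ad z x' = - (a *: y').
    by rewrite ad_anti E scalerDr scalerA mulrC divfK.
  have : x' + s *: y' = 0.
    apply: (no_eigen_neg (t := z) (a := - s)); rewrite ?oppr_eq0 //.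
      apply: (lsD HV) => //; apply/(lsZ HV)/(lsD HV) => //.
      exact/(ls_scal HV)/scal_k.
    have gen u w : - ((s * s) *: u) + s *: - w = - s *: (w + s *: u).
      by rewrite scalerN scaleNr scalerDr scalerA opprD addrC.
    by rewrite adDr adZr zy' zx' -gen s2.
  move/(congr1 (ad y)); rewrite ad0r adDr adZr adDr ad_scalar adxx addr0 scaler0 addr0.
  by rewrite Ed => /eqP; rewrite scaler_eq0 (negPf d0) oner_eq0.
exists (z + (b / d) *: y); split.
- by apply: (lsD HV) => //; exact: (lsZ HV).
- rewrite adDr adZr E a0 scale0r add0r (ad_anti x') Ed scalerN scalerA divfK //.
  by rewrite subrr.
- move=> [a' [b' E']].
  have L : ad y (z + (b / d) *: y) = x' by rewrite adDr adZr adxx scaler0 addr0.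
  have R : ad y (a' *: x' + b'%:A) = (a' * d)%:A.
    by rewrite adDr adZr ad_scalar addr0 Ed scalerA.
  have /eqP := congr1 (ad y) (congr1 (ad y) E'); rewrite L R Ed ad_scalar.
  by rewrite scaler_eq0 (negPf d0) oner_eq0.
Qed.

Hypothesis nonab : exists x y, [/\ V x, V y & ~ scal (ad x y)].

(** Take x outside the centralizer of y with [y, x] inside it. Then ad x acts on
this centralizer, and y' is the last non-scalar vector in the string of y. *)
Lemma heisenberg_of_nonscal y : V y -> ~ scal y ->
  exists x y' c, heisenberg x y' c /\ ad y y' = 0.
Proof.
move=> Vy ny; have [N NP] := nilpotent_iter Vy.
have [z Vz yz] : exists2 z, V z & ad y z <> 0.
  apply: contrapT => none; have [x1 [x2 [V1 V2 nsc]]] := nonab.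
  have comm z : V z -> ad y z = 0.
    by move=> Vz; apply: contrapT => yz; apply: none; exists z.
  by apply: nsc; rewrite (centralizer_comm ny (comm _ V1) (comm _ V2)); exact: scal0.
have [|j []] := @last_outside _ (fun z => ad y z = 0) (ad y) z N yz.
  by rewrite NP // ad0r.
rewrite iterS; set x := iter j (ad y) z => yx yyx.
have Vx : V x by exact: iter_V.
have [M MP] := nilpotent_iter Vx.
have [|i [ni [c Ec]]] := @last_outside _ (@scal K A) (ad x) y M ny.
  by rewrite MP //; exact: scal0.
have stable n : ad y (iter n (ad x) y) = 0.
  elim: n => [|n IH] /=; first exact: adxx.
  by rewrite ad_jacobi IH ad0r addr0 (centralizer_comm ny yyx IH).
exists x, (iter i (ad x) y), c; split=> //; split=> //; first exact: iter_V.
apply/eqP => c0; apply: yx; apply: (centralizer_comm ni).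
  exact/ad_sym/stable.
by apply: ad_sym; rewrite -iterS Ec c0 scale0r.
Qed.

(** By heisenberg_dichotomy a pair that fails leads to a large centralizer, and a
pair built inside a large centralizer cannot fail. *)
Lemma nilpotent_codim_one : exists x y c, heisenberg x y c /\ codim_one x y.
Proof.
have large y : V y -> ~ scal y -> large_centralizer y ->
    exists x y' c, heisenberg x y' c /\ codim_one x y'.
  move=> Vy ny [v [Vv yv nv]].
  have [x [y' [c [hxy yy']]]] := heisenberg_of_nonscal Vy ny.
  exists x, y', c; split=> //.
  have [//|[small _]] := heisenberg_dichotomy hxy.
  have in_y' w : V w -> ad y w = 0 -> in_span1 y' w.
    move=> Vw yw; apply: contrapT => n; apply: small; exists w; split=> //.
    exact: (centralizer_comm ny).
  have [a [b Ey]] := in_y' y Vy (adxx y); have [a' [b' Ev]] := in_y' v Vv yv.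
  have a0 : a != 0.
    by apply/eqP => a0; apply: ny; rewrite Ey a0 scale0r add0r; exact: scal_k.
  case: nv; exists (a' / a), (b' - a' / a * b).
  by rewrite Ey Ev scalerDr !scalerA divfK // scalerBl -[RHS]addrA [X in _ = _ +
    X]addrC subrK.
have [x1 [x2 [V1 _ nsc]]] := nonab.
have n1 : ~ scal x1.
  by move=> s1; apply: nsc; rewrite (scal_adl _ s1); exact: scal0.
have [x [y [c [hxy _]]]] := heisenberg_of_nonscal V1 n1.
have [cod|[_ [x' [Vx' nx' lx']]]] := heisenberg_dichotomy hxy.
  by exists x, y, c.
exact: large lx'.
Qed.

End Nilpotent.

Section JordanChain.
Variables (K : numClosedFieldType) (V : weyl K -> Prop).
Hypothesis HV : lie_space V.
Local Notation A := (weyl K).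
Implicit Types (t u v w z : A).
Hypothesis no_eigen : forall (t : A) mu z, V t -> eigen V t mu z -> z != 0 -> mu = 0.
Hypothesis nonab : exists x y : A, [/\ V x, V y & ~ scal (ad x y)].

Variables (x y : A) (c : K).
Hypotheses (hxy : heisenberg V x y c) (cod : codim_one V x y).

Let Vx : V x. Proof. by case: hxy. Qed.
Let Vy : V y. Proof. by case: hxy. Qed.
Let T n := iter n (ad x).
Let cent v := V v /\ ad y v = 0.

Let T_lin n a v w : T n (a *: v + w) = a *: T n v + T n w.
Proof. by elim: n => //= n; rewrite /T => /= ->; rewrite adDr adZr. Qed.
Let T0 n : T n 0 = 0.
Proof. by elim: n => //= n; rewrite /T => /= ->; rewrite ad0r. Qed.
Let T_cent n v : cent v -> cent (T n v).
Proof.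
by move=> [Vv yv]; split; [exact: (iter_V HV) | exact: (heisenberg_stable hxy)].
Qed.

(** On the centralizer of y the operator ad x is nilpotent with scalar kernel, so it
is a single Jordan block. Its size is at least 3, as otherwise all brackets in V
would be scalar. *)
Lemma chain_top : exists n z, [/\ (2 <= n)%N, cent z,
  exists2 d, d != 0 & T n z = d%:A & forall v, cent v -> T n.+1 v = 0].
Proof.
have [N0 N0P] := nilpotent_iter HV no_eigen Vx.
have [N NP Nmin] : exists2 N, (forall v, cent v -> T N v = 0) &
    forall m, (m < N)%N -> exists2 v, cent v & T m v <> 0.
  have : forall v, cent v -> T N0 v = 0 by move=> v [Vv _]; exact: N0P.
  elim: N0 {N0P} => [|M IH] all0; first by exists 0%N.
  have [/IH //|none] := pselect (forall v, cent v -> T M v = 0).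
  exists M.+1 => // m; rewrite ltnS => mM.
  have /existsNP[v /not_implyP[cv Tv]] := none.
  exists v => // Tm; apply: Tv; rewrite -(subnK mM) /T iterD.
  by have := T0 (M - m); rewrite /T => E; rewrite -[X in iter _ _ X]/(T m v) Tm E.
have ker v : cent v -> ad x v = 0 -> scal v.
  by move=> [_ yv] xv; exact: (heisenberg_commutant hxy).
have N3 : (3 <= N)%N.
  rewrite leqNgt; apply/negP => N2.
  have cent_scal v : cent v -> scal (ad x v).
    move=> cv; apply: ker; first exact: (T_cent 1 cv).
    rewrite -[LHS]/(T 2 v) -(subnK (n := 2) (m := N)) // /T iterD.
    by rewrite -[X in iter _ _ X]/(T N v) NP //; exact: T0.
  have [u [w [Vu Vw nuw]]] := nonab; apply: nuw.
  have [b ub] := cod Vu; have [d wd] := cod Vw.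
  have Cu : cent (u - b *: x) by split=> //; apply: (lsB HV) => //; exact: (lsZ HV).
  have Cw : cent (w - d *: x) by split=> //; apply: (lsB HV) => //; exact: (lsZ HV).
  rewrite -[u](subrK (b *: x)) -[w](subrK (d *: x)) ad_split.
  rewrite (centralizer_comm (heisenberg_nonscal hxy) ub wd) add0r.
  rewrite !adZl !adZr adxx !scaler0 addr0.
  by apply: scalB; apply: scalZ; rewrite ad_anti; apply/scalN/cent_scal.
have [|z cz Tz] := Nmin N.-1; first by lia.
exists N.-1, z; split=> //; [by lia| |by rewrite prednK //; lia].
have [d E] : scal (T N.-1 z).
  apply: ker; first exact: T_cent.
  by have := NP z cz; rewrite -[N in T N z]prednK //; lia.
by exists d => //; apply/eqP => d0; apply: Tz; rewrite E d0 scale0r.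
Qed.

Section Basis.
Variables (n : nat) (z : A) (d : K).
Hypotheses (n2 : (2 <= n)%N) (cz : cent z) (d0 : d != 0) (Tz : T n z = d%:A).
Hypothesis T_nil : forall v, cent v -> T n.+1 v = 0.

Let T_add i j v : T i (T j v) = T (i + j) v. Proof. by rewrite /T iterD. Qed.

(** For the kernel of (ad x)^m, by induction on m: (ad x)^m v is scalar, hence
cancelled by a multiple of the chain vector at distance m from the end. *)
Lemma chain_span v : cent v -> exists e : nat -> K, v = \sum_(i < n.+1) e i *: T i z.
Proof.
move=> cv; have : T n.+1 v = 0 by exact: T_nil.
have : (n.+1 <= n.+1)%N by [].
move: {1 3}n.+1 => m; elim: m v cv => [|m IH] v cv mn Tv.
  by exists (fun=> 0); rewrite -[LHS]/(T 0 v) Tv big1 // => i _; rewrite scale0r.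
have [k Ek] : scal (T m v).
  have [_ yv] := T_cent m cv; exact: (heisenberg_commutant hxy).
have mn' : (m <= n)%N by [].
pose w := - (k / d) *: T (n - m) z + v.
have cw : cent w.
  have [V1 y1] := T_cent (n - m) cz; have [V2 y2] := cv.
  by split; [exact: (lsL HV)|rewrite /w adDr adZr y1 y2 scaler0 addr0].
have Tw : T m w = 0.
  rewrite /w T_lin T_add subnKC // Tz Ek scalerA mulNr divfK //.
  by rewrite scaleNr addNr.
have [e E] := IH w cw (ltnW mn) Tw.
have nm : (n - m < n.+1)%N by rewrite ltnS leq_subr.
exists (fun i => e i + (k / d) * (i == n - m)%N%:R).
under eq_bigr => i _ do rewrite scalerDl.
rewrite big_split -E /= (bigD1 (Ordinal nm)) //= eqxx mulr1 big1 => [|i].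
  by rewrite addr0 /w scaleNr addrAC addNr add0r.
by rewrite -val_eqE /= => /negPf ->; rewrite mulr0 scale0r.
Qed.

Lemma chain_free (e : nat -> K) : \sum_(i < n.+1) e i *: T i z = 0 ->
  forall i, (i <= n)%N -> e i = 0.
Proof.
move=> E i; elim/ltn_ind: i => i IH i_n.
have iN : (i < n.+1)%N by [].
(* T (n - i) kills the terms after the i-th and sends T i z to the scalar d *)
have := congr1 (T (n - i)) E; rewrite T0 (bigD1 (Ordinal iN)) //= T_lin T_add subnK //.
have -> : T (n - i) (\sum_(j < n.+1 | j != Ordinal iN) e j *: T j z) = 0.
  elim/big_ind: _ => [|u v Eu Ev|j]; first exact: T0.
    by rewrite -[u]scale1r T_lin Eu Ev scaler0 addr0.
  rewrite -val_eqE neq_ltn /= => /orP[ji|ij].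
    by rewrite IH // ?scale0r ?T0 // ltnW // (leq_trans ji).
  rewrite -[_ *: _]addr0 T_lin T0 addr0 T_add.
  have -> : (n - i + j = (j - i.+1) + n.+1)%N by lia.
  by rewrite -T_add T_nil // T0 scaler0.
rewrite addr0 Tz scalerA => /eqP; rewrite scaler_eq0 mulf_eq0 (negPf d0) oner_eq0.
by rewrite !orbF => /eqP.
Qed.

(** X_0 = x and X_j = (ad x)^(j-1) z for j > 0. *)
Definition chain_basis (j : 'I_n.+1) : A := if j == 0%N :> nat then x else T j.-1 z.

Lemma comb_chain (e : {ffun 'I_n.+1 -> K^o}) :
  comb chain_basis e = e ord0 *: x + \sum_(i < n) e (lift ord0 i) *: T i z.
Proof. by rewrite /comb big_ord_recl /=. Qed.

Lemma filiform_model : exists F, is_model (L := filiform K n) V F.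
Proof.
have pos_neq0 (j : 'I_n.+1) : (0 < j)%N = (j != ord0) by rewrite lt0n.
have xb (j : 'I_n.+1) : (0 < j)%N -> ad x (chain_basis j) = T j z.
  by rewrite /chain_basis; case: (val j).
exists (comb chain_basis); apply: table_model => //.
- move=> j; rewrite /chain_basis; case: ifP => // _; exact: (proj1 (T_cent _ cz)).
- have fE (k : 'I_n.+1) : (0 < k)%N ->
      scal (ad (chain_basis ord0) (chain_basis k) -
      comb chain_basis (filiform_coef K ord0 k)).
    move=> k0; have -> : chain_basis ord0 = x by [].
    rewrite xb // /filiform_coef eqxx k0 /=.
    case: ltnP => kn.
      by rewrite comb_basis /chain_basis inordK ?ltnS // subrr; exact: scal0.
    have -> : k = n :> nat by apply/eqP; rewrite eqn_leq kn -ltnS ltn_ord.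
    by rewrite comb0 subr0 Tz; exact: scal_k.
  have f0 (i k : 'I_n.+1) : (0 < i)%N -> comb chain_basis (filiform_coef K i k) = 0.
    by rewrite pos_neq0 /filiform_coef => /negPf ->; exact: comb0.
  have f00 : comb chain_basis (filiform_coef K ord0 (ord0 : 'I_n.+1)) = 0.
    by rewrite /filiform_coef eqxx; exact: comb0.
  have case0 (i : 'I_n.+1) : i = ord0 \/ (0 < i)%N.
    by rewrite pos_neq0; have [|] := eqVneq i ord0; auto.
  move=> i j; rewrite combB; have [->|i0] := case0 i; have [->|j0] := case0 j.
  + by rewrite adxx f00 subrr subr0; exact: scal0.
  + by rewrite (f0 j) // subr0; exact: fE.
  + rewrite (f0 i) // sub0r opprK ad_anti addrC -opprB; apply/scalN.
    exact: fE.
  + rewrite (f0 i) // (f0 j) // subrr subr0.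
    have c_b (k : 'I_n.+1) : (0 < k)%N -> ad y (chain_basis k) = 0.
      rewrite /chain_basis lt0n => /negPf ->; exact: (proj2 (T_cent _ cz)).
    rewrite (centralizer_comm (heisenberg_nonscal hxy) (c_b i i0) (c_b j j0)).
    exact: scal0.
- move=> e; rewrite comb_chain => -[k E].
  have yS : ad y (\sum_(i < n) e (lift ord0 i) *: T i z) = 0.
    rewrite ad_sumr big1 // => i _.
    by rewrite adZr (proj2 (T_cent _ cz)) scaler0.
  have e0 : e ord0 = 0.
    have /eqP := congr1 (ad y) E; rewrite ad_scalar adDr yS addr0 adZr ad_anti.
    case: hxy => _ _ c0 ->; rewrite scalerN oppr_eq0 !scaler_eq0 (negPf c0) oner_eq0.
    by rewrite !orbF => /eqP.
  (* f n is the coefficient of the last chain vector, which absorbs the scalar k *)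
  pose f i : K := if insub i is Some j then e (lift ord0 (j : 'I_n)) else - (k / d).
  have fE (i : 'I_n) : f i = e (lift ord0 i) by rewrite /f valK.
  have f_n : f n = - (k / d) by rewrite /f insubF // ltnn.
  have f0 : forall i, (i <= n)%N -> f i = 0.
    apply: chain_free; rewrite big_ord_recr /= f_n Tz scalerA mulNr divfK //.
    rewrite scaleNr -E e0 scale0r add0r; apply/eqP; rewrite subr_eq0; apply/eqP.
    by apply: eq_bigr => i _; rewrite fE.
  apply/ffunP => j; rewrite ffunE; have [->//|j0] := eqVneq j ord0.
  have [i ->] : exists i, j = lift ord0 i.
    by case: (unliftP ord0 j) j0 => [i ->|->]; [exists i|rewrite eqxx].
  by rewrite -fE f0 // ltnW.
- move=> v Vv; have [b vb] := cod Vv.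
  have cvb : cent (v - b *: x) by split=> //; apply: (lsB HV) => //; exact: (lsZ HV).
  have [e E] := chain_span cvb.
  exists [ffun j : 'I_n.+1 => if j == ord0 then b else e j.-1].
  rewrite comb_chain ffunE eqxx.
  under eq_bigr => i _ do rewrite ffunE /=.
  rewrite opprD addrA E big_ord_recr /= addrAC Tz.
  have -> : \sum_(i < n) e i *: T i z - \sum_(i < n) e (bump 0 i).-1 *: T i z = 0.
    by apply/eqP; rewrite subr_eq0; apply/eqP/eq_bigr.
  by rewrite add0r; exact/scalZ/scal_k.
Qed.
End Basis.
End JordanChain.

(** * The classification *)

Lemma lift_nonabelian (K : numClosedFieldType) (g : lieSubalg (derivation (weyl K))) :
  ~ lie_abelian g ->
  exists x y, [/\ lift_space g x, lift_space g y & ~ scal (ad x y)].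
Proof.
move=> nab; apply: contrapT => none; apply: nab => D E.
have [x xD] := inner_surj (val D); have [y yE] := inner_surj (val E).
apply: val_inj; rewrite /= -xD -yE -inner_ad.
rewrite -[RHS](inner0 K); apply/inner_eq; rewrite subr0; apply: contrapT => nsc; apply:
  none; exists x, y.
by rewrite /lift_space xD yE; split=> //; exact: lsub_valP.
Qed.

Lemma finite_dimensional_pos (K : fieldType) (U : lmodType K) :
  finite_dimensional U -> exists (n : nat) (v : 'I_n.+1 -> U),
    forall x, exists a : 'I_n.+1 -> K, x = \sum_i a i *: v i.
Proof.
move=> [n [v vP]]; exists n, (fun i => if unlift ord0 i is Some j then v j else 0) => x.
have [a ->] := vP x.
exists (fun i => if unlift ord0 i is Some j then a j else 0).
rewrite big_ord_recl unlift_none scaler0 add0r.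
by apply: eq_bigr => i _; rewrite liftK.
Qed.

(** The two cases are whether some ad h has a nonzero eigenvalue on the preimage of g. *)
Lemma weyl_der_classification (K : numClosedFieldType)
    (g : lieSubalg (derivation (weyl K))) :
  finite_dimensional g -> ~ lie_abelian g ->
  lie_isomorphic g (sl K 2) \/
  lie_isomorphic g (sl_std K 2) \/
  (exists n : nat, (2 <= n)%N /\ lie_isomorphic g (filiform K n)) \/
  (exists n : nat, (2 <= n)%N /\ lie_isomorphic g (filiform_ext_mod K n)) \/
  (exists (n : nat) (i : 'I_n -> int),
     [/\ (1 <= n)%N, (forall k : 'I_n, 0 < i k),
         (forall j k : 'I_n, (j < k)%N -> i j < i k)
       & lie_isomorphic g (diag_lie K i)]).
Proof.
move=> /finite_dimensional_pos[m [v vP]] /lift_nonabelian nonab.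
have HV := lift_lie_space vP.
have [no_eigen|/existsNP[h /existsNP[l /existsNP[x]]]] := pselect (forall h mu z,
    lift_space g h -> eigen (lift_space g) h mu z -> z != 0 -> mu = 0); last first.
  move=> /not_implyP[Vh /not_implyP[hx /not_implyP[x0 /eqP l0]]].
  have [S [X [HG S0]]] := graded_exists HV Vh hx l0 x0.
  have [[F HF]|[[F HF]|[[n [n2 [F HF]]]|[n [i [n1 i0 ilt [F HF]]]]]]] :=
    graded_classification HV HG S0.
  - by left; exact: model_isomorphic HF.
  - by right; left; exact: model_isomorphic HF.
  - by do 3!right; left; exists n; split=> //; exact: model_isomorphic HF.
  - by do 4!right; exists n, i; split=> //; exact: model_isomorphic HF.
have [x [y [c [hxy cod]]]] := nilpotent_codim_one HV no_eigen nonab.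
have [n [z [n2 cz [d d0 Tz] T_nil]]] := chain_top HV no_eigen nonab hxy cod.
have [F HF] := filiform_model HV hxy cod n2 cz d0 Tz T_nil.
by do 2!right; left; exists n; split=> //; exact: model_isomorphic HF.
Qed.

Theorem theorem4p20 (R : realType) (g : lieSubalg (derivation (weyl R[i])))
    (g_fin : finite_dimensional g) (g_nonab : ~ lie_abelian g) :
  lie_isomorphic g (sl R[i] 2) \/
  lie_isomorphic g (sl_std R[i] 2) \/
  (exists n : nat, (2 <= n)%N /\ lie_isomorphic g (filiform R[i] n)) \/
  (exists n : nat, (2 <= n)%N /\ lie_isomorphic g (filiform_ext_mod R[i] n)) \/
  (exists (n : nat) (i : 'I_n -> int),
     [/\ (1 <= n)%N,
         (forall k : 'I_n, 0 < i k),
         (forall j k : 'I_n, (j < k)%N -> i j < i k)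
       & lie_isomorphic g (diag_lie R[i] i)]).
Proof. exact: weyl_der_classification. Qed.
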